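(* Let $\alpha$ be a peak composition and let $(P,\gamma)$ be a labeled poset. Then $$\omega(K^{(\beta)}_\alpha)=K^{(\beta)}_{\alpha^\flat}(\tfrac{x}{1-\beta x}),\qquad\psi(K^{(\beta)}_\alpha)=K^{(\beta)}_{\alpha}(\tfrac{x}{1-\beta x}),\qquad\rho(K^{(\beta)}_\alpha)=K^{(\beta)}_{\alpha^\flat},$$ and $$\omega(\Omega^{(\beta)}(P,\gamma))=\Omega^{(\beta)}(P^*,\gamma)(\tfrac{x}{1-\beta x}),\qquad\psi(\Omega^{(\beta)}(P,\gamma))=\Omega^{(\beta)}(P,\gamma)(\tfrac{x}{1-\beta x}),\qquad\rho(\Omega^{(\beta)}(P,\gamma))=\Omega^{(\beta)}(P^*,\gamma).$$ Moreover, the first three formulas also hold with $K^{(\beta)}$ replaced by $\bar K^{(\beta)}$ throughout.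
   Context: $f(\frac{x}{1-\beta x})$ denotes the power series obtained from $f\in\mathbb{Z}[\beta][[x_1,x_2,\dots]]$ by substituting $x_i\mapsto\frac{x_i}{1-\beta x_i}$ for every $i$. Compositions. A composition $\alpha=(\alpha_1,\dots,\alpha_k)$ is a finite sequence of positive integers, $|\alpha|=\sum\alpha_i$, $I(\alpha)=\{\alpha_1,\alpha_1+\alpha_2,\dots,\alpha_1+\cdots+\alpha_{k-1}\}$. With $n=|\alpha|$: $\alpha^{\mathtt r}$ is the reversal, $\alpha^{\mathtt c}$ is the composition of $n$ with $I(\alpha^{\mathtt c})=[n-1]\setminus I(\alpha)$, $\alpha^{\mathtt t}=(\alpha^{\mathtt c})^{\mathtt r}$. $\alpha$ is a peak composition if $\alpha_i\ge2$ for $1\le i<k$; then $\alpha^\flat=(\alpha_k+1,\alpha_{k-1},\dots,\alpha_2,\alpha_1-1)$ (with $\alpha^\flat=\alpha$ if $k\le1$). Involutions. $\mathfrak{m}\mathrm{QSym}$ is the module of all quasisymmetric power series over $\mathbb{Z}[\beta]$ (unbounded degree allowed), consisting of all possibly infinite linear combinations of the fundamental quasisymmetric functions $L_\alpha=\sum x_{i_1}\cdots x_{i_n}$ (sum over $i_1\le\cdots\le i_n$ with $i_j<i_{j+1}$ for $j\in I(\alpha)$, $n=|\alpha|$). $\omega,\psi,\rho$ are the continuous linear maps $\mathfrak{m}\mathrm{QSym}\to\mathfrak{m}\mathrm{QSym}$ (compatible with infinite linear combinations of the $L_\alpha$) with $\omega(L_\alpha)=L_{\alpha^{\mathtt t}}$,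 $\psi(L_\alpha)=L_{\alpha^{\mathtt c}}$, $\rho(L_\alpha)=L_{\alpha^{\mathtt r}}$. Marked sets. Let $\mathbb{M}=\{1'<1<2'<2<\cdots\}$, $|i'|=|i|=i$. For finite nonempty $S,T\subset\mathbb{M}$: $S\prec T$ means $\max S<\min T$, $S\preceq T$ means $\max S\le\min T$, $x^S=\prod_{i\in S}x_{|i|}$. Multipeak functions. For a tuple $S=(S_1,\dots,S_N)$ put $|S|=\sum|S_i|$, $x^S=\prod x^{S_i}$. For a peak composition $\alpha$ with $|\alpha|=N$: $K^{(\beta)}_\alpha=\sum_S\beta^{|S|-N}x^S$ over $N$-tuples of finite nonempty $S_i\subset\mathbb{M}$ with $S_1\preceq\cdots\preceq S_N$, $S_i\cap S_{i+1}\subset\{1',2',\dots\}$ if $i\in I(\alpha)$, and $S_i\cap S_{i+1}\subset\{1,2,\dots\}$ if $i\notin I(\alpha)$. $\bar K^{(\beta)}_\alpha=\sum_S\beta^{|S|-N}x^S$ over $N$-tuples of finite nonempty $S_i\subset\mathbb{M}$ with $S_1\preceq\cdots\preceq S_N$, $S_i\prec S_{i+1}$ if $i\in I(\alpha)$, $S_{i+1}\subseteq\mathbb{Z}_{>0}$ if $i\in\{0\}\cup I(\alpha)$, and $S_i\cap S_{i+1}\subseteq\mathbb{Z}_{>0}$ if $i\notin I(\alpha)$. Labeled posets. A labeled poset $(P,\gamma)$ is a finite poset with an injective map $\gamma:P\to\mathbb{Z}$; $s\lessdot t$ means $t$ covers $s$; $P^*$ is the dual poset. An enriched set-valued $(P,\gamma)$-partition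 is a map $\sigma$ from $P$ to finite nonempty subsets of $\mathbb{M}$ such that for each cover $s\lessdot t$: $\sigma(s)\preceq\sigma(t)$; if $\gamma(s)<\gamma(t)$ then $\sigma(s)\cap\sigma(t)\subset\{1,2,3,\dots\}$; if $\gamma(s)>\gamma(t)$ then $\sigma(s)\cap\sigma(t)\subset\{1',2',3',\dots\}$. $\Omega^{(\beta)}(P,\gamma)=\sum_\sigma\beta^{|\sigma|-|P|}x^\sigma$ over all of these, where $|\sigma|=\sum_{s}|\sigma(s)|$, $x^\sigma=\prod_sx^{\sigma(s)}$. *)

(* Defs.v *)
From HB Require Import structures.
From mathcomp Require Import all_boot all_order all_algebra finmap.
From mathcomp Require Import boolp classical_sets cardinality fsbigop.
From mathcomp Require Import monalg.

Set Implicit Arguments.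
Unset Strict Implicit.
Unset Printing Implicit Defensive.

Import Order.TTheory GRing.Theory Num.Theory.

Local Open Scope classical_set_scope.
Local Open Scope ring_scope.

(* Z[beta] is {poly int} with beta = 'X.  The variables
   x_1, x_2, ... are numbered from 0, so that monomials are {cmonom nat} and
   i : nat stands for the index i + 1. *)
Definition pseries := {cmonom nat} -> {poly int}.

(* The generating series sum_(t in A) w t * x^(mon t).  In every use below only
   finitely many t have a given mon t, as \sum_(_ \in _) requires: it is 0 on
   infinite supports. *)
Definition genseries (T : choiceType) (A : set T) (w : T -> {poly int})
    (mon : T -> {cmonom nat}) : pseries :=
  fun m => \sum_(t \in [set t | A t /\ mon t = m]) w t.

Definition ps1 : pseries := fun m => (m == mone)%:R.

Definition psmul (f g : pseries) : pseries :=
  fun m => \sum_(p \in [set p : {cmonom nat} * {cmonom nat} |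
                          mmul p.1 p.2 = m]) f p.1 * g p.2.

Definition psexp (f : pseries) (k : nat) : pseries := iter k (psmul f) ps1.

(* The result of substituting x_i |-> h i in f; the sum giving a coefficient
   is finite if each h i is a multiple of x_i. *)
Definition pssubst (h : nat -> pseries) (f : pseries) : pseries :=
  fun n => \sum_(m \in [set: {cmonom nat}])
    f m * (\big[psmul/ps1]_(i <- finsupp m) psexp (h i) (m i)) n.

(* x_i / (1 - beta x_i) = sum_(k >= 1) beta^(k-1) x_i^k *)
Definition geom (i : nat) : pseries :=
  genseries [set k | (0 < k)%N] (fun k => 'X^(k.-1)) (expcmn (ucm i)).

Definition at_geom (f : pseries) : pseries := pssubst geom f.

Definition is_comp (a : seq nat) : bool := all (fun i => 0 < i)%N a.

Definition descents (a : seq nat) : seq nat :=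
  [seq sumn (take j a) | j <- iota 1 (size a).-1].

(* The composition of n with descent set the increasing sequence s. *)
Definition comp_of_descents (n : nat) (s : seq nat) : seq nat :=
  if n is 0 then [::] else pairmap (fun i j => j - i)%N 0%N (rcons s n).

Definition comp_compl (a : seq nat) : seq nat :=
  comp_of_descents (sumn a)
    [seq i <- iota 1 (sumn a).-1 | i \notin descents a].

Lemma descents_cons (x y : nat) (s : seq nat) :
  descents [:: x, y & s] = x :: [seq (x + i)%N | i <- descents (y :: s)].
Proof.
rewrite /descents /= ?take0 /= ?addn0; congr (_ :: _).
by rewrite (iotaDl 1 1) -!map_comp; apply: eq_map => -[].
Qed.

Lemma comp_of_descents_aux (p n : nat) (s : seq nat) :
  path ltn p (rcons s n) ->
  let q := pairmap (fun i j => j - i)%N p (rcons s n) in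
  [/\ is_comp q, (p + sumn q)%N = n & [seq (p + i)%N | i <- descents q] = s].
Proof.
elim: s p => [|x s IHs] p /= => [/andP[ltpn _]|/andP[ltpx /IHs]].
  by rewrite subn_gt0 ltpn addn0 subnKC // ltnW.
case=> cq sq dq; rewrite subn_gt0 ltpx cq addnA subnKC ?(ltnW ltpx) //.
case Eq: (pairmap _ _ _) cq sq dq => [|y q] _ sq dq.
  by move/(congr1 size): Eq; rewrite size_pairmap size_rcons.
rewrite descents_cons /= subnKC ?(ltnW ltpx) //; split=> //.
rewrite -[X in _ = _ :: X]dq -map_comp; congr (_ :: _).
by apply: eq_map => i /=; rewrite addnA subnKC // ltnW.
Qed.

Lemma comp_complP (a : seq nat) :
  [/\ is_comp (comp_compl a), sumn (comp_compl a) = sumn a &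
      descents (comp_compl a) =
        [seq i <- iota 1 (sumn a).-1 | i \notin descents a]].
Proof.
rewrite /comp_compl /comp_of_descents; case: (sumn a) => [|n] //=.
set s := filter _ _.
have ps : path ltn 0 (rcons s n.+1).
  rewrite -cats1 cat_path /= andbT path_min_sorted; last first.
    by apply/allP => i; rewrite mem_filter mem_iota => /and3P[].
  rewrite (sorted_filter ltn_trans _ (iota_ltn_sorted 1 n)) /=.
  have : last 0%N s \in 0%N :: s by exact: mem_last.
  rewrite inE mem_filter mem_iota => /orP[/eqP-> //|/and3P[_ _]].
  by rewrite add1n.
have [cq sq dq] := comp_of_descents_aux ps; split=> //.
by rewrite -[LHS]map_id.
Qed.

Definition comp_transp (a : seq nat) : seq nat := rev (comp_compl a).

Definition is_peak (a : seq nat) : bool :=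
  is_comp a && all (fun i => 2 <= i)%N (take (size a).-1 a).

Definition flat (a : seq nat) : seq nat :=
  if a is a1 :: b :: s
  then (last b s).+1 :: rcons (rev (belast b s)) a1.-1
  else a.

(* Entries of a word or tuple are numbered from 1. *)
Definition fund_word (a : seq nat) (w : seq nat) : Prop :=
  size w = sumn a /\
  forall j, (0 < j < sumn a)%N ->
    (nth 0 w j.-1 <= nth 0 w j)%N /\
    (j \in descents a -> nth 0 w j.-1 < nth 0 w j)%N.

Definition word_mon (w : seq nat) : {cmonom nat} :=
  \big[mmul/mone]_(i <- w) ucm i.

Definition fundL (a : seq nat) : pseries :=
  genseries (fund_word a) (fun=> 1) word_mon.

(* The infinite linear combination sum_a c_a F_a over all compositions a. *)
Definition lincomb (c : seq nat -> {poly int}) (F : seq nat -> pseries) :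
    pseries :=
  fun m => \sum_(a \in [set a | is_comp a]) c a * F a m.

Definition mQSym : set pseries := [set f | exists c, f = lincomb c fundL].

(* The coefficients of f on the fundamental quasisymmetric functions; they are
   unique on compositions (lincomb_inj), and by convention zero if f is not in
   mQSym. *)
Definition fund_coef (f : pseries) : seq nat -> {poly int} :=
  xget (fun=> 0) [set c | f = lincomb c fundL].

(* The continuous linear map on mQSym with fundL a |-> F a (see fund_extE). *)
Definition fund_ext (F : seq nat -> pseries) (f : pseries) : pseries :=
  lincomb (fund_coef f) F.

Lemma word_monE (w : seq nat) (j : nat) : word_mon w j = count_mem j w.
Proof.
elim: w => [|i w IHw]; first by rewrite /word_mon big_nil cm1.
by rewrite /word_mon big_cons cmM -/(word_mon w) IHw cmU.
Qed.

Lemma fund_word_sorted (a w : seq nat) : fund_word a w -> sorted leq w.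
Proof.
move=> [sz Hw]; apply/(sortedP 0%N) => i ltiw.
by have [] := Hw i.+1 _; rewrite -?sz.
Qed.

Lemma descents_gt0 (a : seq nat) (i : nat) :
  is_comp a -> i \in descents a -> (0 < i)%N.
Proof.
case: a => [|x a] //= /andP[x0 _] /mapP[[|j]]; first by rewrite mem_iota.
by move=> _ ->; rewrite /= addn_gt0 x0.
Qed.

Lemma descents_sorted (a : seq nat) : is_comp a -> sorted ltn (descents a).
Proof.
elim: a => [|x [|y s] IHs] // /andP[x0 cs].
rewrite descents_cons /= path_min_sorted; last first.
  by apply/allP => _ /mapP[i di ->]; rewrite /= -{1}(addn0 x) ltn_add2l;
     exact: descents_gt0 di.
by rewrite sorted_map (eq_sorted (e' := ltn)) ?IHs // => i j /=;
   rewrite ltn_add2l.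
Qed.

Lemma size_descents (a : seq nat) : size (descents a) = (size a).-1.
Proof. by rewrite size_map size_iota. Qed.

Lemma descents_inj (a b : seq nat) : is_comp a -> is_comp b ->
  sumn a = sumn b -> descents a = descents b -> a = b.
Proof.
elim: a b => [|x a IHa] [|y b] //=.
- by case/lastP: b => // [|b' z] _ /andP[]; case: y.
- by move=> /andP[]; case: x.
move=> /andP[x0 ca] /andP[y0 cb].
case: a ca IHa => [|x' a] ca IHa; case: b cb => [|y' b] cb.
- by rewrite /= !addn0 => ->.
- by move=> _ /(congr1 size); rewrite !size_descents.
- by move=> _ /(congr1 size); rewrite !size_descents.
move=> eqs; rewrite !descents_cons => -[eqxy]; subst y.
move/(inj_map (@addnI x)) => eqd; congr (_ :: _).
by apply: IHa => //; apply/eqP; rewrite -(eqn_add2l x) eqs.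
Qed.

Fixpoint block_word (b : seq nat) (k : nat) : seq nat :=
  if b is x :: b' then nseq x k ++ block_word b' k.+1 else [::].

Lemma size_block_word (b : seq nat) (k : nat) :
  size (block_word b k) = sumn b.
Proof. by elim: b k => //= x b IHb k; rewrite size_cat size_nseq IHb. Qed.

Lemma block_wordP (b : seq nat) (k j : nat) :
  is_comp b -> (0 < j < sumn b)%N ->
  (nth 0 (block_word b k) j.-1 <= nth 0 (block_word b k) j)%N /\
  (j \in descents b) =
    (nth 0 (block_word b k) j.-1 < nth 0 (block_word b k) j)%N.
Proof.
elim: b k j => [|x b IHb] k j; first by rewrite andbF.
move=> /andP[x0 cb] /andP[j0 jlt]; rewrite /= !nth_cat size_nseq !nth_nseq.
have ltj1 : (j.-1 < j)%N by rewrite prednK.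
case: (ltngtP j x) => [ltjx|ltxj|eqjx].
- rewrite (ltn_trans ltj1 ltjx) leqnn ltnn; split=> //.
  case: b cb IHb jlt => [|y b] cb IHb jlt //.
  rewrite descents_cons inE (ltn_eqF ltjx) /=; apply/mapP => -[i _ eqj].
  by move: ltjx; rewrite eqj ltnNge leq_addr.
- have lexj : (x <= j.-1)%N by rewrite -ltnS prednK.
  rewrite ltnNge lexj /=.
  case: b cb IHb jlt => [|y b] cb IHb jlt.
    by move: jlt; rewrite /= addn0 ltnNge (ltnW ltxj).
  have -> : (j.-1 - x = (j - x).-1)%N by rewrite -!subn1 subnAC.
  have jx0 : (0 < j - x < sumn (y :: b))%N.
    by rewrite subn_gt0 ltxj /= ltn_subLR // ltnW.
  have [le1 eq1] := IHb k.+1 (j - x)%N cb jx0.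
  rewrite le1 -eq1; split=> //.
  rewrite descents_cons inE (gtn_eqF ltxj) /=.
  by rewrite -{1}(subnKC (ltnW ltxj)) mem_map //; exact: addnI.
- rewrite eqjx prednK // leqnn subnn; move: jlt; rewrite eqjx.
  case: b cb IHb => [|y b] cb IHb; first by rewrite /= addn0 ltnn.
  move=> _; rewrite descents_cons inE eqxx /=.
  by move: cb => /andP[]; case: y {IHb} => //= y _ _; rewrite ltnS leqnn leqnSn.
Qed.

Lemma fund_word_block (b : seq nat) : is_comp b -> fund_word b (block_word b 0).
Proof.
move=> cb; split; first exact: size_block_word.
by move=> j /(block_wordP 0 cb) [? ->].
Qed.

Lemma fund_word_size (a b : seq nat) : is_comp a -> is_comp b ->
  fund_word a (block_word b 0) -> a <> b ->
  sumn a = sumn b /\ (size a < size b)%N.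
Proof.
move=> ca cb [sz Hw] neab; move: sz; rewrite size_block_word => /esym eqs.
split=> //; rewrite ltnNge; apply/negP => leba; apply: neab.
have sub : {subset descents a <= descents b}.
  move=> j dj; have j0 : (0 < j < sumn a)%N.
    rewrite (descents_gt0 ca dj) /=; move: dj => /mapP[i]; rewrite mem_iota.
    move=> /andP[i0 ilt] ->; rewrite -{2}(cat_take_drop i a) sumn_cat.
    rewrite -{1}(addn0 (sumn (take i a))) ltn_add2l.
    have : (0 < size (drop i a))%N.
      by rewrite size_drop subn_gt0; move: ilt i0; rewrite add1n;
         case: (size a) => [|n] //=; case: i.
    have /allP cd : is_comp (drop i a).
      by apply/allP => x /mem_drop; move/allP: ca; apply.
    by case: (drop i a) cd => // x s cd _; rewrite /= addn_gt0 cd ?mem_head.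
  have [_ /(_ dj) lt1] := Hw j j0.
  by rewrite (block_wordP 0 cb _).2 // -eqs.
have ud c : is_comp c -> uniq (descents c).
  by move/descents_sorted; apply: sorted_uniq => //; [exact: ltn_trans|exact: ltnn].
apply: descents_inj => //; apply: (@sorted_eq _ leq) => //.
- exact: leq_trans.
- exact: anti_leq.
- by apply: sub_sorted (descents_sorted ca) => i j; exact: ltnW.
- by apply: sub_sorted (descents_sorted cb) => i j; exact: ltnW.
apply: uniq_perm; rewrite ?ud //.
have [] // := uniq_min_size (ud a ca) sub _.
by rewrite !size_descents -!subn1 leq_sub2r.
Qed.

Lemma fundL_block1 (a b : seq nat) : fund_word a (block_word b 0) ->
  fundL a (word_mon (block_word b 0)) = 1.
Proof.
move=> fab; rewrite /fundL /genseries -[RHS](fsbig_set1 +%R (block_word b 0) (fun=> 1)).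
apply: eq_fsbigl; apply/seteqP; split=> [w [fw eqm]|w ->] //=.
apply: (@sorted_eq _ leq) (leq_trans) (anti_leq) _ _ _ _ _.
- exact: fund_word_sorted fw.
- exact: fund_word_sorted fab.
by apply/allP => j _ /=; rewrite -!word_monE eqm.
Qed.

Lemma fundL_block0 (a b : seq nat) : is_comp b ->
  ~ fund_word a (block_word b 0) -> fundL a (word_mon (block_word b 0)) = 0.
Proof.
move=> cb nfab; rewrite /fundL /genseries.
rewrite (_ : [set _ | _] = set0) ?fsbig_set0 //.
apply/seteqP; split=> // w [fw eqm]; apply: nfab.
suff <- : w = block_word b 0 by [].
apply: (@sorted_eq _ leq) (leq_trans) (anti_leq) _ _ _ _ _.
- exact: fund_word_sorted fw.
- exact: fund_word_sorted (fund_word_block cb).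
by apply/allP => j _ /=; rewrite -!word_monE eqm.
Qed.

Lemma finite_comps (n : nat) : finite_set [set a | is_comp a /\ sumn a = n].
Proof.
apply: (@sub_finite_set _ _ [set` [seq [seq i <- map val (tval t) | (0 < i)%N]
                                   | t : n.-tuple 'I_n.+1]]).
  move=> a [ca san] /=.
  have sza : (size a <= n)%N.
    by rewrite -san; elim: a ca {san} => //= x a IHa /andP[x0 /IHa];
       rewrite -add1n; apply: leq_add.
  have sz : size (map (@inord n) (a ++ nseq (n - size a) 0%N)) == n.
    by rewrite size_map size_cat size_nseq subnKC.
  apply/mapP; exists (Tuple sz); first by rewrite mem_enum.
  rewrite /= -map_comp map_id_in; last first.
    move=> x; rewrite mem_cat mem_nseq => xin /=; rewrite inordK // ltnS.
    case/orP: xin => [xa|/andP[_ /eqP->] //].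
    by rewrite -san sumnE (big_rem x) //= leq_addr.
  rewrite filter_cat filter_nseq /= cats0.
  by apply/esym/all_filterP.
exact: finite_seq.
Qed.

Lemma lincomb_block (c : seq nat -> {poly int}) (b : seq nat) : is_comp b ->
  lincomb c fundL (word_mon (block_word b 0)) =
    c b + \sum_(a \in [set a | is_comp a /\ sumn a = sumn b] `\ b)
             c a * fundL a (word_mon (block_word b 0)).
Proof.
move=> cb; rewrite /lincomb.
rewrite -(fsbig_widen [set a | is_comp a /\ sumn a = sumn b]).
- rewrite (fsbigD1 b); [|exact: finite_comps|by []].
  by rewrite fundL_block1 ?mulr1 //; exact: fund_word_block.
- by move=> a [].
move=> a [/= ca nab]; rewrite fundL_block0 ?mulr0 // => -[sz _].
by apply: nab; rewrite -sz size_block_word.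
Qed.

Lemma lincomb_inj (c c' : seq nat -> {poly int}) :
  lincomb c fundL = lincomb c' fundL -> forall a, is_comp a -> c a = c' a.
Proof.
move=> eqcc' a; have [n] := ubnP (size a); elim: n a => // n IHn b.
rewrite ltnS => szb cb.
move/(congr1 (fun f => f (word_mon (block_word b 0)))): eqcc'.
rewrite !lincomb_block // => eqb.
apply: (@addIr _ _ _ _ (etrans eqb _)); congr (_ + _); apply: eq_fsbigr => a.
rewrite inE /= => -[[ca sab] neab].
have [fab|nfab] := pselect (fund_word a (block_word b 0)).
  by rewrite IHn // (leq_trans _ szb) //; have [] := fund_word_size ca cb fab neab.
by rewrite fundL_block0 ?mulr0.
Qed.

Lemma fund_extE (F : seq nat -> pseries) (c : seq nat -> {poly int}) :
  fund_ext F (lincomb c fundL) = lincomb c F.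
Proof.
have eqc : lincomb c fundL = lincomb (fund_coef (lincomb c fundL)) fundL.
  by apply: (@xgetPex _ _ [set c' | lincomb c fundL = lincomb c' fundL]); exists c.
apply/funext => m; apply: eq_fsbigr => a; rewrite inE /= => ca.
by rewrite -(lincomb_inj eqc).
Qed.

Lemma fund_extL (F : seq nat -> pseries) (a : seq nat) : is_comp a ->
  fund_ext F (fundL a) = F a.
Proof.
move=> ca; pose c (b : seq nat) : {poly int} := (b == a)%:R.
have lc G : lincomb c G = G a.
  apply/funext => m; rewrite /lincomb -(fsbig_widen [set a]).
  - by rewrite fsbig_set1 /c eqxx mul1r.
  - by move=> b ->.
  - by move=> b [_ /eqP /negPf neb]; rewrite /= /c neb mul0r.
by rewrite -{1}(lc fundL) fund_extE lc.
Qed.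

Definition omega : pseries -> pseries :=
  fund_ext (fun a => fundL (comp_transp a)).
Definition psi : pseries -> pseries :=
  fund_ext (fun a => fundL (comp_compl a)).
Definition rho : pseries -> pseries :=
  fund_ext (fun a => fundL (rev a)).

(* i' is (i, false) and i is (i, true), so that the lexicographic order is
   1' < 1 < 2' < 2 < ... *)
Definition marked : orderType _ := (nat *l bool)%type.

Definition unprimed (x : marked) : bool := x.2.

Definition mabs (x : marked) : nat := x.1.

(* For nonempty sets, max S < min T and max S <= min T. *)
Definition fprec (S T : {fset marked}) : Prop :=
  forall s t, s \in S -> t \in T -> (s < t)%O.
Definition fpreceq (S T : {fset marked}) : Prop :=
  forall s t, s \in S -> t \in T -> (s <= t)%O.

Definition meet_primed (S T : {fset marked}) : Prop :=
  forall s, s \in S -> s \in T -> ~~ unprimed s.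
Definition meet_unprimed (S T : {fset marked}) : Prop :=
  forall s, s \in S -> s \in T -> unprimed s.

Definition set_mon (S : {fset marked}) : {cmonom nat} :=
  \big[mmul/mone]_(s <- S) ucm (mabs s).

Definition tuple_card (S : seq {fset marked}) : nat := (\sum_(A <- S) #|` A|)%N.

Definition tuple_mon (S : seq {fset marked}) : {cmonom nat} :=
  \big[mmul/mone]_(A <- S) set_mon A.

Definition entry (S : seq {fset marked}) (i : nat) : {fset marked} :=
  nth fset0 S i.-1.

Definition mpeak_tuple (a : seq nat) (S : seq {fset marked}) : Prop :=
  [/\ size S = sumn a,
      (forall A, A \in S -> A != fset0) &
      forall i, (0 < i < sumn a)%N ->
        [/\ fpreceq (entry S i) (entry S i.+1),
            i \in descents a -> meet_primed (entry S i) (entry S i.+1) &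
            i \notin descents a -> meet_unprimed (entry S i) (entry S i.+1)]].

Definition mpeakK (a : seq nat) : pseries :=
  genseries (mpeak_tuple a) (fun S => 'X^(tuple_card S - sumn a)) tuple_mon.

Definition mpeakbar_tuple (a : seq nat) (S : seq {fset marked}) : Prop :=
  [/\ size S = sumn a,
      (forall A, A \in S -> A != fset0),
      (forall i, (0 < i < sumn a)%N ->
        [/\ fpreceq (entry S i) (entry S i.+1),
            i \in descents a -> fprec (entry S i) (entry S i.+1) &
            i \notin descents a -> meet_unprimed (entry S i) (entry S i.+1)]) &
      forall i, (i < sumn a)%N -> i \in 0%N :: descents a ->
        forall s, s \in entry S i.+1 -> unprimed s].

Definition mpeakKbar (a : seq nat) : pseries :=
  genseries (mpeakbar_tuple a) (fun S => 'X^(tuple_card S - sumn a)) tuple_mon.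

Definition covers (d : Order.disp_t) (P : finPOrderType d) (s t : P) : Prop :=
  (s < t)%O /\ forall z, ~ (s < z < t)%O.

Definition enriched_part (d : Order.disp_t) (P : finPOrderType d)
    (g : P -> int) (sg : {ffun P -> {fset marked}}) : Prop :=
  (forall s, sg s != fset0) /\
  forall s t, covers s t ->
    [/\ fpreceq (sg s) (sg t),
        g s < g t -> meet_unprimed (sg s) (sg t) &
        g t < g s -> meet_primed (sg s) (sg t)].

Definition part_card (P : finType) (sg : {ffun P -> {fset marked}}) : nat :=
  (\sum_s #|` sg s|)%N.

Definition part_mon (P : finType) (sg : {ffun P -> {fset marked}}) :
    {cmonom nat} :=
  \big[mmul/mone]_s set_mon (sg s).

Definition Omega (d : Order.disp_t) (P : finPOrderType d) (g : P -> int) :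
    pseries :=
  genseries (enriched_part g) (fun sg => 'X^(part_card sg - #|P|)) (@part_mon P).

(* Main.v *)
(* Read a set-valued partition one letter at a time: the letters 1', 1, 2', 2, ...
   act on functions of the set U of elements that already hold a letter, so the
   coefficient of x_1^(e_1) x_2^(e_2) ... is a matrix entry of T_(e_1) T_(e_2) ...,
   where T(x) = sum_n T_n x^n = A'(x) A(x) multiplies the operators of a primed
   and of an unprimed letter.  On such coefficients psi replaces T(x) by the
   inverse of T(-x), rho reverses the product, and omega = psi rho.  So the psi
   formulas say that T(-x) T(x / (1 - beta x)) = 1.  For labeled posets this
   follows from A'(z1) A(z2) = 1 = A(z1) A'(z2) when z1 + z2 + beta z1 z2 = 0, a
   sign-reversing toggle of the element with the least label.  The primed operator
   of a bar multipeak function becomes that of the ordinary one when multiplied by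
   an operator G with G(z1) G(z2) = 1.
   Reversing the order of the letters and exchanging the primed and unprimed
   ones gives rho for labeled posets.  It sends the chain of a peak
   composition a to a chain whose T is again that of flat a: summing over primes
   shows that T only depends on the peaks, since the elements sharing an absolute
   value form an interval without interior peak, of weight 2 + beta x.  In the
   bar case this weight is replaced by 1 if the interval contains the first
   element after a peak, or, after the reversal, the last one before a peak; the
   two resulting T are conjugate by a constant bidiagonal matrix. *)
Require Import Defs.
From HB Require Import structures.
From mathcomp Require Import all_boot all_order all_algebra finmap.
From mathcomp Require Import boolp classical_sets cardinality fsbigop.
From mathcomp Require Import monalg zify ring.
From mathcomp Require Import finset.

Set Implicit Arguments.
Unset Strict Implicit.
Unset Printing Implicit Defensive.

Import Order.TTheory GRing.Theory Num.Theory.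

Local Open Scope ring_scope.

(** * Letter operators *)

(** That [psi] inverts letters is visible on a single [fundL]. An exponent list cuts the positions
    into runs of equal letters, with descents allowed at the cuts only. Complementing the descent
    set reverses what is forbidden inside a run, and when a run is divided into a part obeying the
    first rule and a part obeying the second, the signed sum over the dividing points telescopes to
    zero. The resulting relation extends to infinite combinations and determines [psi], so only the
    existence of an expansion in [fundL] is used. The letter operators act over an arbitrary
    commutative ring because the letter variable is specialized twice: to power series, since
    $x/(1-\beta x)$ is not a polynomial, and to a polynomial variable when intervals of a chain are
    weighed. On a chain only initial segments [U] matter, so $T$ becomes a matrix indexed by
    $0,\dots,N$. Conjugate matrices give the same series in the bar case because the conjugating
    matrix fixes the final vector and leaves the entry at $0$ unchanged. *)

Lemma big_set_split (Q : finType) (S : nmodType) (z : Q) (F : {set Q} -> S) :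
  \sum_(B : {set Q}) F B = \sum_(C : {set Q} | z \notin C) (F C + F (z |: C)).
Proof.
rewrite big_split /= (bigID (fun B : {set Q} => z \notin B)) /=; congr (_ + _).
rewrite (reindex_onto (fun C => z |: C) (fun B : {set Q} => B :\ z)) /=.
  apply: eq_bigl => C; rewrite setU11 /=.
  by apply/eqP/idP => [<-|zC]; rewrite ?setD11 // setU1K.
by move=> B /negbNE zB; rewrite setD1K.
Qed.

Section Step.
Variables (Q : finType) (S : comNzRingType).
Implicit Types (U X B C : {set Q}) (L : rel {set Q}) (v : {set Q} -> S).

(** Each element of [B] that already holds a letter costs a factor [b]; along a complete run the
    exponent of [b] becomes $|\sigma|-|P|$. *)
Definition step L (b z : S) v U : S :=
  \sum_(B : {set Q} | L U B) z ^+ #|B| * b ^+ #|B :&: U| * v (U :|: B).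

Lemma card_two_steps U B C :
  (#|B :&: U| + #|C :&: (U :|: B)| = #|(B :|: C) :&: U| + #|B :&: C|)%N.
Proof.
have -> : C :&: (U :|: B) = (C :&: U) :|: (B :&: C).
  by apply/setP => x; rewrite !inE; case: (x \in C); rewrite ?andbF ?andbT.
have -> : (B :|: C) :&: U = (B :&: U) :|: (C :&: U) by rewrite setIUl.
rewrite !cardsU.
have -> : (C :&: U) :&: (B :&: C) = (B :&: U) :&: (C :&: U).
  by apply/setP => x; rewrite !inE; do !case: (x \in _).
have h1 : (#|(B :&: U) :&: (C :&: U)| <= #|B :&: U|)%N by rewrite subset_leq_card ?subsetIl.
have h2 : (#|(B :&: U) :&: (C :&: U)| <= #|C :&: U|)%N by rewrite subset_leq_card ?subsetIr.
lia.
Qed.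

(** After grouping by the union [X] of both steps, the outer factor no longer depends on how [X] is
    split. An element placed in both steps pays one extra [b], which gives the exponent
    [#|B :&: C|]. *)
Lemma step2E L1 L2 (b z1 z2 : S) v U :
  step L1 b z1 (step L2 b z2 v) U =
  \sum_(X : {set Q}) b ^+ #|X :&: U| * v (U :|: X) *
    \sum_(B : {set Q}) \sum_(C : {set Q} |
       [&& B :|: C == X, L1 U B & L2 (U :|: B) C])
      z1 ^+ #|B| * z2 ^+ #|C| * b ^+ #|B :&: C|.
Proof.
transitivity (\sum_(X : {set Q}) \sum_(B : {set Q}) \sum_(C : {set Q} |
   [&& B :|: C == X, L1 U B & L2 (U :|: B) C])
   z1 ^+ #|B| * b ^+ #|B :&: U| *
     (z2 ^+ #|C| * b ^+ #|C :&: (U :|: B)| * v (U :|: B :|: C))).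
  rewrite exchange_big /= /step big_mkcond; apply: eq_bigr => B _.
  rewrite (exchange_big_dep (fun C => L1 U B && L2 (U :|: B) C)) /=; last first.
    by move=> X C _ /andP[].
  case: ifP => /= _; last by rewrite big_pred0.
  rewrite big_distrr /=; apply: eq_bigr => C LC.
  rewrite (big_pred1 (B :|: C)) // => X; rewrite LC andbT.
  by rewrite eq_sym.
apply: eq_bigr => X _; rewrite big_distrr /=; apply: eq_bigr => B _.
rewrite big_distrr /=; apply: eq_bigr => C /andP[/eqP <- _].
rewrite setUA; set V := v _.
transitivity (z1 ^+ #|B| * z2 ^+ #|C| * V *
    (b ^+ #|B :&: U| * b ^+ #|C :&: (U :|: B)|)); first by ring.
by rewrite -exprD card_two_steps exprD; ring.
Qed.

(* z can be toggled between lying in the first step only, in the second only,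
   and in both; the three weights add up to z1 + z2 + b z1 z2 = 0. *)
Lemma step_cancel L1 L2 (b z1 z2 : S) v U :
    z1 + z2 + b * z1 * z2 = 0 ->
    L1 U set0 -> L2 U set0 ->
    (forall X, X != set0 -> exists2 z, z \in X &
       forall B C, B :|: C = X :\ z ->
       L1 U (z |: B) && L2 (U :|: (z |: B)) C = L1 U B && L2 (U :|: B) (z |: C) /\
       L1 U (z |: B) && L2 (U :|: (z |: B)) (z |: C) =
         L1 U B && L2 (U :|: B) (z |: C)) ->
  step L1 b z1 (step L2 b z2 v) U = v U.
Proof.
move=> hz L10 L20 tog; rewrite step2E (bigD1 set0) //= [X in _ + X]big1 => [|X X0].
  rewrite set0I cards0 expr0 mul1r setU0 addr0.
  rewrite (bigD1 set0) //= [X in _ + X]big1 => [|B B0].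
    rewrite (big_pred1 set0) => [|C]; last first.
      by rewrite set0U setU0 L10 /=; case: eqP => [->|].
    by rewrite set0I cards0 !expr0 addr0 !mulr1.
  by apply: big_pred0 => C; rewrite setU_eq0 (negPf B0).
have [z zX {}tog] := tog X X0.
rewrite [X in _ * X](_ : _ = 0) ?mulr0 // (big_set_split z) big1 // => B zB.
rewrite big_mkcond /= (big_set_split z) [X in _ + X]big_mkcond.
rewrite [X in _ + X](big_set_split z) -big_split /=.
apply: big1 => C zC.
have zBC : z \notin B :|: C by rewrite inE negb_or zB.
have eqX (D : {set Q}) : z \notin D -> (z |: D == X) = (D == X :\ z).
  move=> zD; apply/eqP/eqP => [<-|->]; [by rewrite setU1K|exact: setD1K].
have -> : (B :|: C == X) = false.
  by apply: contraNF zBC => /eqP ->.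
have -> : (z |: B) :|: (z |: C) = z |: (B :|: C) by rewrite setUACA setUid.
have -> : (z |: B) :|: C = z |: (B :|: C) by rewrite setUA.
have -> : B :|: (z |: C) = z |: (B :|: C) by rewrite setUCA.
rewrite eqX // /= add0r.
have [eX|_] := eqVneq; last by rewrite !addr0.
have [t1 t2] := tog B C eX.
rewrite /= t1 t2; case: ifP => _; last by rewrite !addr0.
have zBI : z \notin B :&: C by rewrite inE (negPf zB).
have -> : B :&: (z |: C) = B :&: C.
  by rewrite setIUr (_ : _ :&: [set z] = set0) ?set0U //; apply/setP => x;
     rewrite !inE; case: eqP => [->|]; rewrite ?(negPf zB) ?andbF.
have -> : (z |: B) :&: C = B :&: C.
  by rewrite setIUl (_ : [set z] :&: _ = set0) ?set0U //; apply/setP => x;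
     rewrite !inE; case: eqP => [->|]; rewrite ?(negPf zC) ?andbF.
rewrite -setUIr !cardsU1 zB zC zBI !exprD !expr1.
transitivity (z1 ^+ #|B| * z2 ^+ #|C| * b ^+ #|B :&: C| * (z1 + z2 + b * z1 * z2)).
  by ring.
by rewrite hz mulr0.
Qed.
End Step.

(** [true] stands for unprimed letters. [smark] says which kinds of letters an element may hold,
    [spair] when two related elements may share a letter. Posets, chains, their bar versions and all
    reversals fit this format. *)
Record sys (Q : finType) := Sys {
  srel : rel Q; smark : bool -> pred Q; spair : bool -> rel Q }.

(** * Legal placements of one letter and their cancellation *)

Section Legal.
Variable Q : finType.
Implicit Types (U X B C : {set Q}) (c pr : rel Q) (mk : pred Q).

(** Letters are read in increasing order, so nothing related below a member of [U] may still receive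
    one: this is the second clause. *)
Definition legal c mk pr : rel {set Q} := fun U B =>
  [&& [forall s in B, mk s], [forall s in B, forall t in U, ~~ c s t] &
      [forall s in B, forall t in B, c s t ==> pr s t]].

Lemma legalP c mk pr U B :
  reflect [/\ forall s, s \in B -> mk s,
              forall s t, s \in B -> t \in U -> ~~ c s t &
              forall s t, s \in B -> t \in B -> c s t -> pr s t]
          (legal c mk pr U B).
Proof.
apply: (iffP and3P) => -[h1 h2 h3]; split.
- by move=> s sB; exact: (forall_inP h1).
- by move=> s t sB tU; have /forall_inP/(_ _ tU) := forall_inP h2 s sB.
- move=> s t sB tB; have /forall_inP/(_ _ tB) := forall_inP h3 s sB.
  by move/implyP.
- by apply/forall_inP.
- by apply/forall_inP => s sB; apply/forall_inP => t tU; apply: h2.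
- apply/forall_inP => s sB; apply/forall_inP => t tU; apply/implyP; exact: h3.
Qed.

Lemma legal0 c mk pr U : legal c mk pr U set0.
Proof. by apply/legalP; split=> [s|s t|s t]; rewrite inE. Qed.

(** In the first step [z] may share the letter with elements below it but not above it, in the
    second step the other way round. So each of the three placements of [z] is legal under the same
    condition [R]: the rest is legal, nothing in [U :|: B] lies above [z] and nothing in [C] lies
    below it. *)
Lemma legal_toggle c mk1 mk2 pr1 pr2 U (z : Q) B C :
    ~~ c z z -> mk1 z = mk2 z ->
    (forall t, mk1 z -> t \in B :|: C -> mk1 t || mk2 t ->
       [/\ c z t -> ~~ pr1 z t, c t z -> pr1 t z,
           c t z -> ~~ pr2 t z & c z t -> pr2 z t]) ->
  let L1 := legal c mk1 pr1 in let L2 := legal c mk2 pr2 in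
  L1 U (z |: B) && L2 (U :|: (z |: B)) C = L1 U B && L2 (U :|: B) (z |: C) /\
  L1 U (z |: B) && L2 (U :|: (z |: B)) (z |: C) =
    L1 U B && L2 (U :|: B) (z |: C).
Proof.
move=> czz mkz hz L1 L2.
pose R := [/\ mk1 z, L1 U B, L2 (U :|: B) C,
  forall t, t \in U :|: B -> ~~ c z t & forall s, s \in C -> ~~ c s z].
have l1 : L1 U (z |: B) && L2 (U :|: (z |: B)) C <-> R.
  split=> [/andP[/legalP[m1 n1 p1] /legalP[m2 n2 p2]]|
           [mz /legalP[m1 n1 p1] /legalP[m2 n2 p2] nz1 nz2]].
    have mz : mk1 z by rewrite m1 ?setU11.
    split=> //.
    - apply/legalP; split=> [s sB|s t sB|s t sB tB].
      + by rewrite m1 // setU1r.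
      + by apply: n1; rewrite setU1r.
      + by apply: p1; rewrite setU1r.
    - apply/legalP; split=> // s t sC tUB; apply: n2 => //.
      by move: tUB; rewrite !inE => /orP[->//|->]; rewrite !orbT.
    - move=> t; rewrite inE => /orP[tU|tB]; first by apply: n1; rewrite ?setU11.
      apply/negP => czt; have [] := hz t mz; rewrite ?inE ?tB ?m1 ?setU1r //.
      by move/(_ czt)/negP => h _ _ _; apply: h; apply: p1; rewrite ?setU11 ?setU1r.
    - by move=> s sC; apply: n2; rewrite // !inE eqxx orbT.
  apply/andP; split; apply/legalP; split=> //.
  - by move=> s /setU1P[->//|/m1].
  - by move=> s t /setU1P[-> tU|sB]; [apply: nz1; rewrite inE tU|apply: n1].
  - move=> s t /setU1P[->|sB] /setU1P[->|tB].
    + by rewrite (negPf czz).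
    + by rewrite (negPf (nz1 t _)) // inE tB orbT.
    + by move=> csz; have [] := hz s mz; rewrite ?inE ?sB ?m1 // => _ /(_ csz).
    + exact: p1.
  - move=> s t sC; rewrite !inE => /or3P[tU|/eqP->|tB]; last 2 first.
    + exact: nz2.
    + by apply: n2; rewrite // inE tB orbT.
    by apply: n2; rewrite // inE tU.
have l2 : L1 U B && L2 (U :|: B) (z |: C) <-> R.
  split=> [/andP[/legalP[m1 n1 p1] /legalP[m2 n2 p2]]|
           [mz /legalP[m1 n1 p1] /legalP[m2 n2 p2] nz1 nz2]].
    have mz : mk1 z by rewrite mkz m2 ?setU11.
    split=> //; first exact/legalP.
    - apply/legalP; split=> [s sB|s t sB|s t sB tB].
      + by rewrite m2 // setU1r.
      + by apply: n2; rewrite setU1r.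
      + by apply: p2; rewrite setU1r.
    - by move=> t; apply: n2; rewrite setU11.
    - move=> s sC; apply/negP => csz.
      have [] := hz s mz; rewrite ?inE ?sC ?m2 ?orbT ?setU1r //.
      by move=> _ _ /(_ csz)/negP h _; apply: h; apply: p2; rewrite ?setU11 ?setU1r.
  apply/andP; split; apply/legalP; split=> //.
  - by move=> s /setU1P[->|/m2//]; rewrite -mkz.
  - by move=> s t /setU1P[->|sB]; [apply: nz1|apply: n2].
  - move=> s t /setU1P[->|sC] /setU1P[->|tC].
    + by rewrite (negPf czz).
    + move=> czt; have [] := hz t mz; rewrite ?inE ?tC ?m2 ?orbT // => _ _ _.
      exact.
    + by rewrite (negPf (nz2 _ _)).
    + exact: p2.
have l3 : L1 U (z |: B) && L2 (U :|: (z |: B)) (z |: C) <-> R.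
  split=> [/andP[h1 /legalP[m2 n2 p2]]|].
    apply/l1; rewrite h1 /=; apply/legalP; split=> [s sC|s t sC tU|s t sC tC].
    - by rewrite m2 ?setU1r.
    - by apply: n2; rewrite ?setU1r.
    - by apply: p2; rewrite ?setU1r.
  move=> r; have [_ _ _ nz1 nz2] := r.
  move/l1: (r) => /andP[h1 /legalP[m2 n2 p2]]; rewrite h1 /=.
  move/l2: (r) => /andP[_ /legalP[m2' n2' p2']].
  apply/legalP; split=> // s t /setU1P[->|sC] //; last exact: n2.
  by rewrite setUCA => /setU1P[->//|]; apply: nz1.
by split; apply/idP/idP; rewrite ?l1 ?l2 ?l3.
Qed.

Variable S : comNzRingType.

Lemma step_legal_cancel c mk1 mk2 pr1 pr2 (b z1 z2 : S) v U :
    z1 + z2 + b * z1 * z2 = 0 -> irreflexive c ->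
    (forall X, X != set0 -> exists2 z, z \in X & mk1 z = mk2 z /\
      forall t, mk1 z -> t \in X -> mk1 t || mk2 t ->
       [/\ c z t -> ~~ pr1 z t, c t z -> pr1 t z,
           c t z -> ~~ pr2 t z & c z t -> pr2 z t]) ->
  step (legal c mk1 pr1) b z1 (step (legal c mk2 pr2) b z2 v) U = v U.
Proof.
move=> hz ci h; apply: step_cancel => //; try exact: legal0.
move=> X /h[z zX [mz hz']]; exists z => // B C eX.
apply: legal_toggle => //; first by rewrite ci.
by move=> t mz1; rewrite eX inE => /andP[_]; exact: hz'.
Qed.

Lemma step_label_cancel c (g : Q -> int) (b z1 z2 : S) v U :
    z1 + z2 + b * z1 * z2 = 0 -> (forall s t, c s t -> g s != g t) ->
  step (legal c predT (fun s t => g t < g s)) b z1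
    (step (legal c predT (fun s t => g s < g t)) b z2 v) U = v U.
Proof.
move=> hz cg; apply: step_legal_cancel => //.
  by move=> s; apply/negP => /cg; rewrite eqxx.
move=> X /set0Pn[x0 x0X].
exists [arg min_(x < x0 in X) g x]%O; case: arg_minP => // z zX zmin; split=> // t _ tX _.
have := zmin t tX; rewrite le_eqVlt => /orP[/eqP e|ltzt].
  by split=> /cg; rewrite e eqxx.
by split=> //; rewrite -leNgt ltW.
Qed.

(** Negating the labels exchanges the two pair conditions; the toggled element now has the greatest
    label. *)
Lemma step_label_cancel' c (g : Q -> int) (b z1 z2 : S) v U :
    z1 + z2 + b * z1 * z2 = 0 -> (forall s t, c s t -> g s != g t) ->
  step (legal c predT (fun s t => g s < g t)) b z1
    (step (legal c predT (fun s t => g t < g s)) b z2 v) U = v U.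
Proof.
move=> hz cg; have := @step_label_cancel c (fun x => - g x) b z1 z2 v U hz.
have E1 : (fun s t => - g t < - g s) = (fun s t => g s < g t).
  by apply/funext => s; apply/funext => t; rewrite ltrN2.
have E2 : (fun s t => - g s < - g t) = (fun s t => g t < g s).
  by apply/funext => s; apply/funext => t; rewrite ltrN2.
rewrite E1 E2; apply => s t /cg; by rewrite eqr_opp.
Qed.

Definition sstep (Y : sys Q) (p : bool) (b z : S) :=
  step (legal (srel Y) (smark Y p) (spair Y p)) b z.
Definition vstep (Y : sys Q) (b z : S) (v : {set Q} -> S) :=
  sstep Y false b z (sstep Y true b z v).

End Legal.

(** * Cancellation for bar systems *)

Section BarCancel.
Variables (Q : finType) (S : comNzRingType) (c : rel Q) (g : Q -> int).
Variable (fs : pred Q).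
Hypothesis cg : forall s t, c s t -> g s != g t.
Hypothesis gfs : forall s t, c s t -> (g t < g s) = fs t.
Hypothesis fsfs : forall s t, c s t -> fs t -> ~~ fs s.
Implicit Types (U X B C : {set Q}) (v : {set Q} -> S).

Let none : rel Q := fun _ _ => false.
Let up : rel Q := fun s t => g s < g t.
Let dn : rel Q := fun s t => g t < g s.
Let Lbar := legal c (fun s => ~~ fs s) none.
Let Lfst := legal c fs none.

(** Under the ordinary primed rule related [s], [t] share a letter only if [fs t], and then [s] is
    not in [fs]. So giving the letter to [X] amounts to giving it first to the elements outside [fs]
    and then to those inside, and this splitting is forced. *)
Lemma legal_bar_split U X B C : B :|: C = X ->
  Lbar U B && Lfst (U :|: B) C =
  [&& legal c predT dn U X, B == X :\: [set x | fs x] & C == X :&: [set x | fs x]].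
Proof.
move=> eX; apply/andP/and3P.
  case=> /legalP[m1 n1 p1] /legalP[m2 n2 p2]; split.
  - apply/legalP; split=> // s t; rewrite -eX.
      move=> /setUP[sB|sC] tU; first exact: n1.
      by apply: n2; rewrite // inE tU.
    move=> /setUP[sB|sC] /setUP[tB|tC] cst; rewrite /dn.
    + by have := p1 s t sB tB cst.
    + by rewrite gfs ?m2.
    + by have := n2 s t sC; rewrite inE tB orbT cst => /(_ isT).
    + by have := p2 s t sC tC cst.
  - rewrite -eX; apply/eqP/setP => x; rewrite !inE.
    move: (m1 x) (m2 x); case: (x \in B); case: (x \in C); case: (fs x) => // h1 h2;
      first [by have := h1 isT | by have := h2 isT].
  - rewrite -eX; apply/eqP/setP => x; rewrite !inE.
    move: (m1 x) (m2 x); case: (x \in B); case: (x \in C); case: (fs x) => // h1 h2;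
      first [by have := h1 isT | by have := h2 isT].
case=> /legalP[_ n p] /eqP eB /eqP eC; split; apply/legalP; split.
- by move=> s; rewrite eB !inE => /andP[].
- by move=> s t; rewrite eB inE => /andP[_ sX]; exact: n.
- move=> s t; rewrite eB !inE => /andP[_ sX] /andP[nt tX] cst.
  by have := p s t sX tX cst; rewrite /dn gfs // (negPf nt).
- by move=> s; rewrite eC !inE => /andP[].
- move=> s t; rewrite eC !inE => /andP[sX fsx] /orP[tU|]; first exact: n.
  rewrite eB !inE => /andP[nt tX]; apply/negP => cst.
  by have := p s t sX tX cst; rewrite /dn gfs // (negPf nt).
- move=> s t; rewrite eC !inE => /andP[_ fsx] /andP[_ ft] cst.
  by have := fsfs cst ft; rewrite fsx.
Qed.

Lemma step_bar_fst (b z : S) v U :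
  step Lbar b z (step Lfst b z v) U = step (legal c predT dn) b z v U.
Proof.
rewrite step2E [RHS]big_mkcond; apply: eq_bigr => X _.
set F := [set x | fs x].
transitivity (b ^+ #|X :&: U| * v (U :|: X) *
   (if legal c predT dn U X then z ^+ #|X| else 0)); last first.
  by case: ifP => _; rewrite ?mulr0 //; ring.
congr (_ * _); rewrite (bigD1 (X :\: F)) //= [X in _ + X]big1 => [|B neB]; last first.
  apply: big_pred0 => C; case: eqP => //= eX; rewrite (legal_bar_split _ eX).
  by rewrite (negPf neB) andbF.
rewrite addr0 big_mkcond (bigD1 (X :&: F)) //= [X in _ + X]big1 => [|C neC]; last first.
  case: eqP => //= eX; rewrite (legal_bar_split _ eX).
  by rewrite (negPf neC) !andbF.
have eX : X :\: F :|: X :&: F = X by rewrite setUC setID.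
rewrite eX eqxx /= (legal_bar_split _ eX) !eqxx !andbT.
rewrite addr0; case: ifP => // _.
rewrite -exprD addnC cardsID (_ : _ :&: _ = set0) ?cards0 ?mulr1 //.
by apply/setP => x; rewrite !inE; case: (fs x); rewrite ?andbF.
Qed.

(** No two elements of [fs] are related, so any element of [X] can be toggled. *)
Lemma step_fst_cancel (b z1 z2 : S) v U : z1 + z2 + b * z1 * z2 = 0 ->
  step Lfst b z1 (step Lfst b z2 v) U = v U.
Proof.
move=> hz; apply: step_legal_cancel => //.
  by move=> s; apply/negP => /cg; rewrite eqxx.
move=> X /set0Pn[z zX]; exists z => //; split=> // t fz _; rewrite orbb => ft.
by split=> // /fsfs; rewrite ?ft ?fz => /(_ isT).
Qed.

Lemma vstep_bar_cancel (b z1 z2 : S) v U (Y := Sys c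
    (fun p s => p || ~~ fs s) (fun p s t => p && (g s < g t))) : z1 + z2 + b * z1 * z2 = 0 ->
  vstep Y b z1 (vstep Y b z2 v) U = v U.
Proof.
move=> hz; have hz' : z2 + z1 + b * z2 * z1 = 0 by rewrite -hz; ring.
pose A := legal c predT up.
rewrite -[LHS]/(step Lbar b z1 (step A b z1 (step Lbar b z2 (step A b z2 v))) U). set w := step A b z2 v.
(* Insert $G(z_2)G(z_1)=1$ in front of [w], where $G$ is the operator of [Lfst]. The bar operator at
   [z2] followed by $G(z_2)$ is the ordinary primed operator, which cancels against [A] at [z1];
   then $G(z_1)$ completes the remaining bar operator in the same way. *)
have -> : w = step Lfst b z2 (step Lfst b z1 w).
  by apply/funext => V; rewrite step_fst_cancel.
set w' := step Lfst b z1 w.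
have -> : step Lbar b z2 (step Lfst b z2 w') = step (legal c predT dn) b z2 w'.
  by apply/funext => V; rewrite step_bar_fst.
have -> : step A b z1 (step (legal c predT dn) b z2 w') = w'.
  by apply/funext => V; rewrite step_label_cancel'.
by rewrite step_bar_fst step_label_cancel.
Qed.

Lemma vstep_label_cancel (b z1 z2 : S) v U (Y := Sys c (fun _ _ => true)
    (fun p s t => if p then g s < g t else g t < g s)) : z1 + z2 + b * z1 * z2 = 0 ->
  vstep Y b z1 (vstep Y b z2 v) U = v U.
Proof.
move=> hz; rewrite -[LHS]/(step (legal c predT dn) b z1 (step (legal c predT up) b z1
  (step (legal c predT dn) b z2 (step (legal c predT up) b z2 v))) U).
set A := step _ b z2 v.
have -> : step (legal c predT up) b z1 (step (legal c predT dn) b z2 A) = A.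
  by apply/funext => V; rewrite step_label_cancel'.
exact: step_label_cancel.
Qed.
End BarCancel.

(** * Power series and inverse letters *)

Section PowerSeries.
Variable R : comNzRingType.

(** The cancellation lemmas hold over any commutative ring; this one contains both $-x$ and
    $x/(1-bx)$. *)
Definition fps : Type := nat -> R.
HB.instance Definition _ := gen_eqMixin fps.
HB.instance Definition _ := gen_choiceMixin fps.

Implicit Types f g h : fps.

Definition fps_mul f g : fps := fun n => \sum_(i < n.+1) f i * g (n - i)%N.

Definition fps_zero : fps := fun=> 0.
Definition fps_add f g : fps := fun n => f n + g n.
Definition fps_opp f : fps := fun n => - f n.

Lemma fps_addA : associative fps_add.
Proof. by move=> f g h; apply/funext => n; rewrite /fps_add addrA. Qed.
Lemma fps_addC : commutative fps_add.
Proof. by move=> f g; apply/funext => n; rewrite /fps_add addrC. Qed.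
Lemma fps_add0 : left_id fps_zero fps_add.
Proof. by move=> f; apply/funext => n; rewrite /fps_add add0r. Qed.
Lemma fps_addN : left_inverse fps_zero fps_opp fps_add.
Proof. by move=> f; apply/funext => n; rewrite /fps_add addNr. Qed.

HB.instance Definition _ :=
  GRing.isZmodule.Build fps fps_addA fps_addC fps_add0 fps_addN.

Let trunc n f : {poly R} := \poly_(i < n.+1) f i.

(** Coefficients up to degree [n] only see truncations, so associativity and commutativity are
    inherited from polynomials. *)
Lemma fps_mulE n m f g : (m <= n)%N -> fps_mul f g m = (trunc n f * trunc n g)`_m.
Proof.
move=> mn; rewrite coefM; apply: eq_bigr => i _; rewrite !coef_poly.
by rewrite !ltnS (leq_trans _ mn) ?(leq_trans _ mn) // ?leq_subr // -ltnS.
Qed.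

Lemma fps_mulA : associative fps_mul.
Proof.
move=> f g h; apply/funext => n.
transitivity ((trunc n f * (trunc n g * trunc n h))`_n).
  rewrite coefM; apply: eq_bigr => i _.
  by rewrite coef_poly ltn_ord (@fps_mulE n) ?leq_subr.
rewrite mulrA coefM; apply: eq_bigr => i _.
by rewrite coef_poly ltnS leq_subr (@fps_mulE n) // -ltnS.
Qed.

Lemma fps_mulC : commutative fps_mul.
Proof. by move=> f g; apply/funext => n; rewrite !(@fps_mulE n) // mulrC. Qed.

Definition fps_const (a : R) : fps := fun n => if n is 0 then a else 0.

Lemma fps_constM a f n : fps_mul (fps_const a) f n = a * f n.
Proof. by rewrite /fps_mul big_ord_recl /= subn0 big1 ?addr0 // => i _; rewrite mul0r. Qed.

Lemma fps_mul1 : left_id (fps_const 1) fps_mul.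
Proof. by move=> f; apply/funext => n; rewrite fps_constM mul1r. Qed.

Lemma fps_mulDl : left_distributive fps_mul +%R.
Proof.
move=> f g h; apply/funext => n; rewrite -[RHS]/(fps_mul f h n + fps_mul g h n).
by rewrite -big_split; apply: eq_bigr => i _; exact: mulrDl.
Qed.

Lemma fps_1neq0 : fps_const 1 != 0.
Proof. by apply/eqP => /(congr1 (fun f => f 0%N))/eqP; rewrite oner_eq0. Qed.

HB.instance Definition _ := GRing.Zmodule_isComNzRing.Build fps
  fps_mulA fps_mulC fps_mul1 fps_mulDl fps_1neq0.

Lemma fps_sumE (J : Type) (r : seq J) (P : pred J) (F : J -> fps) n :
  (\sum_(j <- r | P j) F j) n = \sum_(j <- r | P j) F j n.
Proof. by elim/big_rec2: _ => // j y f _ <-. Qed.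

Lemma fps_constE a f n : (fps_const a * f) n = a * f n.
Proof. exact: fps_constM. Qed.

Lemma fps_const_mul a b : fps_const (a * b) = fps_const a * fps_const b.
Proof. by apply/funext => -[|n]; rewrite fps_constE ?mulr0. Qed.

Lemma fps_const_exp a n : fps_const (a ^+ n) = fps_const a ^+ n.
Proof. by elim: n => // n IHn; rewrite !exprS fps_const_mul IHn. Qed.

Definition fps_X : fps := fun n => (n == 1)%N%:R.

Lemma fps_XE f n : (fps_X * f) n = if n is n'.+1 then f n' else 0.
Proof.
rewrite -[LHS]/(fps_mul _ _ _) /fps_mul; case: n => [|n].
  by rewrite big_ord1 mul0r.
rewrite 2!big_ord_recl /= mul0r mul1r add0r big1 ?addr0 ?subSS ?subn0 // => i _.
by rewrite mul0r.
Qed.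

Lemma fps_negXn d f n :
  ((- fps_X) ^+ d * f) n = if (d <= n)%N then (-1) ^+ d * f (n - d)%N else 0.
Proof.
rewrite (exprNn fps_X) -mulrA.
have eN : fps_const ((-1) ^+ d) = (-1) ^+ d.
  rewrite fps_const_exp; congr (_ ^+ _).
  by apply/funext => -[|m] //; apply/esym; exact: oppr0.
rewrite -eN fps_constE {eN}.
have -> : (fps_X ^+ d * f) n = if (d <= n)%N then f (n - d)%N else 0.
  elim: d n => [|d IHd] n; first by rewrite expr0 mul1r subn0.
  by rewrite exprS -mulrA fps_XE; case: n => // n; rewrite IHd.
by case: ifP; rewrite ?mulr0.
Qed.

Variable b : R.

(* x / (1 - b x) *)
Definition fps_geom : fps := fun n => if n is n'.+1 then b ^+ n' else 0.

Lemma fps_geomP : - fps_X + fps_geom + fps_const b * - fps_X * fps_geom = 0.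
Proof.
apply/funext => n; rewrite mulrN mulNr -mulrA.
rewrite -[LHS]/(- fps_X n + fps_geom n - (fps_const b * (fps_X * fps_geom)) n).
rewrite fps_constE fps_XE; case: n => [|[|n]]; rewrite /fps_X /=.
- by rewrite mulr0 oppr0 !addr0.
- by rewrite mulr0 subr0 expr0 addNr.
- by rewrite oppr0 add0r exprS subrr.
Qed.

Lemma fps_geom_gt n k : (n < k)%N -> (fps_geom ^+ k) n = 0.
Proof.
elim: k n => // k IHk n; rewrite ltnS => nk; rewrite exprS.
rewrite -[LHS]/(fps_mul _ _ _) /fps_mul big1 // => -[[|i] /= lti] _.
  by rewrite mul0r.
by rewrite IHk ?mulr0 // ; lia.
Qed.

Lemma partition_size (I : finType) (P : pred I) (d : I -> nat) n (F : I -> R) :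
  \sum_(k < n.+1) \sum_(i | P i && (d i == k)) F i =
  \sum_(i | P i && (d i <= n)%N) F i.
Proof.
rewrite (exchange_big_dep P) /=; last by move=> k i _ /andP[].
rewrite [RHS]big_mkcondr; apply: eq_bigr => i Pi; rewrite Pi /=.
case: (leqP (d i) n) => [dn|nd].
  by rewrite (big_pred1 (Ordinal (dn : (d i < n.+1)%N))) // => k; rewrite eq_sym.
by rewrite big_pred0 // => k; apply/eqP => e; move: nd; rewrite e ltnNge -ltnS ltn_ord.
Qed.

(** * Coefficients of $T(z)$ for an abstract transition system *)

Section Transition.
Variables (V : Type) (I : finType) (P : V -> pred I) (d : I -> nat).
Variables (wt : V -> I -> R) (t : V -> I -> V).
Implicit Types (v : V -> R) (w : V -> fps) (U : V).

(** [coef_op n] is $T_n$, [ser_op z] is $T(z)$, and [geom_op n] is the coefficient of $x^n$ in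
    $T(x/(1-bx))$. *)
Definition coef_op n v U : R :=
  \sum_(i | P U i && (d i == n)) wt U i * v (t U i).
Definition geom_op n v U : R :=
  \sum_(k < n.+1) (fps_geom ^+ k) n * coef_op k v U.
Definition ser_op (z : fps) w U : fps :=
  \sum_(i | P U i) z ^+ d i * fps_const (wt U i) * w (t U i).

Lemma ser_op_geom v U n :
  ser_op fps_geom (fun V => fps_const (v V)) U n = geom_op n v U.
Proof.
rewrite /ser_op fps_sumE /geom_op; under [RHS]eq_bigr => k _ do rewrite big_distrr /=.
transitivity (\sum_(k < n.+1) \sum_(i | P U i && (d i == k))
   (fps_geom ^+ d i) n * (wt U i * v (t U i))); last first.
  by apply: eq_bigr => k _; apply: eq_bigr => i /andP[_ /eqP ->].
rewrite partition_size big_mkcondr; apply: eq_bigr => i _.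
rewrite -mulrA -fps_const_mul mulrC fps_constE; case: leqP => [_|/fps_geom_gt ->].
  by rewrite mulrC.
by rewrite mulr0.
Qed.

Lemma ser_op_negX w U n : ser_op (- fps_X) w U n =
  \sum_(k < n.+1) (-1) ^+ k * coef_op k (fun V => w V (n - k)%N) U.
Proof.
rewrite /ser_op fps_sumE; under [RHS]eq_bigr => k _ do rewrite big_distrr /=.
transitivity (\sum_(k < n.+1) \sum_(i | P U i && (d i == k))
   (-1) ^+ d i * (wt U i * w (t U i) (n - d i)%N)); last first.
  by apply: eq_bigr => k _; apply: eq_bigr => i /andP[_ /eqP ->].
rewrite partition_size big_mkcondr; apply: eq_bigr => i _.
by rewrite -mulrA fps_negXn fps_constE.
Qed.

Hypothesis ser_op_cancel : forall w U, ser_op (- fps_X) (ser_op fps_geom w) U = w U.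
Hypothesis coef_op0 : forall v U, coef_op 0 v U = v U.

Lemma coef_geom_cancel n v U :
  \sum_(k < n.+1) (-1) ^+ k * coef_op k (geom_op (n - k) v) U = (n == 0%N)%:R * v U.
Proof.
have /(congr1 (fun f => f n)) := ser_op_cancel (fun V => fps_const (v V)) U.
rewrite ser_op_negX => e.
transitivity (fps_const (v U) n); last by case: n {e} => [|n]; rewrite /= ?mul1r ?mul0r.
rewrite -e; apply: eq_bigr => k _; congr (_ * _); congr (coef_op _ _ _).
by apply/funext => W; rewrite ser_op_geom.
Qed.

Lemma coef_op_sum n (J : Type) (r : seq J) (a : J -> R) (v : J -> V -> R) U :
  coef_op n (fun W => \sum_(j <- r) a j * v j W) U =
  \sum_(j <- r) a j * coef_op n (v j) U.
Proof.
rewrite /coef_op; under eq_bigr => i _ do rewrite big_distrr /=.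
rewrite exchange_big /=; apply: eq_bigr => j _; rewrite big_distrr /=.
by apply: eq_bigr => i _; rewrite mulrCA.
Qed.

Lemma foldr_coef_op_sum (J : Type) (r : seq J) (a : J -> R) (v : J -> V -> R) p U :
  foldr coef_op (fun W => \sum_(j <- r) a j * v j W) p U =
  \sum_(j <- r) a j * foldr coef_op (v j) p U.
Proof.
elim: p U => //= n p IHp U; rewrite -coef_op_sum; congr (coef_op _ _ _).
exact/funext.
Qed.
End Transition.

(* g e is obtained from f e by replacing the (noncommuting) coefficient T_b of
   each letter by the coefficient of the series inverse to sum_i (-1)^i T_i;
   H p q mixes letters T (in p) and inverse letters (in q). *)
Definition psi_rel (f g : seq nat -> R) : Prop := exists H : seq nat -> seq nat -> R,
  [/\ forall p, H p [::] = f p, forall q, H [::] q = g q,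
      forall p q, H (rcons p 0%N) q = H p q &
      forall (p q : seq nat) (n : nat), \sum_(i < n.+1) (-1) ^+ i * H (rcons p i) ((n - i)%N :: q) =
        (n == 0%N)%:R * H p q].

(** The term [i = 0] of the recursion equals [H p (n :: q)], and every other term has a smaller head
    in its second list. So [H] is determined by its values at an empty second list, that is, by
    [f]. *)
Lemma psi_rel_fun (f g g' : seq nat -> R) : psi_rel f g -> psi_rel f g' -> g =1 g'.
Proof.
move=> [H [Hf Hg H0 HS]] [H' [Hf' Hg' H0' HS']] e; rewrite -Hg -Hg'.
elim: e [::] => [|n e IHe] p; first by rewrite Hf Hf'.
elim/ltn_ind: n p => n IHn p.
have := HS p e n; rewrite IHe -(HS' p e n).
rewrite !big_ord_recl /= subn0 expr0 !mul1r H0 H0'.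
rewrite [X in _ + X = _](eq_bigr (fun i : 'I_n => (-1) ^+ (lift ord0 i) *
   H' (rcons p (lift ord0 i)) ((n - lift ord0 i)%N :: e))); first exact: addIr.
move=> i _; rewrite IHn // /bump /=; have := ltn_ord i; lia.
Qed.

(** The coefficients of $T(x/(1-bx))$ serve as inverse letters: [H p q] is a product of operators,
    $T_n$ for the entries of [p] and then [geom_op n] for those of [q]. *)
Lemma psi_rel_op (V : Type) (I : finType) (P : V -> pred I) (d : I -> nat)
    (wt : V -> I -> R) (t : V -> I -> V) (v0 : V -> R) (s0 : V) :
    (forall w U, ser_op P d wt t (- fps_X) (ser_op P d wt t fps_geom w) U = w U) ->
    (forall v U, coef_op P d wt t 0 v U = v U) ->
  psi_rel (fun e => foldr (coef_op P d wt t) v0 e s0)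
          (fun e => foldr (geom_op P d wt t) v0 e s0).
Proof.
move=> hc h0; exists (fun p q => foldr (coef_op P d wt t) (foldr (geom_op P d wt t) v0 q) p s0).
split=> // [p q|p q n].
  by rewrite foldr_rcons; congr (foldr _ _ _ _); apply/funext => U; rewrite h0.
under eq_bigr => i _ do rewrite foldr_rcons /=.
rewrite -foldr_coef_op_sum; set v := foldr _ v0 q.
(* A sum with one term, so that linearity of the operator product also pulls out the scalar
   [(n == 0)%:R]. *)
transitivity (foldr (coef_op P d wt t)
    (fun W => \sum_(j <- [:: tt]) (n == 0%N)%:R * v W) p s0).
  congr (foldr _ _ _ _); apply/funext => U.
  by rewrite big_seq1 coef_geom_cancel.
by rewrite (foldr_coef_op_sum _ _ _ _ _ (fun=> _) (fun=> v)) big_seq1.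
Qed.

(** The coefficient of $x^e$ after substituting $x_i/(1-bx_i)$ for each $x_i$ in the series with
    coefficients [f], computed one variable at a time; [at_geom_emon] identifies the two. *)
Fixpoint geom_sum (f : seq nat -> R) (e : seq nat) : R :=
  if e is n :: e' then
    \sum_(k < n.+1) (fps_geom ^+ k) n * geom_sum (fun q => f ((k : nat) :: q)) e'
  else f [::].

Lemma geom_sum_sum (J : finType) (P : pred J) (a : J -> R) (f : J -> seq nat -> R) e :
  geom_sum (fun q => \sum_(j | P j) a j * f j q) e =
  \sum_(j | P j) a j * geom_sum (f j) e.
Proof.
elim: e f => //= n e IHe f; under eq_bigr => k _ do rewrite IHe big_distrr /=.
rewrite exchange_big /=; apply: eq_bigr => j _; rewrite big_distrr /=.
by apply: eq_bigr => k _; rewrite mulrCA.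
Qed.

Lemma geom_sum_op (V : Type) (I : finType) (P : V -> pred I) (d : I -> nat)
    (wt : V -> I -> R) (t : V -> I -> V) (v0 : V -> R) (s0 : V) e :
  geom_sum (fun q => foldr (coef_op P d wt t) v0 q s0) e =
  foldr (geom_op P d wt t) v0 e s0.
Proof.
elim: e s0 => //= n e IHe s0; apply: eq_bigr => k _; congr (_ * _).
by rewrite geom_sum_sum; apply: eq_bigr => i _; rewrite IHe.
Qed.

End PowerSeries.

(** * Transfer operators of set-valued partitions *)

Section Lists.
Variable T : finType.

Fixpoint lists (l : nat) : seq (seq T) :=
  if l is l'.+1 then [seq x :: s | x <- enum T, s <- lists l'] else [:: [::]].

Lemma mem_lists l s : (s \in lists l) = (size s == l).
Proof.
elim: l s => [|l IHl] [|x s] /=; rewrite ?inE //.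
  by apply/allpairsP => -[[y s'] [_ _]].
rewrite eqSS -IHl; apply/allpairsP/idP => [[[y s'] [_ hs' [_ ->]]] //|sl].
by exists (x, s); rewrite mem_enum.
Qed.

Lemma uniq_lists l : uniq (lists l).
Proof.
elim: l => //= l IHl; apply: allpairs_uniq => //; first exact: enum_uniq.
by move=> [x s] [y s'] _ _ /= [-> ->].
Qed.

Lemma big_lists_cons (R : nmodType) l (P : pred (seq T)) (F : seq T -> R) :
  \sum_(s <- lists l.+1 | P s) F s =
  \sum_x \sum_(s <- lists l | P (x :: s)) F (x :: s).
Proof.
rewrite big_mkcond /= big_allpairs_dep /= big_enum /=; apply: eq_bigr => x _.
by rewrite [RHS]big_mkcond.
Qed.
End Lists.

Lemma cm_bigE (J : Type) (r : seq J) (P : pred J) (F : J -> {cmonom nat}) i :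
  (\big[mmul/mone]_(j <- r | P j) F j) i = (\sum_(j <- r | P j) F j i)%N.
Proof. by elim/big_rec2: _ => [|j y m _ <-]; rewrite ?cm1 ?cmM. Qed.

Lemma mdeg_nth (m : {cmonom nat}) (e : seq nat) :
  (forall i, m i = nth 0%N e i) -> mdeg m = sumn e.
Proof.
move=> me; rewrite (@mdegEw _ m (seq_fset tt (iota 0 (size e)))); last first.
  apply/fsubsetP => i; rewrite -cmE_neq0 me seq_fsetE mem_iota add0n /=.
  by apply: contraR; rewrite -leqNgt => h; rewrite nth_default.
rewrite (perm_big (iota 0 (size e))) /=; last first.
  by apply: (perm_trans (seq_fset_perm tt _)); rewrite undup_id ?iota_uniq.
rewrite sumnE [RHS](big_nth 0%N) /index_iota subn0.
by apply: eq_bigr => i _; rewrite me.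
Qed.

Lemma set_monE (A : {fset marked}) i :
  set_mon A i = ((((i, false) : marked) \in A) + (((i, true) : marked) \in A))%N.
Proof.
rewrite /set_mon cm_bigE.
under eq_bigr => x _ do rewrite cmU /mabs.
have h x : (x.1 == i : nat) = ((x == (i, false) :> marked) + (x == (i, true) :> marked))%N.
  by case: x => j [] /=; rewrite !xpair_eqE ?andbT ?andbF ?addn0.
under eq_bigr => x _ do rewrite h.
have cnt (y : marked) : (\sum_(x <- A) (x == y) = (y \in A))%N.
  rewrite -count_uniq_mem ?fset_uniq // -sum1_count [RHS]big_mkcond.
  by apply: eq_bigr => x _ /=; case: eqP.
by rewrite big_split /= !cnt.
Qed.

Section Systems.
Variables (Q : finType) (R : comNzRingType) (b : R).
Implicit Types (Y : sys Q) (U B C : {set Q}) (p : {set Q} * {set Q}).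

(** For one absolute value, [p.1] receives the primed letter and then [p.2] the unprimed one. *)
Definition spred Y U : pred ({set Q} * {set Q}) := fun p =>
  legal (srel Y) (smark Y false) (spair Y false) U p.1 &&
  legal (srel Y) (smark Y true) (spair Y true) (U :|: p.1) p.2.
Definition ssize p : nat := (#|p.1| + #|p.2|)%N.
Definition sexp U p : nat := (#|p.1 :&: U| + #|p.2 :&: (U :|: p.1)|)%N.
Definition swt U p : R := b ^+ sexp U p.
Definition snext U p : {set Q} := U :|: p.1 :|: p.2.

Definition sop Y := coef_op (spred Y) ssize swt snext.
Definition sfinal U : R := (U == [set: Q])%:R.

Lemma ser_op_vstep Y z w U :
  ser_op (spred Y) ssize swt snext z w U = vstep Y (fps_const b) z w U.
Proof.
rewrite /vstep /sstep /step /ser_op.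
under [RHS]eq_bigr => B _ do rewrite big_distrr /=.
rewrite pair_big_dep /=; apply: eq_bigr => -[B C] _ /=.
by rewrite fps_const_exp /ssize /sexp !exprD /=; ring.
Qed.

Lemma sop0 Y v U : sop Y 0 v U = v U.
Proof.
rewrite /sop /coef_op (big_pred1 (set0, set0)) => [|[B C]] /=.
  by rewrite /swt /sexp /snext /= !set0I !cards0 mul1r !setU0.
rewrite /ssize /= addn_eq0 !cards_eq0 xpair_eqE; case: eqP => [->|]; rewrite ?andbF //=.
by case: eqP => [->|]; rewrite ?andbF //= /spred /= !legal0.
Qed.

Fixpoint run Y U (s : seq ({set Q} * {set Q})) : bool :=
  if s is p :: s' then spred Y U p && run Y (snext U p) s' else U == [set: Q].
Fixpoint rexp U (s : seq ({set Q} * {set Q})) : nat :=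
  if s is p :: s' then (sexp U p + rexp (snext U p) s')%N else 0%N.

Lemma foldr_sopE Y e U : foldr (sop Y) sfinal e U =
  \sum_(s <- lists _ (size e) | run Y U s && (map ssize s == e)) b ^+ rexp U s.
Proof.
elim: e U => [|n e IHe] U.
  by rewrite /= big_seq_cond big_mkcond /= big_seq1 inE /= andbT /sfinal; case: ifP.
rewrite [size _]/= big_lists_cons [LHS]/= {1}/sop /coef_op big_mkcond.
apply: eq_bigr => p _; case: ifP => [/andP[sp /eqP dp]|np].
  rewrite IHe big_distrr /=; apply: eq_big => [s|s _]; last by rewrite exprD.
  by rewrite sp eqseq_cons dp eqxx.
rewrite big_pred0 // => s /=; rewrite eqseq_cons.
by apply: contraFF np => /andP[/andP[-> _] /andP[-> _]].
Qed.

(** Every placement of a letter either enters a new element or pays one [b]. For empty [U] the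
    exponent of [b] is therefore the number of letters minus the number of elements. *)
Lemma run_card Y U s : run Y U s -> (sumn (map ssize s) + #|U| = rexp U s + #|Q|)%N.
Proof.
elim: s U => [|p s IHs] U /=; first by move/eqP ->; rewrite cardsT.
case/andP => _ /IHs; rewrite /ssize /sexp /snext.
have := cardsU U p.1; have := cardsU (U :|: p.1) p.2.
rewrite (setIC U) (setIC (_ :|: _)).
have h1 : (#|p.1 :&: U| <= #|p.1|)%N by rewrite subset_leq_card ?subsetIl.
have h2 : (#|p.2 :&: (U :|: p.1)| <= #|p.2|)%N by rewrite subset_leq_card ?subsetIl.
have h3 : (#|p.2 :&: (U :|: p.1)| <= #|U :|: p.1|)%N by rewrite subset_leq_card ?subsetIr.
move=> e3 e2 e1; have ar (x3 x2 u a c i k S r q : nat) : x3 = (x2 + c - k)%N ->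
    x2 = (u + a - i)%N -> (S + x3 = r + q)%N -> (i <= a)%N -> (k <= c)%N ->
    (k <= x2)%N -> (a + c + S + u = i + k + r + q)%N by lia.
exact: ar e3 e2 e1 h1 h2 h3.
Qed.

Definition slot (s : seq ({set Q} * {set Q})) (x : marked) : {set Q} :=
  let p := nth (set0, set0) s (mabs x) in if unprimed x then p.2 else p.1.

Definition slots_ok Y U (s : seq ({set Q} * {set Q})) : Prop :=
  [/\ forall q, q \in U \/ exists x, q \in slot s x,
      forall x q, q \in slot s x -> smark Y (unprimed x) q,
      forall x q r, srel Y q r -> q \in slot s x -> r \in U -> False,
      forall x y q r, srel Y q r -> q \in slot s x -> r \in slot s y -> (x <= y)%O &
      forall x q r, srel Y q r -> q \in slot s x -> r \in slot s x ->
        spair Y (unprimed x) q r].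

Lemma slot_nil x : slot [::] x = set0.
Proof. by case: x => i []; rewrite /slot /mabs /= nth_nil. Qed.

(** Membership in [U] records that an element received an earlier letter, so testing each letter
    against [U] amounts to requiring that the slots of related elements weakly increase. *)
Lemma runP Y U s : reflect (slots_ok Y U s) (run Y U s).
Proof.
elim: s U => [|p s IHs] U /=.
  apply: (iffP eqP) => [->|[h _ _ _ _]].
    by split=> [q|x q|x q r|x y q r|x q r]; rewrite ?slot_nil ?inE //; left.
  apply/setP => q; rewrite inE; case: (h q) => // -[x]; by rewrite slot_nil inE.
have lexS i j (u v : bool) : (((i.+1, u) : marked) <= (j.+1, v))%O = (((i, u) : marked) <= (j, v))%O.
  by [].
apply: (iffP andP) => [[/andP[/legalP[m1 n1 p1] /legalP[m2 n2 p2]] /IHs[h1 h2 h3 h4 h5]]|].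
  split.
  - move=> q; case: (h1 q) => [|[[i u] qi]].
      rewrite !inE => /orP[/orP[->|q1]|q2]; [by left|right|right].
        by exists (0%N, false).
      by exists (0%N, true).
    by right; exists (i.+1, u).
  - by move=> [[|i] []] q //=; [exact: m2|exact: m1|exact: (h2 (i, true))|exact: (h2 (i, false))].
  - move=> [[|i] u] q r c qx rU.
      case: u qx => qx.
        by have := n2 q r qx; rewrite inE rU c => /(_ isT).
      by have := n1 q r qx rU; rewrite c.
    by apply: (h3 (i, u) q r c qx); rewrite !inE rU.
  - move=> [[|i] u] [[|j] v] q r c qx ry //.
    + case: u v qx ry => [] [] // qx ry.
      by have := n2 q r qx; rewrite inE ry c orbT => /(_ isT).
    + by exfalso; apply: (h3 (i, u) q r c qx); case: v ry => ry; rewrite !inE ry ?orbT.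
    + by rewrite lexS; exact: (h4 (i, u) (j, v) q r c qx ry).
  - move=> [[|i] u] q r c qx ry; last exact: (h5 (i, u) q r c qx ry).
    by case: u qx ry => qx ry; [exact: p2|exact: p1].
move=> [h1 h2 h3 h4 h5]; split.
  apply/andP; split; apply/legalP; split.
  - by move=> q; exact: (h2 (0%N, false)).
  - by move=> q r q1 rU; apply/negP => c; exact: (h3 (0%N, false) _ _ c q1).
  - by move=> q r q1 r1 c; exact: (h5 (0%N, false)).
  - by move=> q; exact: (h2 (0%N, true)).
  - move=> q r q2; rewrite inE => /orP[rU|r1]; apply/negP => c.
      exact: (h3 (0%N, true) _ _ c q2).
    by have := h4 (0%N, true) (0%N, false) _ _ c q2 r1.
  - by move=> q r q1 r1 c; exact: (h5 (0%N, true)).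
apply/IHs; split.
- move=> q; case: (h1 q) => [qU|[[[|i] u] qx]].
  + by left; rewrite !inE qU.
  + by left; case: u qx => qx; rewrite !inE qx ?orbT.
  + by right; exists (i, u).
- by move=> [i u] q; exact: (h2 (i.+1, u)).
- move=> [i u] q r c qx; rewrite !inE => /orP[/orP[rU|r1]|r2].
  + exact: (h3 (i.+1, u) _ _ c qx).
  + by have := h4 (i.+1, u) (0%N, false) _ _ c qx r1.
  + by have := h4 (i.+1, u) (0%N, true) _ _ c qx r2.
- by move=> [i u] [j v] q r c qx ry; rewrite -lexS; exact: (h4 (i.+1, u) (j.+1, v) q r c qx ry).
- by move=> [i u] q r c qx rx; exact: (h5 (i.+1, u)).
Qed.
End Systems.
Arguments ssize {Q} p.
Arguments sfinal {Q} R U.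

(** * Generating series of a system as a product of transfer operators *)

Section SystemSeries.
Variable Q : finType.
Implicit Types (Y : sys Q) (s : seq ({set Q} * {set Q})).

Definition sys_valid Y (sg : {ffun Q -> {fset marked}}) : Prop :=
  [/\ forall q, sg q != fset0,
      forall (x : marked) q, x \in sg q -> smark Y (unprimed x) q,
      forall q r, srel Y q r -> fpreceq (sg q) (sg r) &
      forall (x : marked) q r, srel Y q r -> x \in sg q -> x \in sg r ->
        spair Y (unprimed x) q r].

Definition sys_series Y : pseries :=
  genseries (sys_valid Y) (fun sg => 'X^(part_card sg - #|Q|)) (@part_mon Q).

Definition filling s : {ffun Q -> {fset marked}} := [ffun q =>
  [fset x in flatten [seq [:: ((i, false) : marked); ((i, true) : marked)] | i <- iota 0 (size s)]
     | q \in slot s x]%fset].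

Lemma mem_filling s (x : marked) q : (x \in filling s q) = (q \in slot s x).
Proof.
rewrite ffunE in_fset /=; apply: andb_idl => qx.
have lx : (x.1 < size s)%N.
  rewrite ltnNge; apply: contraL qx => lx.
  by rewrite /slot /mabs nth_default //; case: unprimed; rewrite inE.
apply/flattenP; exists [:: ((x.1, false) : marked); ((x.1, true) : marked)].
  by apply/mapP; exists x.1; rewrite // mem_iota.
by case: x {qx lx} => i []; rewrite !inE eqxx ?orbT.
Qed.

Lemma filling_valid Y s : sys_valid Y (filling s) <-> slots_ok Y set0 s.
Proof.
split=> [[h1 h2 h3 h4]|[h1 h2 h3 h4 h5]].
  split.
  - by move=> q; right; have /fset0Pn[x xq] := h1 q; exists x; rewrite -mem_filling.
  - by move=> x q; rewrite -mem_filling; exact: h2.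
  - by move=> x q r _ _; rewrite inE.
  - by move=> x y q r c; rewrite -!mem_filling; exact: h3.
  - by move=> x q r c; rewrite -!mem_filling; exact: h4.
split.
- move=> q; case: (h1 q) => [|[x xq]]; first by rewrite inE.
  by apply/fset0Pn; exists x; rewrite mem_filling.
- by move=> x q; rewrite mem_filling; exact: h2.
- by move=> q r c x y; rewrite !mem_filling; exact: h4.
- by move=> x q r c; rewrite !mem_filling; exact: h5.
Qed.

Lemma part_monE (sg : {ffun Q -> {fset marked}}) i : part_mon sg i =
  (#|[set q | ((i, false) : marked) \in sg q]| + #|[set q | ((i, true) : marked) \in sg q]|)%N.
Proof.
rewrite /part_mon cm_bigE; under eq_bigr => q _ do rewrite set_monE.
rewrite big_split /= -!sum1_card; congr (_ + _)%N; rewrite [RHS]big_mkcond;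
  by apply: eq_bigr => q _; rewrite inE; case: (_ \in _).
Qed.

Lemma part_mon_filling s i : part_mon (filling s) i = nth 0%N (map ssize s) i.
Proof.
rewrite part_monE; have e u : [set q | ((i, u) : marked) \in filling s q] = slot s (i, u).
  by apply/setP => q; rewrite inE mem_filling.
rewrite !e; case: (ltnP i (size s)) => li; first by rewrite (nth_map (set0, set0)).
by rewrite /slot /= !nth_default ?size_map //= cards0.
Qed.

Lemma part_cardE (sg : {ffun Q -> {fset marked}}) : part_card sg = mdeg (part_mon sg).
Proof.
rewrite mdeg_prod; apply: eq_bigr => q _.
rewrite /set_mon mdeg_prod; under eq_bigr => x _ do rewrite mdegU.
by rewrite sum1_size.
Qed.

Lemma filling_inj s s' : size s = size s' -> filling s = filling s' -> s = s'.
Proof.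
move=> ss e; apply: (@eq_from_nth _ (set0, set0)) => // i _.
have h u : slot s (i, u) = slot s' (i, u).
  by apply/setP => q; rewrite -!mem_filling e.
by have := h false; have := h true; rewrite /slot /=; case: nth => ? ?; case: nth => ? ? /= -> ->.
Qed.

(** [filling] is a bijection from the runs with letter counts [e] to the valid fillings with
    monomial [m]. Zeros at the end of [e] are harmless. *)
Lemma sys_seriesE Y (m : {cmonom nat}) e : (forall i, m i = nth 0%N e i) ->
  sys_series Y m = foldr (sop 'X Y) (sfinal _) e set0.
Proof.
move=> me; rewrite foldr_sopE.
set L := [seq s <- lists _ (size e) | run Y set0 s && (map ssize s == e)].
have memL s : s \in L -> [/\ run Y set0 s, map ssize s = e & size s = size e].
  by rewrite mem_filter mem_lists => /andP[/andP[-> /eqP ->] /eqP ->].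
transitivity (\sum_(s <- L) ('X^(rexp set0 s) : {poly int})); last by rewrite big_filter.
rewrite fsbig_seq ?filter_uniq ?uniq_lists //.
rewrite /sys_series /genseries (@reindex_fsbig _ _ _ _ _ filling [set` L]).
  apply: eq_fsbigr => s; rewrite classical_sets.in_setE /= => /memL[rs es ss]; congr ('X^_).
  have <- : sumn (map ssize s) = part_card (filling s).
    rewrite part_cardE (@mdeg_nth _ (map ssize s)) // => i; exact: part_mon_filling.
  have := run_card rs; rewrite cards0 addn0 => ->; exact: addnK.
split.
- move=> s /= /memL[rs es ss]; split; first exact/filling_valid/runP.
  by apply/eqP/cmP => i; rewrite part_mon_filling me es.
- move=> s s'; rewrite !classical_sets.in_setE => /memL[_ _ s1] /memL[_ _ s2]; apply: filling_inj.
  by rewrite s1.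
move=> sg /= [vsg esg].
(* Absolute values from [size e] on have exponent zero in [m], so cutting off there loses no letter
   of [sg]. *)
pose s := mkseq (fun i => ([set q | ((i, false) : marked) \in sg q],
                           [set q | ((i, true) : marked) \in sg q])) (size e).
have slotE (x : marked) q : (q \in slot s x) = (x \in sg q).
  case: (ltnP x.1 (size e)) => lx.
    rewrite /slot nth_mkseq //; case: x lx => i [] _ /=; by rewrite inE.
  rewrite /slot nth_default ?size_mkseq //.
  transitivity false; first by case: unprimed; rewrite inE.
  apply/esym/negP => xq; have := me x.1; rewrite nth_default // -esg part_monE.
  move/eqP; rewrite addn_eq0 !cards_eq0 => /andP[/eqP/setP e1 /eqP/setP e2].
  by case: x xq {lx} e1 e2 => i [] xq /(_ q) e1 /(_ q) e2; move: e1 e2; rewrite !inE xq.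
have fs : filling s = sg.
  apply/ffunP => q; apply/fsetP => x; by rewrite mem_filling slotE.
exists s => //; rewrite /= mem_filter mem_lists size_mkseq eqxx andbT.
apply/andP; split; first by apply/runP/filling_valid; rewrite fs.
apply/eqP/(@eq_from_nth _ 0%N); first by rewrite size_map size_mkseq.
by move=> i _; rewrite -part_mon_filling fs esg me.
Qed.

Definition sys_rev Y : sys Q := Sys (fun q r => srel Y r q)
  (fun u => smark Y (~~ u)) (fun u q r => spair Y (~~ u) r q).

Definition swap_rev s : seq ({set Q} * {set Q}) := rev [seq (p.2, p.1) | p <- s].

Lemma swap_revK : involutive swap_rev.
Proof.
move=> s; rewrite /swap_rev map_rev revK -map_comp map_id_in //.
by move=> [].
Qed.

Lemma size_swap_rev s : size (swap_rev s) = size s.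
Proof. by rewrite size_rev size_map. Qed.

Lemma slot_swap_rev s i u : (i < size s)%N ->
  slot (swap_rev s) (i, u) = slot s ((size s - i.+1)%N, ~~ u).
Proof.
move=> li; rewrite /slot nth_rev ?size_map // (nth_map (set0, set0)) /=.
  by case: u.
by rewrite ltn_subrL; case: (size s) li.
Qed.

Lemma run_swap_rev Y s : run Y set0 s -> run (sys_rev Y) set0 (swap_rev s).
Proof.
have slt (t : seq ({set Q} * {set Q})) (q : Q) (x : marked) : q \in slot t x -> (x.1 < size t)%N.
  rewrite ltnNge; apply: contraL => lx.
  by rewrite /slot /mabs nth_default //; case: unprimed; rewrite inE.
have sl (q : Q) (x : marked) : q \in slot (swap_rev s) x -> q \in slot s ((size s - x.1.+1)%N, ~~ x.2).
  case: x => i u qx; move: (slt _ _ _ qx) (qx); rewrite size_swap_rev => li.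
  by rewrite slot_swap_rev.
move=> /runP[h1 h2 h3 h4 h5]; apply/runP; split.
- move=> q; case: (h1 q) => [|[[i u] qx]]; first by rewrite inE.
  have li := slt _ _ _ qx; right; exists ((size s - i.+1)%N, ~~ u).
  rewrite slot_swap_rev /=; last by move: li => /=; lia.
  by rewrite negbK (_ : (_ - _)%N = i) //; move: li => /=; lia.
- move=> [i u] q /sl; exact: h2.
- by move=> x q r _ _; rewrite inE.
- move=> [i u] [j v] q r c qx ry.
  have li := slt _ _ _ qx; have lj := slt _ _ _ ry; rewrite !size_swap_rev /= in li lj.
  have := h4 _ _ _ _ c (sl _ _ ry) (sl _ _ qx) => /=.
  rewrite !lexi_pair /= !leEnat => /andP[le1 /implyP le2].
  have ij : (i <= j)%N by lia.
  rewrite ij /=; apply/implyP => ji.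
  have := le2 _; have -> : (size s - i.+1 <= size s - j.+1)%N by lia.
  by move/(_ isT); case: u v {qx ry le2} => [] [].
- move=> [i u] q r c /sl qx /sl rx; exact: (h5 _ r q c rx qx).
Qed.

Lemma map_ssize_rev s : map ssize (swap_rev s) = rev (map ssize s).
Proof.
rewrite /swap_rev map_rev -map_comp; congr rev; apply: eq_map => p.
by rewrite /ssize /= addnC.
Qed.

Lemma foldr_sop_rev (R : comNzRingType) (b : R) Y e :
  foldr (sop b (sys_rev Y)) (sfinal _) (rev e) set0 = foldr (sop b Y) (sfinal _) e set0.
Proof.
rewrite !foldr_sopE size_rev.
have rr Z s : run (sys_rev Z) set0 (swap_rev s) = run Z set0 s.
  apply/idP/idP => [|]; last exact: run_swap_rev.
  move/run_swap_rev; rewrite swap_revK; congr (run _ _ _).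
  case: Z => c m p; rewrite /sys_rev /=; congr Sys; apply/funext => u.
    by rewrite negbK.
  by apply/funext => x; apply/funext => y; rewrite negbK.
rewrite (perm_big (map swap_rev (lists _ (size e)))) /=; last first.
  apply: uniq_perm; rewrite ?(map_inj_uniq (inv_inj swap_revK)) ?uniq_lists //.
  move=> s; rewrite mem_lists; apply/eqP/mapP => [ss|[s' + ->]].
    by exists (swap_rev s); rewrite ?swap_revK // mem_lists size_swap_rev ss.
  by rewrite mem_lists size_swap_rev => /eqP.
rewrite big_map; apply: eq_big => [s|s].
  by rewrite rr map_ssize_rev (inj_eq (inv_inj (@revK _))).
(* The exponents of [b] are accumulated from opposite ends; [run_card] expresses both by the total
   number of letters. *)
rewrite rr map_ssize_rev => /andP[rs _]; congr (b ^+ _).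
have e1 := run_card rs; have := rs; rewrite -rr => /run_card.
rewrite map_ssize_rev sumn_rev => e2.
by apply/eqP; rewrite -(eqn_add2r #|Q|) -e1 -e2.
Qed.
End SystemSeries.

(** * The involutions on exponent lists *)

Definition emon (e : seq nat) : {cmonom nat} := word_mon (block_word e 0).

Lemma count_block_word e k i :
  count_mem i (block_word e k) = if (k <= i)%N then nth 0%N e (i - k) else 0%N.
Proof.
elim: e k => [|x e IHe] k /=; first by rewrite nth_nil if_same.
rewrite count_cat count_nseq IHe /=; case: (ltngtP k i) => [ki|ki|->].
- by rewrite mul0n add0n; case: (i - k)%N (subnSK ki) => // n [->].
- by rewrite mul0n.
- by rewrite mul1n subnn addn0.
Qed.

Lemma emonE e i : emon e i = nth 0%N e i.
Proof. by rewrite word_monE count_block_word subn0. Qed.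

Lemma emonP (m : {cmonom nat}) e : (forall i, m i = nth 0%N e i) -> m = emon e.
Proof. by move=> me; apply/eqP/cmP => i; rewrite me emonE. Qed.

Lemma emon_mkseq (m : {cmonom nat}) n :
  (forall i, (n <= i)%N -> m i = 0%N) -> m = emon (mkseq m n).
Proof.
move=> m0; apply: emonP => i; case: (ltnP i n) => ni; first by rewrite nth_mkseq.
by rewrite nth_default ?size_mkseq // m0.
Qed.

Lemma emon_surj (m : {cmonom nat}) : exists e, m = emon e.
Proof.
exists (mkseq m (\max_(i <- finsupp m) i).+1); apply: emon_mkseq => i.
rewrite ltnNge; apply: contraNeq; rewrite cmE_neq0 => im.
by rewrite (big_rem i) //= leq_maxl.
Qed.

Lemma sorted_block_word e k :
  sorted leq (block_word e k) /\ all (leq k) (block_word e k).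
Proof.
elim: e k => //= x e IHe k; have [s1 a1] := IHe k.+1.
have a2 : all (leq k) (block_word e k.+1).
  by apply: sub_all a1 => i; apply: ltnW.
rewrite all_cat all_nseq leqnn orbT a2; split=> //.
elim: x => //= x; rewrite path_sortedE ?all_cat ?all_nseq ?leqnn ?orbT ?a2 //.
exact: leq_trans.
Qed.

Lemma fundL_emon a e : fundL a (emon e) = `[< fund_word a (block_word e 0) >]%:R.
Proof.
case: asboolP => [/fundL_block1 //|nf]; rewrite /fundL /genseries.
rewrite (_ : [set _ | _]%classic = classical_sets.set0) ?fsbig_set0 //.
apply/seteqP; split=> // w [fw eqm]; apply: nf.
suff <- : w = block_word e 0 by [].
apply: (@sorted_eq _ leq) (leq_trans) (anti_leq) _ _ _ _ _.
- exact: fund_word_sorted fw.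
- exact: (sorted_block_word e 0).1.
by apply/allP => j _ /=; rewrite -!word_monE eqm.
Qed.

(** * Coefficients of fundamental quasisymmetric functions *)

Section FundPath.
Implicit Types (D : pred nat) (e p q : seq nat) (n j : nat).

(** A run of [b] equal letters starting after position [j] must have no descent strictly inside.
    Stringing such runs together, [dpath] is the coefficient of the fundamental function with
    descent set [D], and [predC D] gives that of the complement. *)
Definition gap D (j b : nat) : bool := all (fun i => ~~ D (j + i)%N) (iota 1 b.-1).

Fixpoint dpath D (n j : nat) e : bool :=
  if e is b :: e' then gap D j b && dpath D n (j + b)%N e' else j == n.

Fixpoint psums e : seq nat :=
  0%N :: (if e is b :: e' then [seq (b + i)%N | i <- psums e'] else [::]).

Lemma psums0 e : 0%N \in psums e.
Proof. by case: e => [|b e]; rewrite inE eqxx. Qed.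

Lemma dpathE D n j e : dpath D n j e <->
  (j + sumn e = n)%N /\ (forall i, (0 < i < sumn e)%N -> D (j + i)%N -> i \in psums e).
Proof.
elim: e n j => [|b e IHe] n j /=.
  rewrite addn0; split=> [/eqP ->|[-> _]//]; split=> // i.
  by case: i.
split=> [/andP[/allP g /IHe [<- h]]|[<- h]].
  split=> [|i /andP[i0 ilt] Di]; first by rewrite addnA.
  case: (ltnP i b) => ib.
    by have := g i; rewrite mem_iota Di i0 add1n prednK ?ib ?(leq_trans _ ib) // => /(_ isT).
  rewrite inE (gtn_eqF i0) /=; apply/mapP; exists (i - b)%N; last by rewrite subnKC.
  case: (posnP (i - b)) => [->|ib0]; first exact: psums0.
  by apply: h; [rewrite ib0 ltn_subLR|rewrite -addnA subnKC].
apply/andP; split.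
  apply/allP => i; rewrite mem_iota add1n => /andP[i0 ib]; apply/negP => Di.
  have ib' : (i < b)%N by lia.
  have := h i; rewrite i0 ltn_addr // => /(_ isT Di); rewrite inE (gtn_eqF i0) /=.
  by case/mapP => k _ ei; move: ib'; rewrite ei ltnNge leq_addr.
apply/IHe; rewrite addnA; split=> // i /andP[i0 ilt] Di.
have := h (b + i)%N; rewrite addn_gt0 i0 orbT ltn_add2l ilt addnA => /(_ isT Di).
rewrite inE addn_eq0 (gtn_eqF i0) andbF /= => /mapP[k ke /addnI ->] //.
Qed.

Lemma eq_dpath D D' n e : (forall i, (0 < i < n)%N -> D i = D' i) ->
  dpath D n 0 e = dpath D' n 0 e.
Proof.
move=> eD; apply/idP/idP => /dpathE[sn h]; apply/dpathE; split=> // i hi;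
  [rewrite add0n -eD|rewrite add0n eD]; rewrite -?sn ?add0n //; exact: h.
Qed.

Lemma block_word_lt e k j :
  (0 < j < sumn e)%N -> (nth 0%N (block_word e k) j.-1 < nth 0%N (block_word e k) j)%N = (j \in psums e).
Proof.
elim: e k j => [|b e IHe] k j /=; first by rewrite ltn0 andbF.
move=> /andP[j0 jlt]; rewrite !nth_cat size_nseq !nth_nseq inE (gtn_eqF j0) /=.
have ltj1 : (j.-1 < j)%N by rewrite prednK.
case: (ltngtP j b) => [jb|bj|ejb].
- rewrite (ltn_trans ltj1 jb) ltnn; apply/esym/mapP => -[i _ ej].
  by move: jb; rewrite ej ltnNge leq_addr.
- have bj1 : (b <= j.-1)%N by rewrite -ltnS prednK.
  rewrite (ltnNge j.-1 b) bj1 /=; have -> : (j.-1 - b = (j - b).-1)%N by rewrite -!subn1 subnAC.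
  rewrite IHe ?subn_gt0 ?bj ?ltn_subLR // ?(ltnW bj) //.
  apply/idP/mapP => [h|[i ie ->]]; last by rewrite addKn.
  by exists (j - b)%N; rewrite // subnKC // ltnW.
- rewrite -ejb prednK // leqnn subnn.
  have sz : (0 < size (block_word e k.+1))%N.
    by rewrite size_block_word; move: jlt; rewrite ejb -{1}(addn0 b) ltn_add2l.
  have [_ /allP/(_ (nth 0%N (block_word e k.+1) 0))] := sorted_block_word e k.+1.
  rewrite mem_nth // => /(_ isT) ->; apply/esym/mapP; exists 0%N; rewrite ?psums0 //.
  by rewrite addn0.
Qed.

Lemma fund_wordE a e :
  fund_word a (block_word e 0) <-> dpath (mem (descents a)) (sumn a) 0 e.
Proof.
rewrite dpathE /fund_word size_block_word add0n; split=> -[se h]; split=> // j.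
  move=> hj dj; have [_ /(_ dj)] := h j (eq_ind _ (fun n => (0 < j < n)%N) hj _ se).
  by rewrite block_word_lt.
rewrite -se => hj; have [sorted_bw _] := sorted_block_word e 0; split.
  case/andP: hj => j0 jlt; rewrite (@sorted_leq_nth _ leq leq_trans leqnn) ?inE ?size_block_word //.
    by rewrite (leq_trans _ jlt) // prednK // leqnSn.
  exact: leq_pred.
by move=> dj; rewrite block_word_lt //; apply: h.
Qed.

Lemma fundL_dpath a e : fundL a (emon e) = (dpath (mem (descents a)) (sumn a) 0 e)%:R.
Proof.
by rewrite fundL_emon; congr (nat_of_bool _)%:R; apply/asboolP/idP; rewrite fund_wordE.
Qed.

Lemma dpath_filter D n j e : dpath D n j [seq x <- e | (0 < x)%N] = dpath D n j e.
Proof. by elim: e j => //= -[|b] e IHe j /=; rewrite IHe // addn0. Qed.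

(** The mixed function required by [psi_rel], for one fundamental function: [p] is read with [D] and
    [q] with its complement. *)
Fixpoint dpath2 D (n j : nat) p q : bool :=
  if p is b :: p' then gap D j b && dpath2 D n (j + b)%N p' q
  else dpath (predC D) n j q.

(** For [0 < i < b] the dividing position [j + i] is unconstrained. According to whether it lies in
    [D], the term is a sum of two consecutive values of [Z], while the terms [i = 0] and [i = b] are
    single values; the alternating sum telescopes. *)
Lemma gap_alternating (R : comNzRingType) D j b : (0 < b)%N ->
  \sum_(i < b.+1) (-1) ^+ i * (gap D j i && gap (predC D) (j + i) (b - i))%:R = 0 :> R.
Proof.
case: b => // b _.
pose Z i : R := (gap D j i.+1 && gap (predC D) (j + i) (b.+1 - i))%:R.
have gS (E : pred nat) k l : gap E k l.+2 = ~~ E (k + 1)%N && gap E k.+1 l.+1.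
  rewrite /gap /= ; congr (_ && _); rewrite (iotaDl 1 1) all_map; apply: eq_all => i /=.
  by rewrite addnA addn1.
have gR (E : pred nat) k l : gap E k l.+2 = gap E k l.+1 && ~~ E (k + l.+1)%N.
  rewrite /gap (_ : l.+2.-1 = (l + 1)%N); last by rewrite addn1.
  by rewrite iotaD all_cat /= andbT add1n.
have key i : (i < b)%N -> (gap D j i.+1 && gap (predC D) (j + i.+1) (b.+1 - i.+1))%:R = Z i + Z i.+1.
  move=> ib; rewrite /Z subSS; have [n en] : exists n, (b - i)%N = n.+1.
    by exists (b - i).-1; rewrite prednK // subn_gt0.
  rewrite subSn ?(ltnW ib) // en gS gR /= negbK addn1 -addnS.
  by case: (D (j + i.+1)%N); case: gap; case: gap; rewrite /= ?addr0 ?add0r.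
rewrite big_ord_recl big_ord_recr /=.
rewrite expr0 mul1r subn0 addn0 /bump /= add1n subnn.
under eq_bigr => i _ do rewrite add1n key // mulrDr.
have -> : (gap D j 0 && gap (predC D) j b.+1)%:R = Z 0%N by rewrite /Z addn0 subn0.
have -> : (gap D j b.+1 && gap (predC D) (j + b.+1) 0)%:R = Z b.
  by rewrite /Z subSn // subnn.
rewrite big_split /=.
have tele k : Z 0%N + (\sum_(i < k) (-1) ^+ i.+1 * Z i + \sum_(i < k) (-1) ^+ i.+1 * Z i.+1) = (-1) ^+ k * Z k.
  elim: k => [|k IHk]; first by rewrite !big_ord0 !addr0 expr0 mul1r.
  rewrite !big_ord_recr /=; move: IHk; set S1 := \sum_(i < k) _; set S2 := \sum_(i < k) _.
  by move/(canRL (addrK _)) ->; rewrite exprS; ring.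
by rewrite addrA tele exprS; ring.
Qed.

Lemma dpath2_alternating (R : comNzRingType) D n j p q b :
  \sum_(i < b.+1) (-1) ^+ i * (dpath2 D n j (rcons p i) ((b - i)%N :: q))%:R =
  (b == 0%N)%:R * (dpath2 D n j p q)%:R :> R.
Proof.
elim: p j => [|x p IHp] j /=.
  transitivity (\sum_(i < b.+1) (-1) ^+ i *
     (gap D j i && gap (predC D) (j + i) (b - i))%:R * (dpath (predC D) n (j + b) q)%:R : R).
    apply: eq_bigr => i _; rewrite -mulrA -natrM mulnb andbA -addnA subnKC //.
    by rewrite -ltnS.
  rewrite -big_distrl /=; case: b => [|b]; last by rewrite gap_alternating // !mul0r.
  by rewrite big_ord1 expr0 /= addn0 !mul1r.
under eq_bigr => i _ do rewrite -mulnb natrM mulrCA.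
by rewrite -big_distrr /= IHp -mulnb natrM mulrCA.
Qed.

End FundPath.

Lemma psumsE e : psums e = [seq sumn (take i e) | i <- iota 0 (size e).+1].
Proof.
elim: e => [|b e IHe] //; rewrite [psums _]/= IHe.
rewrite -[iota 0 _ in RHS]/(0%N :: iota (1 + 0) (size e).+1) iotaDl map_cons -!map_comp.
by congr (_ :: _); apply: eq_map.
Qed.

Lemma mem_psums e d : reflect (exists2 i, (i <= size e)%N & d = sumn (take i e)) (d \in psums e).
Proof.
rewrite psumsE; apply: (iffP mapP) => -[i hi ->]; exists i => //.
  by rewrite mem_iota in hi.
by rewrite mem_iota.
Qed.

Lemma psums_rev e d : (d <= sumn e)%N -> (d \in psums (rev e)) = ((sumn e - d)%N \in psums e).
Proof.
have half s x : (x \in psums (rev s)) -> (sumn s - x)%N \in psums s.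
  case/mem_psums => i hi ->; rewrite size_rev in hi.
  apply/mem_psums; exists (size s - i)%N; first exact: leq_subr.
  rewrite take_rev sumn_rev -{1}(cat_take_drop (size s - i) s) sumn_cat.
  by rewrite addnK.
move=> hd; apply/idP/idP => [|h]; first exact: half.
by have := half (rev e) (sumn e - d)%N; rewrite revK sumn_rev subKn // => ->.
Qed.

Lemma mem_descents a d : is_comp a ->
  (d \in descents a) = (0 < d < sumn a)%N && (d \in psums a).
Proof.
move=> ca; apply/mapP/andP => [[i]|[/andP[d0 dlt] /mem_psums[i ia ed]]].
  rewrite mem_iota => /andP[i0 ilt] ->.
  have di : sumn (take i a) \in descents a by apply/mapP; exists i; rewrite // mem_iota i0.
  rewrite (descents_gt0 ca di); split; last by apply/mem_psums; exists i => //; lia.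
  rewrite -{2}(cat_take_drop i a) sumn_cat -{1}(addn0 (sumn (take i a))) ltn_add2l /=.
  have : (0 < size (drop i a))%N by rewrite size_drop; lia.
  have : is_comp (drop i a) by apply/allP => x /mem_drop; move/allP: ca; apply.
  by case: (drop i a) => // x s /= /andP[x0 _] _; rewrite addn_gt0 x0.
exists i => //; rewrite mem_iota; apply/andP; split.
  by case: i {ia} ed => // ed; move: d0; rewrite ed take0.
case: (ltnP i (size a)) => [|h]; first lia.
by move: dlt; rewrite ed take_oversize // ltnn.
Qed.

Lemma is_comp_rev a : is_comp (rev a) = is_comp a.
Proof. exact: all_rev. Qed.

Lemma mem_descents_rev a d : is_comp a -> (0 < d < sumn a)%N ->
  (d \in descents (rev a)) = ((sumn a - d)%N \in descents a).
Proof.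
move=> ca hd; rewrite !mem_descents ?is_comp_rev // sumn_rev psums_rev; last lia.
by congr (_ && _); lia.
Qed.

Lemma dpath_rev D n e : dpath D n 0 (rev e) = dpath (fun i => D (n - i)%N) n 0 e.
Proof.
apply/idP/idP => /dpathE; rewrite ?sumn_rev add0n => -[sn h]; apply/dpathE;
  rewrite ?sumn_rev add0n; split=> // i hi; rewrite add0n => Di.
  rewrite -(subKn (_ : i <= sumn e)%N) -?psums_rev; try lia.
  by apply: h; rewrite ?sn //; lia.
rewrite psums_rev; last lia.
by apply: h; rewrite ?add0n -?sn ?subKn //; lia.
Qed.

Lemma fundL_rev a e : is_comp a -> fundL (rev a) (emon e) = fundL a (emon (rev e)).
Proof.
move=> ca; rewrite !fundL_dpath sumn_rev dpath_rev; congr (nat_of_bool _)%:R.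
by apply: eq_dpath => i hi; rewrite /= mem_descents_rev.
Qed.

Lemma fundL_compl a e : is_comp a ->
  fundL (comp_compl a) (emon e) = (dpath (predC (mem (descents a))) (sumn a) 0 e)%:R.
Proof.
move=> ca; have [cc sc dc] := comp_complP a; rewrite fundL_dpath sc.
congr (nat_of_bool _)%:R; apply: eq_dpath => i hi.
have h : (1 <= i < 1 + (sumn a).-1)%N by lia.
by rewrite /= dc mem_filter mem_iota h andbT.
Qed.

Lemma fundL_compl_rev a e : is_comp a ->
  fundL (comp_compl (rev a)) (emon e) = fundL (rev (comp_compl a)) (emon e).
Proof.
move=> ca; have [cc sc dc] := comp_complP a.
rewrite fundL_rev // !fundL_compl ?is_comp_rev // sumn_rev dpath_rev.
congr (nat_of_bool _)%:R; apply: eq_dpath => i hi.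
by rewrite /= mem_descents_rev.
Qed.

Lemma pseries_ext (f g : pseries) : (forall e, f (emon e) = g (emon e)) -> f = g.
Proof. by move=> fg; apply/funext => m; have [e ->] := emon_surj m. Qed.

Definition comps n : seq (seq nat) := fset_set [set a | is_comp a /\ sumn a = n]%classic.

Lemma mem_comps n a : (a \in comps n) = is_comp a && (sumn a == n).
Proof.
rewrite /comps in_fset_set; last exact: finite_comps.
by apply/idP/andP; rewrite classical_sets.in_setE /= => -[-> /eqP].
Qed.

Lemma lincomb_emon (c : seq nat -> {poly int}) F e :
    (forall a, is_comp a -> F a (emon e) != 0 -> sumn a = sumn e) ->
  lincomb c F (emon e) = \sum_(a <- comps (sumn e)) c a * F a (emon e).
Proof.
move=> hF; rewrite /lincomb.
rewrite -(fsbig_widen [set a | is_comp a /\ sumn a = sumn e]%classic).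
- by rewrite fsbig_finite //; exact: finite_comps.
- by move=> a [].
move=> a [/= ca nsa]; case: (eqVneq (F a (emon e)) 0) => [->|/hF h].
  by rewrite mulr0.
by case: nsa; split=> //; exact: h.
Qed.

Lemma dpath_size D n e : dpath D n 0 e -> sumn e = n.
Proof. by case/dpathE. Qed.

Lemma fundL_size a e : fundL a (emon e) != 0 -> sumn a = sumn e.
Proof.
by rewrite fundL_dpath; case: (boolP (dpath _ _ _ _)) => [/dpath_size //|]; rewrite eqxx.
Qed.

Lemma lincomb_fundL c e :
  lincomb c fundL (emon e) = \sum_(a <- comps (sumn e)) c a * fundL a (emon e).
Proof. by apply: lincomb_emon => a _; exact: fundL_size. Qed.

Lemma lincomb_eq (c : seq nat -> {poly int}) F G :
  (forall a e, is_comp a -> F a (emon e) = G a (emon e)) -> lincomb c F = lincomb c G.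
Proof.
move=> FG; apply: pseries_ext => e; apply: eq_fsbigr => a.
by rewrite classical_sets.in_setE /= => ca; rewrite FG.
Qed.

(** * Expanding quasisymmetric series in fundamental functions *)

Section MQSym.
Variable f : pseries.
Hypothesis fqsym : forall e, f (emon e) = f (emon [seq x <- e | (0 < x)%N]).

(** The system is unitriangular: at [emon a] only [fundL a] and functions of compositions with fewer
    parts contribute. [k] bounds the recursion depth; by [tri_coef_stable] every [k] above [size a]
    gives the same value. *)
Fixpoint tri_coef (k : nat) (a : seq nat) : {poly int} :=
  if k is k'.+1 then f (emon a) -
    \sum_(a' \in [set a' | is_comp a' /\ sumn a' = sumn a]%classic `\ a)
       tri_coef k' a' * fundL a' (emon a)
  else 0.

Lemma tri_coef_stable k k' a : is_comp a -> (size a < k)%N -> (size a < k')%N ->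
  tri_coef k a = tri_coef k' a.
Proof.
elim/ltn_ind: k k' a => -[//|k] IHk [//|k'] a ca sk sk' /=; congr (_ - _).
apply: eq_fsbigr => a'; rewrite classical_sets.in_setE /= => -[[ca' sa'] ne].
case: (pselect (fund_word a' (block_word a 0))) => [fw|nf]; last first.
  by rewrite fundL_block0 ?mulr0.
have [_ sz] := fund_word_size ca' ca fw ne; congr (_ * _).
by apply: IHk => //; [exact: leq_trans sz _|exact: leq_trans sz _].
Qed.

Lemma qsym_mQSym : mQSym f.
Proof.
exists (fun a => tri_coef (size a).+1 a); apply: pseries_ext => e.
rewrite fqsym lincomb_fundL; set b := [seq x <- e | _].
have cb : is_comp b by apply: filter_all.
have -> : sumn e = sumn b.
  by rewrite /b; elim: e {b cb} => //= -[|x] e /= ->.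
transitivity (\sum_(a <- comps (sumn b)) tri_coef (size a).+1 a * fundL a (emon b)); last first.
  by apply: eq_bigr => a _; rewrite !fundL_dpath dpath_filter.
rewrite -lincomb_fundL lincomb_block // -/(emon b) [tri_coef _ b]/= -addrA.
rewrite [X in _ + X](_ : _ = 0) ?addr0 // addrC; apply/eqP; rewrite subr_eq0; apply/eqP.
apply: eq_fsbigr => a'; rewrite classical_sets.in_setE /= => -[[ca' sa'] ne].
case: (pselect (fund_word a' (block_word b 0))) => [fw|nf]; last first.
  by rewrite fundL_block0 ?mulr0.
have [_ sz] := fund_word_size ca' cb fw ne; congr (_ * _).
exact: (@tri_coef_stable (size a').+1 (size b) a').
Qed.
End MQSym.

Lemma rho_emon f e : mQSym f -> rho f (emon e) = f (emon (rev e)).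
Proof.
move=> [c ->]; rewrite /rho fund_extE lincomb_fundL sumn_rev lincomb_emon.
  rewrite big_seq [RHS]big_seq; apply: eq_bigr => a; rewrite mem_comps => /andP[ca _].
  by rewrite fundL_rev.
move=> a ca; rewrite fundL_rev // => /fundL_size; by rewrite sumn_rev.
Qed.

(** The case of one [fundL] is [dpath2_alternating]; linearity does the rest, since each coefficient
    involves only compositions of one size. *)
Lemma psi_emon f : mQSym f -> psi_rel (fun e => f (emon e)) (fun e => psi f (emon e)).
Proof.
move=> [c ->]; rewrite /psi fund_extE.
pose H a p q : {poly int} := (dpath2 (mem (descents a)) (sumn a) 0 p q)%:R.
exists (fun p q => \sum_(a <- comps (sumn p + sumn q)) c a * H a p q); split.
- move=> p; rewrite addn0 lincomb_fundL; apply: eq_bigr => a _; congr (_ * _).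
  rewrite fundL_dpath /H; congr (nat_of_bool _)%:R.
  by elim: p (0%N) => //= x p IHp j; rewrite IHp.
- move=> q; rewrite add0n lincomb_emon.
    rewrite big_seq [RHS]big_seq; apply: eq_bigr => a; rewrite mem_comps => /andP[ca _].
    by rewrite fundL_compl.
  move=> a ca; rewrite fundL_compl //.
  by case: (boolP (dpath _ _ _ _)) => [/dpath_size //|]; rewrite eqxx.
- move=> p q; rewrite -cats1 sumn_cat /= !addn0; apply: eq_bigr => a _; congr (_ * _).
  suff h j : dpath2 (mem (descents a)) (sumn a) j (p ++ [:: 0%N]) q =
    dpath2 (mem (descents a)) (sumn a) j p q by rewrite /H h.
  by elim: p j => [|x p IHp] j /=; rewrite ?addn0 ?IHp.
(* All pairs of lists in the alternating sum have the same total, so one finite set of compositions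
   serves every term. *)
move=> p q n; transitivity (\sum_(i < n.+1) \sum_(a <- comps (sumn p + n + sumn q))
    c a * ((-1) ^+ i * H a (rcons p i) ((n - i)%N :: q))).
  apply: eq_bigr => i _; rewrite big_distrr /=.
  have -> : (sumn (rcons p i) + (n - i + sumn q) = sumn p + n + sumn q)%N.
    by rewrite -cats1 sumn_cat /= addn0; have := ltn_ord i; lia.
  by apply: eq_bigr => a _; rewrite mulrCA.
rewrite exchange_big /=; case: n => [|n] /=.
  rewrite addn0 mul1r; apply: eq_bigr => a _.
  by rewrite -big_distrr /= /H dpath2_alternating mul1r.
rewrite mul0r big1 // => a _.
by rewrite -big_distrr /= /H dpath2_alternating mul0r mulr0.
Qed.

Lemma omega_psi_rho f : mQSym f -> omega f = psi (rho f).
Proof.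
move=> [c ->]; rewrite /omega /rho fund_extE fund_extE.
(* [fund_extE] evaluates [psi] only on combinations of [fundL] itself, so the reversal is moved into
   the coefficients and later back. *)
have -> : lincomb c (fun a => fundL (rev a)) = lincomb (fun a => c (rev a)) fundL.
  apply: pseries_ext => e; rewrite lincomb_fundL lincomb_emon.
    rewrite (perm_big (map rev (comps (sumn e)))) /=.
      by rewrite big_map; apply: eq_bigr => a _; rewrite revK.
    apply: uniq_perm; rewrite ?(map_inj_uniq (inv_inj (@revK _))) ?fset_uniq // => a.
    apply/idP/mapP => [ha|[a' + ->]].
      by exists (rev a); rewrite ?revK // mem_comps is_comp_rev sumn_rev -mem_comps.
    by rewrite !mem_comps is_comp_rev sumn_rev.
  by move=> a ca /fundL_size; rewrite sumn_rev.
rewrite /psi fund_extE.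
have -> : lincomb (fun a => c (rev a)) (fun a => fundL (comp_compl a)) =
          lincomb c (fun a => fundL (comp_compl (rev a))).
  have hs a e : is_comp a -> fundL (comp_compl a) (emon e) != 0 -> sumn a = sumn e.
    move=> ca; rewrite fundL_compl //.
    by case: (boolP (dpath _ _ _ _)) => [/dpath_size //|]; rewrite eqxx.
  apply: pseries_ext => e; rewrite !lincomb_emon.
  - rewrite (perm_big (map rev (comps (sumn e)))) /=.
      by rewrite big_map; apply: eq_bigr => a _; rewrite revK.
    apply: uniq_perm; rewrite ?(map_inj_uniq (inv_inj (@revK _))) ?fset_uniq // => a.
    apply/idP/mapP => [ha|[a' + ->]].
      by exists (rev a); rewrite ?revK // mem_comps is_comp_rev sumn_rev -mem_comps.
    by rewrite !mem_comps is_comp_rev sumn_rev.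
  - by move=> a ca; rewrite -is_comp_rev in ca => /(hs _ _ ca); rewrite sumn_rev.
  - by move=> a ca; exact: hs.
by apply: lincomb_eq => a e ca; rewrite fundL_compl_rev.
Qed.

(** * The substitution of x / (1 - beta x) *)

Lemma expcm_ucmE (i k j : nat) : expcmn (ucm i) k j = (if i == j then k else 0)%N.
Proof.
rewrite /expcmn; case: k => [|k]; first by rewrite onecmE if_same.
have -> : iterop k.+1 (@mulcm nat) (ucm i) (onecm nat) j = iter k (mulcm (ucm i)) (ucm i) j.
  by rewrite iteropS.
elim: k => [|k IHk] /=; first by rewrite ucmE; case: eqP.
by rewrite mulcmE IHk ucmE; case: eqP.
Qed.

(** The product over [i] in [s] of the one-variable series [a i] in the variable [i]. *)
Definition psunivar (s : seq nat) (a : nat -> fps {poly int}) : pseries :=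
  fun m => if all (mem s) (finsupp m) then \prod_(i <- s) a i (m i) else 0.

Lemma psmul_univar (i : nat) (a : nat -> fps {poly int}) g n :
  psmul (psunivar [:: i] a) g n =
  \sum_(j <- iota 0 (n i).+1) a i j * g (divcm n (expcmn (ucm i) j)).
Proof.
set L := iota 0 (n i).+1.
have memL j : (j \in L) = (j <= n i)%N by rewrite mem_iota add0n ltnS.
have uL : uniq L by exact: iota_uniq.
move: L memL uL => L memL uL.
pose h j : {cmonom nat} * {cmonom nat} := (expcmn (ucm i) j, divcm n (expcmn (ucm i) j)).
have hE j : (j <= n i)%N -> mmul (h j).1 (h j).2 = n.
  move=> jn; apply/eqP/cmP => k; rewrite cmM divcmE expcm_ucmE.
  by case: eqP => [<-|]; rewrite ?subnKC // add0n subn0.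
have uE j : psunivar [:: i] a (expcmn (ucm i) j) = a i j.
  rewrite /psunivar big_seq1 expcm_ucmE eqxx ifT //; apply/allP => k.
  by rewrite -cmE_neq0 expcm_ucmE; case: (eqVneq i k) => [->|] /=; rewrite ?inE ?eqxx.
rewrite /psmul -(fsbig_widen (h @` [set` L])%classic); last 2 first.
- by move=> _ [j Lj <-]; apply: hE; rewrite -memL.
- move=> [p q] /= [epq np]; rewrite /psunivar; case: ifP => [sp|_]; last by rewrite mul0r.
  case: np; exists (p i); first by rewrite /= memL -epq cmM leq_addr.
  have ep : expcmn (ucm i) (p i) = p.
    apply/eqP/cmP => k; rewrite expcm_ucmE; case: eqP => [->//|ik].
    apply/esym/eqP; rewrite cmE_eq0; apply/negP => /(allP sp) /=.
    by rewrite inE => /eqP /esym.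
  by rewrite /h ep; congr pair; apply/eqP/cmP => k; rewrite divcmE -epq cmM addKn.
rewrite fsbig_image /=; last first.
  move=> j k _ _ [] /(congr1 (fun m : {cmonom nat} => m i)) + _.
  by rewrite !expcm_ucmE eqxx.
by rewrite -fsbig_seq ?uL //; apply: eq_bigr => j _; rewrite uE.
Qed.

Lemma psmul_univar_cons (i : nat) s a : i \notin s ->
  psmul (psunivar [:: i] a) (psunivar s a) = psunivar (i :: s) a.
Proof.
move=> si; apply/funext => n; rewrite psmul_univar -[(n i).+1]addn1 iotaD add0n.
rewrite big_cat /= big_seq1 big_seq big1 ?add0r => [|j]; last first.
  rewrite mem_iota add0n /= => jn; rewrite /psunivar ifF ?mulr0 //.
  apply/negP => /allP/(_ i); rewrite -cmE_neq0 divcmE expcm_ucmE eqxx subn_eq0 -ltnNge jn.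
  by move/(_ isT) => /=; rewrite (negPf si).
rewrite /psunivar; set n' := divcm _ _.
have n'E k : n' k = if i == k then 0%N else n k.
  by rewrite divcmE expcm_ucmE; case: eqP => [->|]; rewrite ?subnn ?subn0.
have -> : all (mem s) (finsupp n') = all (mem (i :: s)) (finsupp n).
  apply/allP/allP => h k.
    rewrite -cmE_neq0 /= inE => nk; case: (eqVneq k i) => //= ki; apply: h.
    by rewrite -cmE_neq0 n'E [i == k]eq_sym (negPf ki).
  rewrite -cmE_neq0 n'E; case: (eqVneq i k) => // ik nk.
  by have := h k; rewrite -cmE_neq0 => /(_ nk); rewrite /= inE eq_sym (negPf ik).
case: ifP => _; last by rewrite mulr0.
rewrite big_cons; congr (_ * _); apply: eq_big_seq => k ks; rewrite n'E.
by case: eqP => // ik; move: si; rewrite ik ks.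
Qed.

Lemma psmul_univar1 i (a b : fps {poly int}) :
  psmul (psunivar [:: i] (fun=> a)) (psunivar [:: i] (fun=> b)) =
  psunivar [:: i] (fun=> a * b).
Proof.
apply/funext => n; rewrite psmul_univar /psunivar.
transitivity (\sum_(j <- iota 0 (n i).+1) if all (mem [:: i]) (finsupp n) then a j * b (n i - j)%N else 0).
  apply: eq_bigr => j _; rewrite big_seq1 divcmE expcm_ucmE eqxx.
  have [sn|sn] := boolP (all _ (finsupp n)).
    rewrite ifT //; apply/allP => k; rewrite -cmE_neq0 divcmE => h; apply: (allP sn).
    by rewrite -cmE_neq0; apply: contraNneq h => ->.
  rewrite ifF ?mulr0 //; apply: contraNF sn => /allP h; apply/allP => k kn.
  have [->|nik] := eqVneq k i; first by rewrite /= inE.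
  by apply: h; rewrite -cmE_neq0 divcmE expcm_ucmE [i == k]eq_sym (negPf nik) subn0 cmE_neq0.
case: ifP => _; last by rewrite big1.
rewrite big_seq1 -[X in iota _ X](subn0 (n i).+1) -/(index_iota _ _) big_mkord.
by [].
Qed.

Lemma ps1_univar : ps1 = psunivar [::] (fun=> 0).
Proof.
apply/funext => m; rewrite /ps1 /psunivar big_nil.
have -> : (m == mone) = all (mem [::]) (finsupp m).
  apply/eqP/allP => [->|h]; first by move=> k; rewrite -cmE_neq0 cm1.
  apply/eqP/cmP => k; rewrite cm1; apply/eqP; rewrite cmE_eq0; apply/negP.
  by move/h.
by case: all.
Qed.

Lemma ps1_univar1 i : ps1 = psunivar [:: i] (fun=> 1).
Proof.
rewrite ps1_univar; apply/funext => m; rewrite /psunivar big_nil big_seq1.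
have -> : (1 : fps {poly int}) (m i) = (m i == 0%N)%:R by case: (m i).
case: (boolP (all _ _)) => [/allP h|/allPn[k km _]].
  have h0 k : m k = 0%N by apply/eqP; rewrite cmE_eq0; apply/negP => /h.
  rewrite h0 eqxx ifT //; apply/allP => k; by rewrite -cmE_neq0 h0.
case: ifP => // /allP/(_ k km) /=; rewrite inE => /eqP ki.
by move: km; rewrite ki -cmE_neq0 => /negPf ->.
Qed.

Local Notation y := (@fps_geom {poly int} 'X).

Lemma geom_univar i : geom i = psunivar [:: i] (fun=> y).
Proof.
apply/funext => m; rewrite /geom /genseries /psunivar big_seq1.
have [sm|sm] := boolP (all _ _); last first.
  rewrite -[RHS](fsbig_set0 +%R (fun k : nat => 'X^(k.-1))).
  apply: eq_fsbigl; apply/seteqP; split=> // k /= [_ em]; case/negP: sm; rewrite -em; apply/allP => j.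
  by rewrite -cmE_neq0 expcm_ucmE; case: (eqVneq i j) => [->|] /=; rewrite ?inE ?eqxx.
have em : expcmn (ucm i) (m i) = m.
  apply/eqP/cmP => k; rewrite expcm_ucmE; case: eqP => [->//|ik].
  apply/esym/eqP; rewrite cmE_eq0; apply/negP => /(allP sm) /=.
  by rewrite inE => /eqP /esym.
case em0 : (m i) => [|d].
  rewrite -[RHS](fsbig_set0 +%R (fun k : nat => 'X^(k.-1))).
  apply: eq_fsbigl; apply/seteqP; split=> // k /= [k0 ek]; move: k0.
  have e : m i = k by rewrite -ek expcm_ucmE eqxx.
  by rewrite -e em0.
rewrite -[RHS](fsbig_set1 +%R d.+1 (fun k => 'X^(k.-1))).
apply: eq_fsbigl; apply/seteqP; split=> k /=; last by move=> ->; split; rewrite // -em0.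
by case=> _ ek; rewrite -em0 -ek expcm_ucmE eqxx.
Qed.

Lemma psexp_geom i k : psexp (geom i) k = psunivar [:: i] (fun=> y ^+ k).
Proof.
rewrite /psexp; elim: k => [|k IHk] /=; first exact: ps1_univar1.
by rewrite IHk geom_univar psmul_univar1 exprS.
Qed.

Lemma big_psexp_geom (s : seq nat) (m : nat -> nat) : uniq s ->
  \big[psmul/ps1]_(i <- s) psexp (geom i) (m i) = psunivar s (fun i => y ^+ m i).
Proof.
elim: s => [_|i s IHs] /=; first by rewrite big_nil ps1_univar; apply/funext => n; rewrite /psunivar !big_nil.
move=> /andP[si us]; rewrite big_cons IHs // psexp_geom.
rewrite -[RHS]psmul_univar_cons //; congr (psmul _ _); apply/funext => n; by rewrite /psunivar !big_seq1.
Qed.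

Fixpoint boxes (e : seq nat) : seq (seq nat) :=
  if e is n :: e' then [seq k :: q | k <- index_iota 0 n.+1, q <- boxes e'] else [:: [::]].

Lemma boxes_cons n e :
  boxes (n :: e) = [seq k :: q | k <- index_iota 0 n.+1, q <- boxes e].
Proof. by []. Qed.

Lemma mem_boxes e q : (q \in boxes e) = (size q == size e) && all2 leq q e.
Proof.
elim: e q => [|n e IHe] [|k q]; rewrite ?boxes_cons ?inE //.
  by apply/allpairsP => -[[? ?] [_ _]].
rewrite [size _]/= [size (n :: e)]/= [all2 _ _ _]/= eqSS andbCA -IHe.
apply/allpairsP/andP => [[[k' q'] [h1 h2 [-> ->]]]|[h1 h2]].
  by move: h1; rewrite mem_index_iota ltnS.
by exists (k, q); rewrite mem_index_iota ltnS h1.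
Qed.

Lemma uniq_boxes e : uniq (boxes e).
Proof.
elim: e => // n e IHe; rewrite boxes_cons.
apply: allpairs_uniq => //; first exact: iota_uniq.
by move=> [x s] [z s'] _ _ /= [-> ->].
Qed.

Lemma geom_sum_boxes (f : seq nat -> {poly int}) e : geom_sum 'X f e =
  \sum_(q <- boxes e) f q * \prod_(i < size e) (y ^+ nth 0%N q i) (nth 0%N e i).
Proof.
elim: e f => [|n e IHe] f; first by rewrite /= big_seq1 big_ord0 mulr1.
rewrite boxes_cons big_allpairs_dep big_mkord [LHS]/=.
apply: eq_bigr => k _; rewrite IHe big_distrr; apply: eq_bigr => q _ /=.
by rewrite big_ord_recl mulrCA.
Qed.

Lemma emon_inj q q' : size q = size q' -> emon q = emon q' -> q = q'.
Proof.
move=> ss eq; apply: (@eq_from_nth _ 0%N) => // i _; by rewrite -!emonE eq.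
Qed.

(** The series [y ^+ k] starts in degree [k], so only monomials dividing $x^e$ contribute and the
    sum runs over a finite box. *)
Lemma at_geom_emon f e : at_geom f (emon e) = geom_sum 'X (fun q => f (emon q)) e.
Proof.
rewrite geom_sum_boxes /at_geom /pssubst.
pose F (m : {cmonom nat}) := f m * \prod_(i < size e) (y ^+ m i) (nth 0%N e i).
rewrite -(fsbig_widen (emon @` [set` boxes e])%classic) //; last first.
  move=> m [/= _ nm]; rewrite big_psexp_geom ?fset_uniq // /psunivar.
  case: ifP => [sm|_]; last by rewrite mulr0.
  have [/hasP[i im lt]|/hasPn h] := boolP (has (fun i => emon e i < m i)%N (finsupp m)).
    by rewrite (big_rem i) //= fps_geom_gt // mul0r mulr0.
  have le i : (m i <= nth 0%N e i)%N.
    rewrite -emonE; have [im|] := boolP (i \in finsupp m); first by rewrite leqNgt h.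
    by rewrite -cmE_eq0 => /eqP ->.
  case: nm; exists (mkseq m (size e)).
    rewrite /= mem_boxes size_mkseq eqxx all2E size_mkseq eqxx /=.
    apply/(all_nthP (0%N, 0%N)) => i; rewrite size_zip size_mkseq minnn => ie.
    by rewrite nth_zip ?size_mkseq //= nth_mkseq.
  apply/esym/emon_mkseq => i ie; have := le i.
  by rewrite (nth_default _ ie) leqn0 => /eqP.
rewrite fsbig_image; last first.
  move=> q q'; rewrite !classical_sets.in_setE /= !mem_boxes => /andP[/eqP sq _] /andP[/eqP sq' _].
  by apply: emon_inj; rewrite sq.
rewrite -fsbig_seq ?uniq_boxes //; apply: eq_big_seq => q; rewrite mem_boxes => /andP[/eqP sq qe].
rewrite big_psexp_geom ?fset_uniq // /psunivar; congr (_ * _).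
have y0 k d : (k == 0)%N -> (y ^+ k) d = (d == 0%N)%:R by move=> /eqP ->; rewrite expr0; case: d.
have sub : {subset finsupp (emon q) <= iota 0 (size e)}.
  move=> i; rewrite -cmE_neq0 emonE mem_iota add0n /=; apply: contraR; rewrite -leqNgt -sq.
  by move/(nth_default 0%N) ->.
have -> : \prod_(i < size e) (y ^+ nth 0%N q i) (nth 0%N e i) =
   \prod_(i <- iota 0 (size e)) (y ^+ emon q i) (emon e i).
  rewrite -[X in iota _ X](subn0 (size e)) -/(index_iota _ _) big_mkord.
  by apply: eq_bigr => i _; rewrite !emonE.
(* The products differ in the variables with exponent 0 in [q]. Their factor [y ^+ 0] contributes 1
   where [e] also has exponent 0; at any other such variable both sides vanish. *)
case: ifP => [sup|/negbT/allPn[i ie ni]].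
  rewrite [RHS](bigID (mem (finsupp (emon q)))) /= [X in _ * X]big1 ?mulr1 => [|i ni].
    rewrite -[RHS]big_filter; apply: perm_big; apply: uniq_perm.
    - exact: fset_uniq.
    - by rewrite filter_uniq ?iota_uniq.
    by move=> i; rewrite mem_filter andb_idr //; exact: sub.
  rewrite y0 ?cmE_eq0 // (_ : i \notin _) //; apply: contra ni; exact: (allP sup).
apply/esym; rewrite (big_rem i) /=.
  by rewrite y0 ?cmE_eq0 // ie mul0r.
rewrite mem_iota add0n /=; move: ie; rewrite -cmE_neq0 emonE; apply: contraR.
by rewrite -leqNgt => /(nth_default 0%N) ->.
Qed.

(** * Labeled posets and peak compositions *)

Section SystemInvolutions.
Variables (Q : finType) (Y : sys Q).

Lemma sys_series_emon e :
  sys_series Y (emon e) = foldr (sop 'X Y) (sfinal _) e set0.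
Proof. by apply: sys_seriesE => i; rewrite emonE. Qed.

Lemma sys_series_mQSym : mQSym (sys_series Y).
Proof.
apply: qsym_mQSym => e; rewrite !sys_series_emon; move: set0.
elim: e => //= -[|n] e IHe U /=; first by rewrite sop0.
by congr (sop _ _ _ _ _); apply/funext.
Qed.

(** Both sides are partners of the same coefficients under [psi_rel], the left by [psi_emon] and the
    right by cancellation at $-x$ and $x/(1-\beta x)$; such a partner is unique. *)
Lemma psi_sys_series :
    (forall (z1 z2 : fps {poly int}) w U, z1 + z2 + fps_const 'X * z1 * z2 = 0 ->
       vstep Y (fps_const 'X) z1 (vstep Y (fps_const 'X) z2 w) U = w U) ->
  psi (sys_series Y) = at_geom (sys_series Y).
Proof.
move=> cancel; apply: pseries_ext => e; rewrite at_geom_emon.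
have efold : (fun e => sys_series Y (emon e)) = (fun e => foldr (sop 'X Y) (sfinal _) e set0).
  by apply/funext => q; exact: sys_series_emon.
rewrite efold geom_sum_op; move: e; apply: psi_rel_fun (psi_emon sys_series_mQSym) _.
rewrite efold; apply: psi_rel_op => [w U|v U]; last exact: sop0.
rewrite ser_op_vstep (_ : ser_op _ _ _ _ _ w = vstep Y (fps_const 'X) (fps_geom 'X) w).
  by apply: cancel; exact: fps_geomP.
by apply/funext => V; rewrite ser_op_vstep.
Qed.

Lemma rho_sys_series : rho (sys_series Y) = sys_series (sys_rev Y).
Proof.
apply: pseries_ext => e; rewrite rho_emon; last exact: sys_series_mQSym.
rewrite sys_series_emon (@sys_seriesE _ (sys_rev Y) _ e (emonE e)).
by rewrite -foldr_sop_rev revK.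
Qed.
End SystemInvolutions.

Section LabelSystem.
Variables (Q : finType) (c : rel Q) (g : Q -> int).

Definition label_sys : sys Q := Sys c (fun _ _ => true)
  (fun p s t => if p then g s < g t else g t < g s).

Lemma psi_label_sys : (forall s t, c s t -> g s != g t) ->
  psi (sys_series label_sys) = at_geom (sys_series label_sys).
Proof.
by move=> cg; apply: psi_sys_series => z1 z2 w U hz; exact: vstep_label_cancel.
Qed.

Variable fs : pred Q.

Definition bar_sys : sys Q := Sys c (fun p s => p || ~~ fs s)
  (fun p s t => p && (g s < g t)).

Lemma psi_bar_sys : (forall s t, c s t -> g s != g t) ->
    (forall s t, c s t -> (g t < g s) = fs t) ->
    (forall s t, c s t -> fs t -> ~~ fs s) ->
  psi (sys_series bar_sys) = at_geom (sys_series bar_sys).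
Proof.
move=> cg gfs ff; apply: psi_sys_series => z1 z2 w U hz; exact: vstep_bar_cancel.
Qed.
End LabelSystem.

Lemma eq_genseries (T : choiceType) (A B : classical_sets.set T) w mon :
  (forall x, A x <-> B x) -> genseries A w mon = genseries B w mon.
Proof.
by move=> AB; congr genseries; apply/seteqP; split=> x /AB.
Qed.

Section PosetSystem.
Variables (d : Order.disp_t) (P : finPOrderType d) (g : P -> int).

Definition coversb : rel P := fun s t => `[< covers s t >].

Hypothesis g_inj : injective g.

Lemma coversb_neq s t : coversb s t -> g s != g t.
Proof. by move=> /asboolP[st _]; rewrite (inj_eq g_inj) lt_eqF. Qed.

Lemma Omega_sys : Omega g = sys_series (label_sys coversb g).
Proof.
rewrite /Omega /sys_series; apply: eq_genseries => sg.
split=> [[ne h]|[ne _ h1 h2]].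
  split=> // [q r /asboolP/h[]//|x q r cqr xq xr].
  have /asboolP/h[_ hu hp] := cqr; have := coversb_neq cqr; rewrite /=.
  case: ltgtP => // lt _.
    by rewrite (hu lt x xq xr).
  by rewrite (negPf (hp lt x xq xr)).
split=> // s t st; have cst : coversb s t by apply/asboolP.
split=> [|lt x xs xt|lt x xs xt]; first exact: h1.
  have := h2 x s t cst xs xt; rewrite /=; case: ifP => // _.
  by rewrite ltNge ltW.
apply/negP => ux; have := h2 x s t cst xs xt; rewrite /= ux.
by rewrite ltNge ltW.
Qed.

Lemma psi_Omega : psi (Omega g) = at_geom (Omega g).
Proof. by rewrite Omega_sys; apply: psi_label_sys; exact: coversb_neq. Qed.

End PosetSystem.

(** Dualizing reverses every comparison of labels along a cover, and exchanging primed and unprimed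
    letters reverses it again, so the labels stay as they are. *)
Lemma rho_Omega (d : Order.disp_t) (P : finPOrderType d) (g : P -> int) :
  injective g -> rho (Omega g) = @Omega _ (P^d)%type g.
Proof.
move=> g_inj; rewrite !Omega_sys // rho_sys_series; congr sys_series.
congr Sys.
  apply/funext => s; apply/funext => t; apply/asboolP/asboolP => -[st nz]; split=> //;
  by move=> z /andP[h1 h2]; apply: (nz z); apply/andP.
by apply/funext => p; apply/funext => s; apply/funext => t /=; case: p.
Qed.

Section Tuples.
Variable N : nat.

Definition tuple_of (sg : {ffun 'I_N -> {fset marked}}) : seq {fset marked} :=
  [seq sg i | i <- enum 'I_N].

Lemma size_tuple_of sg : size (tuple_of sg) = N.
Proof. by rewrite size_map size_enum_ord. Qed.

Lemma entry_tuple_of sg (i : 'I_N) : entry (tuple_of sg) i.+1 = sg i.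
Proof. by rewrite /entry /= (nth_map i) ?size_enum_ord // nth_ord_enum. Qed.

Lemma genseries_tuples (A : classical_sets.set (seq {fset marked}))
    (B : classical_sets.set {ffun 'I_N -> {fset marked}}) :
    (forall S, A S -> size S = N) -> (forall sg, A (tuple_of sg) <-> B sg) ->
  genseries A (fun S => 'X^(tuple_card S - N)) tuple_mon =
  genseries B (fun sg => 'X^(part_card sg - #|'I_N|)) (@part_mon 'I_N).
Proof.
move=> sA AB; apply/funext => m; rewrite /genseries.
have mE sg : tuple_mon (tuple_of sg) = part_mon sg.
  by rewrite /tuple_mon big_map /part_mon big_enum.
have cE sg : tuple_card (tuple_of sg) = part_card sg.
  by rewrite /tuple_card big_map /part_card big_enum.
rewrite (@reindex_fsbig _ _ _ _ _ tuple_of [set sg | B sg /\ part_mon sg = m]%classic).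
  by apply: eq_fsbigr => sg _; rewrite cE card_ord.
split.
- by move=> sg /= [/AB Bsg <-]; rewrite mE.
- move=> sg sg' _ _ e; apply/ffunP => i; by rewrite -!entry_tuple_of e.
move=> S /= [AS mS].
have eS : tuple_of [ffun i : 'I_N => nth fset0 S i] = S.
  apply: (@eq_from_nth _ fset0); first by rewrite size_tuple_of sA.
  move=> i; rewrite size_tuple_of => iN.
  by have := entry_tuple_of [ffun i : 'I_N => nth fset0 S i] (Ordinal iN);
     rewrite ffunE.
exists [ffun i : 'I_N => nth fset0 S i] => //=.
by split; [apply/AB; rewrite eS|rewrite -mE eS].
Qed.
End Tuples.

(** * Multipeak functions as series of labeled chains *)

Section Chain.
Variable N : nat.

Definition succ_rel : rel 'I_N := fun i j => j == i.+1 :> nat.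

(** A walk with steps 1 and -1. Entry [i] of a tuple is element [i - 1] of the chain, so position
    [i] of the descent set is tested on the step into element [i]. *)
Definition chain_label (D : pred nat) (i : 'I_N) : int :=
  \sum_(k < i) (if D k.+1 then -1 else 1).

Lemma chain_label_succ D i j : succ_rel i j ->
  chain_label D j = chain_label D i + (if D j then -1 else 1).
Proof.
rewrite /succ_rel /chain_label => /eqP ->; by rewrite big_ord_recr.
Qed.

Lemma chain_label_neq D i j : succ_rel i j -> chain_label D i != chain_label D j.
Proof.
move/chain_label_succ ->; case: ifP => _; apply/eqP => h; lia.
Qed.

Lemma chain_label_gt D i j : succ_rel i j -> (chain_label D j < chain_label D i) = D j.
Proof. by move/chain_label_succ ->; case: ifP => _; lia. Qed.

Lemma chain_label_lt D i j : succ_rel i j -> (chain_label D i < chain_label D j) = ~~ D j.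
Proof. by move/chain_label_succ ->; case: ifP => _; lia. Qed.
End Chain.
Arguments succ_rel N : clear implicits.
Arguments chain_label N D : clear implicits.

Definition chainK N (D : pred nat) := label_sys (succ_rel N) (chain_label N D).
Definition chainKbar N (D : pred nat) :=
  bar_sys (succ_rel N) (chain_label N D) (fun i : 'I_N => (i == 0 :> nat) || D i).

Lemma mpeakK_sys a : mpeakK a = sys_series (chainK (sumn a) (mem (descents a))).
Proof.
rewrite /mpeakK; apply: genseries_tuples => [S []//|sg]; set N := sumn a.
split=> [[_ ne h]|[ne _ h1 h2]].
  have ne' i : sg i != fset0 by apply: ne; apply: map_f; rewrite mem_enum.
  split=> // [i j ij|x i j ij xi xj].
    have hj : (0 < i.+1 < N)%N by rewrite ltn0Sn -(eqP ij) ltn_ord.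
    have ej : entry (tuple_of sg) i.+2 = sg j by rewrite -entry_tuple_of (eqP ij).
    by have [hp _ _] := h i.+1 hj; move: hp; rewrite ej entry_tuple_of.
  have hj : (0 < i.+1 < N)%N by rewrite ltn0Sn -(eqP ij) ltn_ord.
  have ej : entry (tuple_of sg) i.+2 = sg j by rewrite -entry_tuple_of (eqP ij).
  have [_] := h i.+1 hj; rewrite ej entry_tuple_of => hd hu.
  rewrite /= (chain_label_gt _ ij) (chain_label_lt _ ij) /= (eqP ij).
  case: ifP => ux; first by apply/negP => /hd/(_ x xi xj); rewrite ux.
  by apply/negPn/negP => /hu/(_ x xi xj); rewrite ux.
split=> [|A /mapP[i _ ->]//|i /andP[i0 iN]]; first exact: size_tuple_of.
have iN' : (i.-1 < N)%N by rewrite prednK // ltnW.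
pose i1 := Ordinal iN'; pose i2 := Ordinal iN.
have s12 : succ_rel _ i1 i2 by rewrite /succ_rel /= prednK.
have e1 : entry (tuple_of sg) i = sg i1 by rewrite -entry_tuple_of /= prednK.
have e2 : entry (tuple_of sg) i.+1 = sg i2 by rewrite -entry_tuple_of.
rewrite e1 e2; split; first exact: h1.
  move=> di x x1 x2; have := h2 x i1 i2 s12 x1 x2.
  by rewrite /= (chain_label_gt _ s12) (chain_label_lt _ s12) /= di; case: ifP.
move=> di x x1 x2; have := h2 x i1 i2 s12 x1 x2.
by rewrite /= (chain_label_gt _ s12) (chain_label_lt _ s12) /= (negPf di); case: ifP.
Qed.

Lemma mpeakKbar_sys a : mpeakKbar a = sys_series (chainKbar (sumn a) (mem (descents a))).
Proof.
rewrite /mpeakKbar; apply: genseries_tuples => [S []//|sg]; set N := sumn a.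
split=> [[_ ne h hf]|[ne hm h1 h2]].
  have ne' i : sg i != fset0 by apply: ne; apply: map_f; rewrite mem_enum.
  split=> // [x i xi|i j ij|x i j ij xi xj].
  - rewrite /=; case: (boolP (unprimed x)) => //= ux.
    apply: contra ux => fi; apply: (hf i (ltn_ord i)); last by rewrite entry_tuple_of.
    by rewrite inE; exact: fi.
  - have hj : (0 < i.+1 < N)%N by rewrite ltn0Sn -(eqP ij) ltn_ord.
    have ej : entry (tuple_of sg) i.+2 = sg j by rewrite -entry_tuple_of (eqP ij).
    by have [hp _ _] := h i.+1 hj; move: hp; rewrite ej entry_tuple_of.
  have hj : (0 < i.+1 < N)%N by rewrite ltn0Sn -(eqP ij) ltn_ord.
  have ej : entry (tuple_of sg) i.+2 = sg j by rewrite -entry_tuple_of (eqP ij).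
  have [_] := h i.+1 hj; rewrite ej entry_tuple_of => hd hu.
  rewrite /= (chain_label_lt _ ij) /= (eqP ij).
  case: (boolP (i.+1 \in descents a)) => di; last by rewrite (hu di x xi xj).
  by have := hd di x x xi xj; rewrite ltxx.
split=> [|A /mapP[i _ ->]//|i /andP[i0 iN]|i iN fi x]; first exact: size_tuple_of.
  have iN' : (i.-1 < N)%N by rewrite prednK // ltnW.
  pose i1 := Ordinal iN'; pose i2 := Ordinal iN.
  have s12 : succ_rel _ i1 i2 by rewrite /succ_rel /= prednK.
  have e1 : entry (tuple_of sg) i = sg i1 by rewrite -entry_tuple_of /= prednK.
  have e2 : entry (tuple_of sg) i.+1 = sg i2 by rewrite -entry_tuple_of.
  rewrite e1 e2; split; first exact: h1.
    move=> di x z x1 z2; rewrite lt_neqAle (h1 _ _ s12 x z x1 z2) andbT.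
    apply/eqP => exz; subst z; have := h2 x i1 i2 s12 x1 z2.
    by rewrite /= (chain_label_lt _ s12) /= di andbF.
  move=> di x x1 x2; have := h2 x i1 i2 s12 x1 x2.
  by rewrite /= => /andP[].
rewrite (entry_tuple_of sg (Ordinal iN)) => xi.
have := hm x _ xi; rewrite /=; move: fi; rewrite inE => ->.
by rewrite orbF.
Qed.

(** * Intervals of a chain *)

Section Letters.
Variables (Q : finType) (S : comNzRingType) (Y : sys Q) (b z : S).
Hypothesis excl : forall s t, srel Y s t -> spair Y false s t -> ~~ spair Y true s t.
Implicit Types (U X B C : {set Q}) (v : {set Q} -> S).

Definition no_rel X U : bool := [forall s in X, forall t in U, ~~ srel Y s t].

Definition okB X t : bool :=
  smark Y false t && [forall s in X, srel Y s t ==> spair Y false s t].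
Definition okC X s : bool :=
  smark Y true s && [forall t in X, srel Y s t ==> spair Y true s t].

(** The element holds the primed letter only, the unprimed one only, or both, which costs an extra
    letter and a factor [b]. *)
Definition letter_wt X x : S :=
  (okB X x)%:R + (okC X x)%:R + b * z * (okB X x && okC X x)%:R.

(** If [t] holds the primed letter, members of [X] related below it can only hold that letter as
    well; dually for an unprimed letter and members above. So the constraints on an element depend
    on [X] alone. The remaining conflict, an unprimed letter below a primed one, is excluded by
    [excl]. *)
Lemma spred_local U X B C : B :|: C = X ->
  spred Y U (B, C) =
  no_rel X U && [forall x, ((x \in B) ==> okB X x) && ((x \in C) ==> okC X x)].
Proof.
move=> eX; apply/andP/andP => [[/legalP[m1 n1 p1] /legalP[m2 n2 p2]]|[/forall_inP nr /forallP ok]].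
  split.
    apply/forall_inP => s; rewrite -eX => /setUP[sB|sC]; apply/forall_inP => t tU.
      exact: n1.
    by apply: n2; rewrite // inE tU.
  apply/forallP => x; apply/andP; split; apply/implyP => xB; apply/andP; split.
  - exact: m1.
  - apply/forall_inP => s; rewrite -eX => /setUP[sB|sC]; apply/implyP => csx; first exact: p1.
    by have := n2 s x sC; rewrite inE xB orbT csx => /(_ isT).
  - exact: m2.
  - apply/forall_inP => t; rewrite -eX => /setUP[tB|tC]; apply/implyP => cxt; last exact: p2.
    by have := n2 x t xB; rewrite inE tB orbT cxt => /(_ isT).
have nr' s t : s \in X -> t \in U -> ~~ srel Y s t by move=> sX; have /forall_inP := nr s sX; apply.
have okB' x : x \in B -> okB X x by move=> xB; have /andP[/implyP/(_ xB)] := ok x.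
have okC' x : x \in C -> okC X x by move=> xC; have /andP[_ /implyP/(_ xC)] := ok x.
have BX x : x \in B -> x \in X by rewrite -eX inE => ->.
have CX x : x \in C -> x \in X by rewrite -eX inE => ->; rewrite orbT.
split; apply/legalP; split.
- by move=> s /okB'/andP[].
- by move=> s t /BX; exact: nr'.
- by move=> s t /BX sX /okB'/andP[_ /forall_inP/(_ s sX)/implyP].
- by move=> s /okC'/andP[].
- move=> s t sC /setUP[tU|tB]; first by apply: nr'; rewrite // CX.
  apply/negP => cst; have /andP[_ /forall_inP/(_ s (CX s sC))/implyP/(_ cst) h1] := okB' t tB.
  have /andP[_ /forall_inP/(_ t (BX t tB))/implyP/(_ cst) h2] := okC' s sC.
  by have := excl cst h1; rewrite h2.
- by move=> s t sC /CX tX; have /andP[_ /forall_inP/(_ t tX)/implyP] := okC' s sC.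
Qed.

Lemma letter_wt_prod X :
  \sum_(B : {set Q}) \sum_(C : {set Q} | (B :|: C == X) &&
     [forall x, ((x \in B) ==> okB X x) && ((x \in C) ==> okC X x)])
    (b * z) ^+ #|B :&: C| = \prod_(x in X) letter_wt X x.
Proof.
pose F x (j : bool * bool) : S :=
  if [&& (j.1 || j.2) == (x \in X), j.1 ==> okB X x & j.2 ==> okC X x]
  then (b * z) ^+ (j.1 && j.2) else 0.
transitivity (\prod_x \sum_j F x j); last first.
  rewrite [RHS]big_mkcond; apply: eq_bigr => x _.
  rewrite -(pair_bigA _ (fun i j => F x (i, j))) /= !big_bool /F /letter_wt /=.
  case: (x \in X); case: (okB X x); case: (okC X x); rewrite /= ?expr0 ?expr1; ring.
rewrite bigA_distr_bigA /= pair_big_dep /=.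
pose h (f : {ffun Q -> bool * bool}) := ([set x | (f x).1], [set x | (f x).2]).
rewrite (reindex h) /=; last first.
  exists (fun p : {set Q} * {set Q} => [ffun x => (x \in p.1, x \in p.2)]) => [f|[B C]] _.
    by apply/ffunP => x; rewrite ffunE !inE; case: (f x).
  by congr (_, _); apply/setP => x; rewrite !inE ffunE.
rewrite big_mkcond; apply: eq_bigr => f _; rewrite /F.
case: ifP => [/andP[/eqP eX /forallP ok]|nok].
  transitivity (\prod_x (b * z) ^+ ((f x).1 && (f x).2)).
    rewrite prodrXr; congr (_ ^+ _); rewrite -sum1_card big_mkcond.
    by apply: eq_bigr => x _; rewrite !inE; case: (_ && _).
  apply: eq_bigr => x _; rewrite ifT //; have := ok x; rewrite !inE => ->.
  by rewrite -eX !inE eqxx.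
have [x nx] : exists x, ~~ [&& ((f x).1 || (f x).2) == (x \in X),
    (f x).1 ==> okB X x & (f x).2 ==> okC X x].
  apply/existsP; rewrite -negb_forall; apply: contraFN nok => /forallP ok.
  apply/andP; split.
    by apply/eqP/setP => x; have /andP[/eqP <- _] := ok x; rewrite !inE.
  by apply/forallP => x; have /andP[_] := ok x; rewrite !inE.
by rewrite (bigD1 x) //= (negPf nx) mul0r.
Qed.

Lemma vstep_letters v U : vstep Y b z v U =
  \sum_(X : {set Q} | no_rel X U)
    b ^+ #|X :&: U| * z ^+ #|X| * (\prod_(x in X) letter_wt X x) * v (U :|: X).
Proof.
rewrite /vstep /sstep step2E [RHS]big_mkcond; apply: eq_bigr => X _.
transitivity (b ^+ #|X :&: U| * v (U :|: X) *
  (if no_rel X U then z ^+ #|X| * \prod_(x in X) letter_wt X x else 0)); last first.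
  by case: ifP => _; rewrite ?mulr0 //; ring.
congr (_ * _); rewrite -letter_wt_prod.
transitivity (\sum_(B : {set Q}) \sum_(C : {set Q} | (B :|: C == X) && (no_rel X U &&
     [forall x, ((x \in B) ==> okB X x) && ((x \in C) ==> okC X x)]))
    z ^+ #|X| * (b * z) ^+ #|B :&: C|).
  apply: eq_bigr => B _; apply: eq_big => [C|C /andP[/eqP <- _]].
    by case: eqP => //= eX; rewrite -(spred_local _ eX).
  by rewrite exprMn mulrCA -!exprD mulrC -cardsUI addnC.
case: no_rel => /=; last by rewrite big1 // => B _; rewrite big_pred0 // => C; rewrite andbF.
by rewrite big_distrr /=; apply: eq_bigr => B _; rewrite big_distrr.
Qed.
End Letters.

Section ChainStep.
Variable N : nat.
Implicit Types (U X : {set 'I_N}) (u w l h : nat).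

Definition seg u : {set 'I_N} := [set i : 'I_N | (i < u)%N].
Definition itv l h : {set 'I_N} := [set i : 'I_N | (l <= i < h)%N].

Lemma seg0 : seg 0 = set0.
Proof. by apply/setP => i; rewrite !inE. Qed.

Lemma segN : seg N = setT.
Proof. by apply/setP => i; rewrite !inE ltn_ord. Qed.

Lemma big_itv (S : comNzRingType) (F : nat -> S) l h : (h <= N)%N ->
  \prod_(x in itv l h) F x = \prod_(l <= i < h) F i.
Proof.
move=> hN; rewrite [RHS](big_nat_widenl _ 0) // (big_nat_widen _ _ _ _ _ hN) big_mkord.
by apply: eq_bigl => i; rewrite inE.
Qed.

Lemma card_itv l h : (h <= N)%N -> #|itv l h| = (h - l)%N.
Proof.
move=> hN; rewrite -sum1_card -[RHS]muln1 -sum_nat_const_nat.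
rewrite [RHS](big_nat_widenl _ 0) // (big_nat_widen _ _ _ _ _ hN) big_mkord.
by apply: eq_bigl => i; rewrite inE.
Qed.

Variables (S : comNzRingType) (Y : sys 'I_N) (b z : S).
Hypothesis relY : forall i j, srel Y i j = succ_rel N i j.
Hypothesis excl : forall s t, srel Y s t -> spair Y false s t -> ~~ spair Y true s t.

Definition seg_supp (v : {set 'I_N} -> S) : Prop :=
  forall U, v U != 0 -> exists2 k, (k <= N)%N & U = seg k.

(** To pass from [seg u] to [seg w], the new elements [u], ..., [w - 1] receive the current absolute
    value, and possibly also [u - 1], the only old element whose successor is still empty; that
    repetition costs [b]. *)
Definition kernel (phi : nat -> nat -> S) u w : S :=
  z ^+ (w - u) * phi u w + (if (0 < u)%N then b * z ^+ (w - u).+1 * phi u.-1 w else 0).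

Lemma seg_inj u w : (u <= N)%N -> (w <= N)%N -> seg u = seg w -> u = w.
Proof.
move=> uN wN /setP e; have h x y : (x <= N)%N -> (forall i : 'I_N, (i < y)%N = (i < x)%N) -> (y < x)%N -> False.
  move=> xN hxy yx; have yN : (y < N)%N by apply: leq_trans xN.
  by have := hxy (Ordinal yN); rewrite /= ltnn yx.
case: (ltngtP u w) => // lt; [case: (h w u wN _ lt)|case: (h u w uN _ lt)];
  by move=> i; have := e i; rewrite !inE.
Qed.

Lemma no_rel_seg X u w : (u <= w <= N)%N -> no_rel Y X (seg u) && (seg u :|: X == seg w) =
  (X == itv u w) || (0 < u)%N && (X == itv u.-1 w).
Proof.
move=> uwN; have nrE : no_rel Y X (seg u) = [forall s in X, (u <= s.+1)%N].
  apply/forall_inP/forall_inP => nr s sX.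
    rewrite leqNgt; apply/negP => su; have sN : (s.+1 < N)%N by lia.
    have /forall_inP/(_ (Ordinal sN)) := nr s sX.
    by rewrite inE relY /succ_rel /= eqxx su => /(_ isT).
  apply/forall_inP => t; rewrite inE relY /succ_rel => tu; apply/eqP => e.
  by have := nr s sX; rewrite -e leqNgt tu.
rewrite nrE; apply/andP/orP => [[/forall_inP nr /eqP/setP eX]|].
  have eX' (x : 'I_N) : (x < u)%N || (x \in X) = (x < w)%N by have := eX x; rewrite !inE.
  have [/existsP[y /andP[yX yu]]|/existsPn nX] := boolP [exists y : 'I_N, (y \in X) && (y < u)%N].
    right; have := nr y yX => uy; rewrite (leq_ltn_trans (leq0n y) yu) /=.
    have ey : y = u.-1 :> nat by lia.
    apply/eqP/setP => x; rewrite inE; have := eX' x; have := nr x.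
    case: (eqVneq x y) => [->|nxy]; first by rewrite yX; lia.
    have : (x : nat) != y by rewrite -(inj_eq val_inj) in nxy.
    by case: (x \in X) => // ; [move=> ? /(_ isT)|]; lia.
  left; apply/eqP/setP => x; rewrite inE; have := eX' x; have := nX x.
  by case: (x \in X); rewrite /= ?orbT ?orbF -?leqNgt; lia.
case=> [/eqP ->|/andP[u0 /eqP ->]]; split.
- by apply/forall_inP => s; rewrite inE; lia.
- by apply/eqP/setP => x; rewrite !inE; lia.
- by apply/forall_inP => s; rewrite inE; lia.
- by apply/eqP/setP => x; rewrite !inE; lia.
Qed.

(** Sets [X] leading outside the initial segments contribute nothing, as [v] vanishes there. The
    value [phi l l = 1] accounts for reaching no new element. *)
Lemma vstep_chain phi v u : seg_supp v -> (u <= N)%N ->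
    (forall l, phi l l = 1) ->
    (forall l h, (l < h <= N)%N -> \prod_(x in itv l h) letter_wt Y b z (itv l h) x = phi l h) ->
  vstep Y b z v (seg u) = \sum_(u <= w < N.+1) kernel phi u w * v (seg w).
Proof.
move=> sv uN phi1 hphi; rewrite vstep_letters //.
pose F X := b ^+ #|X :&: seg u| * z ^+ #|X| * (\prod_(x in X) letter_wt Y b z X x) * v (seg u :|: X).
have FE l w : (l <= w <= N)%N -> (u <= w)%N -> seg u :|: itv l w = seg w ->
    F (itv l w) = b ^+ #|itv l w :&: seg u| * z ^+ (w - l) * phi l w * v (seg w).
  move=> lw uw e; rewrite /F e card_itv; last lia.
  congr (_ * _ * _).
  case: (ltngtP l w) lw => [lw|/[swap]|->] lN; try lia; first by rewrite hphi // lw; lia.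
  by rewrite phi1 big_pred0 // => x; rewrite inE; lia.
transitivity (\sum_(u <= w < N.+1) \sum_(X : {set 'I_N} | no_rel Y X (seg u) && (seg u :|: X == seg w)) F X).
  rewrite (exchange_big_dep (fun X => no_rel Y X (seg u))) /=; last by move=> w X _ /andP[].
  apply: eq_bigr => X nr; rewrite -[LHS]/(F X); case: (eqVneq (F X) 0) => [->|FX].
    by rewrite big1.
  have [k kN ek] : exists2 k, (k <= N)%N & seg u :|: X = seg k.
    by apply: sv; apply: contraNneq FX; rewrite /F => ->; rewrite mulr0.
  have uk : (u <= k)%N.
    rewrite leqNgt; apply/negP => ku; have kN' : (k < N)%N by lia.
    by move/setP/(_ (Ordinal kN')): ek; rewrite !inE /= ku ltnn.
  rewrite [RHS](big_nat_widenl _ 0) // big_mkord (big_pred1 (Ordinal (kN : (k < N.+1)%N))) //= => w.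
  rewrite nr ek /= -(inj_eq val_inj) /=.
  apply/andP/eqP => [[/eqP e uw]|->]; last by rewrite eqxx.
  have wN : (w <= N)%N by rewrite -ltnS.
  by apply/val_inj/esym/(seg_inj kN wN)/val_inj.
rewrite big_nat_cond [RHS]big_nat_cond; apply: eq_bigr => w; rewrite andbT ltnS => /andP[uw wN].
have uwN : (u <= w <= N)%N by rewrite uw.
under eq_bigl => X do rewrite no_rel_seg //.
have s0 : seg u :|: itv u w = seg w by apply/setP => x; rewrite !inE; lia.
rewrite (bigD1 (itv u w)) ?eqxx //= FE //.
rewrite (_ : itv u w :&: seg u = set0) ?cards0 ?expr0 ?mul1r; last by apply/setP => x; rewrite !inE; lia.
rewrite /kernel mulrDl; congr (_ + _); case: posnP => [u0|u0].
  by rewrite mul0r big_pred0 // => X; rewrite u0 /= orbF andbN.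
have s1 : seg u :|: itv u.-1 w = seg w by apply/setP => x; rewrite !inE; lia.
have uN1 : (u.-1 < N)%N by lia.
rewrite (big_pred1 (itv u.-1 w)) => [|X].
  rewrite FE //; last lia.
  have -> : itv u.-1 w :&: seg u = [set Ordinal uN1].
    by apply/setP => x; rewrite !inE -(inj_eq val_inj) /=; lia.
  by rewrite cards1 expr1; congr (_ * z ^+ _ * _ * _); lia.
rewrite /= andb_orl andbN /=; case: eqP => // ->; apply/eqP => /setP/(_ (Ordinal uN1)).
by rewrite !inE /=; lia.
Qed.
End ChainStep.

Definition nop (p : pred nat) (l h : nat) : bool :=
  all (fun x => ~~ p x) (index_iota l.+1 h).

Lemma nop1 p l : nop p l l.+1.
Proof. by rewrite /nop /index_iota subnn. Qed.

Lemma nopS p l h : (l < h)%N -> nop p l h.+1 = nop p l h && ~~ p h.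
Proof.
move=> lh; rewrite /nop /index_iota (_ : (h.+1 - l.+1 = (h - l.+1) + 1)%N); last lia.
by rewrite iotaD all_cat /= andbT subnKC.
Qed.

Lemma eq_nop p p' l h : (forall x, (l < x < h)%N -> p x = p' x) -> nop p l h = nop p' l h.
Proof. by move=> e; apply: eq_in_all => x; rewrite mem_index_iota => /e ->. Qed.

(** * Weights of the intervals sharing an absolute value *)

Section IntervalWeights.
Variables (S : comNzRingType) (q : S).

Section General.
Variables (mf mt pf pt : nat -> bool).

Definition lB l x : bool := mf x && ((x == l) || pf x).
Definition lC h x : bool := mt x && ((x.+1 == h) || pt x.+1).
Definition itv_wt l h : S :=
  \prod_(l <= x < h) ((lB l x)%:R + (lC h x)%:R + q * (lB l x && lC h x)%:R).

(** [itv_wt] without the exemption of the last element, so that enlarging [h] only appends a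
    factor. *)
Definition pre_wt l h : S :=
  \prod_(l <= x < h) ((lB l x)%:R + (mt x && pt x.+1)%:R +
                      q * (lB l x && (mt x && pt x.+1))%:R).

Lemma itv_wtS l h : (l <= h)%N -> itv_wt l h.+1 =
  pre_wt l h * ((lB l h)%:R + (mt h)%:R + q * (lB l h && mt h)%:R).
Proof.
move=> lh; rewrite /itv_wt big_nat_recr //= {3 4}/lC eqxx /= andbT; congr (_ * _).
apply: eq_big_nat => x /andP[_ xh]; rewrite /lC (_ : (x.+1 == h.+1) = false) //.
by rewrite eqSS ltn_eqF.
Qed.

Lemma pre_wtS l h : (l <= h)%N -> pre_wt l h.+1 =
  pre_wt l h * ((lB l h)%:R + (mt h && pt h.+1)%:R + q * (lB l h && (mt h && pt h.+1))%:R).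
Proof. by move=> lh; rewrite /pre_wt big_nat_recr. Qed.

Lemma letter_wt_itv N (Y : sys 'I_N) (b z : S) l h : q = b * z -> (h <= N)%N ->
    (forall i j, srel Y i j = succ_rel N i j) ->
    (forall i, smark Y false i = mf i) -> (forall i, smark Y true i = mt i) ->
    (forall i j, succ_rel N i j -> spair Y false i j = pf j) ->
    (forall i j, succ_rel N i j -> spair Y true i j = pt j) ->
  \prod_(x in itv N l h) letter_wt Y b z (itv N l h) x = itv_wt l h.
Proof.
move=> qE hN relY hmf hmt hpf hpt; rewrite /itv_wt -(@big_itv N) //.
apply: eq_bigr => x; rewrite inE => lxh; rewrite /letter_wt -qE.
have -> : okB Y (itv N l h) x = lB l x.
  rewrite /okB hmf; congr (_ && _); apply/forall_inP/orP => [H|H s].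
    case: (eqVneq (x : nat) l) => [|xl]; [by left|right].
    have xN : (x.-1 < N)%N by have := ltn_ord x; lia.
    have sx : succ_rel N (Ordinal xN) x by rewrite /succ_rel /=; lia.
    by have := H (Ordinal xN); rewrite inE relY sx hpf //=; apply; lia.
  rewrite inE relY => ls; apply/implyP => sx; rewrite hpf //; case: H => // /eqP xl.
  by move: sx; rewrite /succ_rel; lia.
have -> : okC Y (itv N l h) x = lC h x.
  rewrite /okC hmt; congr (_ && _); apply/forall_inP/orP => [H|H s].
    case: (eqVneq (x.+1 : nat) h) => [|xl]; [by left|right].
    have xN : (x.+1 < N)%N by lia.
    have sx : succ_rel N x (Ordinal xN) by rewrite /succ_rel /=.
    by have := H (Ordinal xN); rewrite inE relY sx hpt //=; apply; lia.
  rewrite inE relY => ls; apply/implyP => sx; rewrite hpt //.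
  have es : s = x.+1 :> nat by apply/eqP.
  by case: H => [/eqP xl|]; [lia|rewrite es].
by [].
Qed.
End General.

Variable D E : pred nat.

(** An element may be primed if the labels descend into it, unprimed if they ascend out of it, with
    exemptions at the two ends. An interior peak has no choice, a valley has weight [2 + q], the
    others 1; without interior peak there is exactly one valley. *)
Lemma itv_wt_peak l h : (l <= h)%N ->
  itv_wt xpredT xpredT D (predC D) l h.+1 =
  (nop (fun x => ~~ D x && D x.+1) l h)%:R * (2 + q).
Proof.
move=> lh; rewrite itv_wtS //; case: (ltngtP l h) lh => // [lh _|<- _]; last first.
  rewrite /pre_wt big_geq // /lB eqxx /nop /index_iota (_ : (l - l.+1)%N = 0%N) /=; last lia.
  by ring.
(* If the labels still descend into [h], the valley has not been passed yet. *)
have -> : pre_wt xpredT xpredT D (predC D) l h =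
    (nop (fun x => ~~ D x && D x.+1) l h)%:R * (if D h then 1 else 2 + q).
  elim: h lh => // h IHh; rewrite ltnS leq_eqVlt => /orP[/eqP <-|lh].
    rewrite /pre_wt big_nat1 nop1 /lB eqxx /=; case: (D l.+1) => /=; ring.
  rewrite pre_wtS ?(ltnW lh) // IHh // nopS //.
  rewrite /lB (gtn_eqF lh) /=; case: (nop _ _ _); case: (D h); case: (D h.+1) => /=; ring.
rewrite /lB (gtn_eqF lh) /=; case: (D h) => /=; ring.
Qed.

Hypothesis E0 : ~~ E 0%N.
Hypothesis E1 : ~~ E 1%N.
Hypothesis ES : forall x, E x -> ~~ E x.+1.

(** Only the first element of the interval can be primed, so the choice between 1 and [2 + q] is
    made there; any later element is unprimed, if legal at all. *)
Lemma itv_wt_first l h (fs := fun x => (x == 0%N) || E x) : (l <= h)%N ->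
  itv_wt (fun x => ~~ fs x) xpredT xpred0 (predC E) l h.+1 =
  (nop (E \o succn) l h)%:R * (if fs l || ((l < h)%N && E l.+1) then 1 else 2 + q).
Proof.
move=> lh; rewrite itv_wtS //; case: (ltngtP l h) lh => // [lh _|<- _]; last first.
  rewrite /pre_wt big_geq // /lB eqxx /= /nop /index_iota (_ : (l - l.+1)%N = 0%N) /=; last lia.
  by rewrite orbF andbT; case: (fs l) => /=; ring.
have -> : pre_wt (fun x => ~~ fs x) xpredT xpred0 (predC E) l h =
    (nop (E \o succn) l h)%:R * (if fs l || E l.+1 then 1 else 2 + q).
  elim: h lh => // h IHh; rewrite ltnS leq_eqVlt => /orP[/eqP <-|lh].
    rewrite /pre_wt big_nat1 nop1 /lB eqxx /=.
    have : E l.+1 -> ~~ fs l.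
      move=> El; rewrite /fs negb_or; apply/andP; split.
        by apply: contraTneq El => ->.
      by apply: contraL El => /ES.
    by case: (E l.+1) => [/(_ isT)|_]; case: (fs l) => //= *; ring.
  rewrite pre_wtS ?(ltnW lh) // IHh // nopS //.
  rewrite /lB (gtn_eqF lh) /=; case: (nop _ _ _); case: (E h.+1); rewrite /= ?andbF /=; ring.
by rewrite /lB (gtn_eqF lh) /= andbF /=; ring.
Qed.

(** The mirror image: only the last element can be unprimed and decides the weight. *)
Lemma itv_wt_last N l h (ls := fun x => (x.+1 == N)%N || E x.+2) : (l <= h)%N -> (h < N)%N ->
    (forall x, E x -> (x < N)%N) ->
  itv_wt xpredT (fun x => ~~ ls x) (predC (E \o succn)) xpred0 l h.+1 =
  (nop (E \o succn) l h)%:R * (if ((l < h)%N && E h.+1) || ls h then 1 else 2 + q).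
Proof.
move=> lh hN EN; rewrite itv_wtS //.
have -> : pre_wt xpredT (fun x => ~~ ls x) (predC (E \o succn)) xpred0 l h =
    (nop (E \o succn) l h)%:R.
  elim: h lh {hN} => [|h IHh]; last rewrite leq_eqVlt => /orP[/eqP <-|lh].
  - by rewrite leqn0 => /eqP ->; rewrite /pre_wt big_geq.
  - by rewrite /pre_wt big_geq // /nop /index_iota (_ : (_ - _)%N = 0%N) //; lia.
  rewrite pre_wtS // IHh //.
  rewrite /lB !andbF /= mulr0 !addr0.
  rewrite ltnS in lh; case: (eqVneq h l) => [->|nhl] /=.
    by rewrite mulr1 nop1 /nop /index_iota (_ : (_ - _)%N = 0%N) //; lia.
  by rewrite nopS ?ltn_neqAle 1?eq_sym ?nhl // -mulnb natrM.
have els : E h.+1 -> ~~ ls h.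
  move=> Eh; rewrite /ls negb_or; apply/andP; split; last exact: ES.
  by have := EN _ Eh; lia.
rewrite /lB; case: (ltngtP l h) lh => // [lh _|_ _] /=; last by case: (ls h) => /=; ring.
by case: (E h.+1) els => [/(_ isT)|_]; case: (ls h) => //= *; ring.
Qed.
End IntervalWeights.

(** * Conjugating the two bar kernels *)

Section Conjugation.
Variables (S : comNzRingType) (N : nat) (E : pred nat) (b z : S).
Hypothesis E0 : ~~ E 0%N.
Hypothesis E1 : ~~ E 1%N.
Hypothesis ES : forall x, E x -> ~~ E x.+1.
Hypothesis EN : forall x, E x -> (x < N)%N.

Let q : S := b * z.

Definition gap_free l h : bool := nop (E \o succn) l h.-1.

Definition phi_first l h : S := if (l < h)%N then (gap_free l h)%:R *
  (if [|| l == 0%N, E l | (l.+1 < h)%N && E l.+1] then 1 else 2 + b * z) else 1.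
Definition phi_last l h : S := if (l < h)%N then (gap_free l h)%:R *
  (if [|| (l.+1 < h)%N && E h, h == N | E h.+1] then 1 else 2 + b * z) else 1.

(** On intervals with at least two elements and [h <= N], the nonzero values of [phi_first l h] are
    [2 + b * z] if [tau l] and 1 otherwise; those of [phi_last l h] depend on [tau h] in the same
    way. So for [b = 0] the diagonal matrix [1 + tau] conjugates one into the other; for general [b]
    the subdiagonal entries of [conjugate] supply the correction. *)
Definition tau u : bool := [&& (0 < u)%N, (u < N)%N, ~~ E u & ~~ E u.+1].

Definition reach (phi : nat -> nat -> S) u w : S :=
  phi u w + (if u is u'.+1 then q * phi u' w else 0).

Arguments gap_free : simpl never.

Lemma gap_free_small l h : (h <= l.+2)%N -> gap_free l h.
Proof. by move=> lh; rewrite /gap_free /nop /index_iota (_ : (_ - _)%N = 0%N) //; lia. Qed.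

Lemma gap_freeR l h : (l.+1 < h)%N -> gap_free l h.+1 = gap_free l h && ~~ E h.
Proof.
move=> lh; rewrite /gap_free /= -{1}(prednK (leq_ltn_trans (leq0n _) lh)) nopS ?prednK //.
  by rewrite /= prednK // (leq_ltn_trans _ lh).
by lia.
Qed.

Lemma gap_freeL l h : (l.+2 < h)%N -> gap_free l h = ~~ E l.+2 && gap_free l.+1 h.
Proof.
move=> lh; rewrite /gap_free /nop /index_iota.
by rewrite (_ : (h.-1 - l.+1 = (h.-1 - l.+2).+1)%N) //=; lia.
Qed.

Ltac decide_nat :=
  repeat match goal with
  | |- context [(?a < ?b)%N] =>
      first [ rewrite (_ : (a < b)%N = true); [|by lia]
            | rewrite (_ : (a < b)%N = false); [|by lia] ]
  | |- context [@eq_op _ ?a ?b] =>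
      first [ rewrite (_ : @eq_op _ a b = true); [|by lia]
            | rewrite (_ : @eq_op _ a b = false); [|by lia] ]
  end.

(** The entry just below the diagonal of the conjugation identity; [reach_conj] treats the entries
    on and above it. *)
Lemma reach_diag u : (0 < u <= N)%N ->
  reach phi_first u u * (tau u.-1)%:R = (tau u.-1)%:R * reach phi_last u.-1 u.-1.
Proof.
case: u => // -[|u] uN.
  by rewrite /tau /= mulr0 mul0r.
rewrite /reach /phi_first /phi_last /tau /= !gap_free_small; try lia.
have EwN : E u.+2 -> (u.+1 == N) = false by move=> /EN; lia.
decide_nat; rewrite /=.
by case: (E u.+1); case: (E u.+2) => /=; rewrite ?mulr0 ?mul0r //; rewrite /q; ring.
Qed.

Ltac split_gaps :=
  repeat match goal with
  | |- context [gap_free ?l ?h] => rewrite (@gap_free_small l h); [|by lia]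
  end;
  repeat match goal with
  | |- context [gap_free ?l ?h.+1] => rewrite (@gap_freeR l h); [|by lia]
  end;
  repeat match goal with
  | |- context [gap_free ?l ?h] => rewrite (@gap_free_small l h); [|by lia]
  end;
  repeat match goal with
  | |- context [gap_free ?l ?h] => rewrite (@gap_freeL l h); [|by lia]
  end.

Ltac split_bools :=
  repeat match goal with
  | |- context [E ?x] => case: (E x) => //=
  | |- context [gap_free ?l ?h] => case: (gap_free l h) => //=
  | |- context [@eq_op _ ?a ?b] => case: (@eq_op _ a b) => //=
  end; move=> *; ring.

Lemma reach_conj u w : (u <= w <= N)%N ->
  reach phi_first u w * (1 + (tau w)%:R) + q * (tau w)%:R * reach phi_first u w.+1 =
  (1 + (tau u)%:R) * reach phi_last u w +
    (if u is u'.+1 then q * (tau u')%:R * reach phi_last u' w else 0).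
Proof.
move=> /andP[uw wN].
have cE x : E x ==> ~~ E x.+1 by apply/implyP; exact: ES.
have EwN : E w ==> (w != N) by apply/implyP => /EN; lia.
have EwN1 : E w.+1 ==> (w != N) by apply/implyP => /EN; lia.
have tw : (w < N)%N = (w != N) by rewrite ltn_neqAle wN andbT.
(* In the narrow cases the intervals are too short for [gap_free] to split uniformly. In the wide
   case both ends are peeled off until all terms share one [gap_free] factor. *)
have fin : (w = u) \/ (w = u.+1) \/ (w = u.+2) \/ (u.+2 < w)%N by lia.
have c1 := cE u; have c2 := cE u.-1; have c3 := cE w; have c4 := cE u.+1.
rewrite /reach /phi_first /phi_last /tau /q.
case: fin => [ew|[ew|[ew|lw]]]; [subst w|subst w|subst w|].
- case: u uw wN c1 c2 c3 c4 EwN EwN1 tw => [|[|u]] uw wN c1 c2 c3 c4 EwN EwN1 tw;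
  rewrite ?tw; clear tw; move: c1 c2 c3 EwN EwN1; clear c4;
  rewrite ?(negPf E0) ?(negPf E1) /=; split_gaps; decide_nat; rewrite /=; by split_bools.
- case: u uw wN c1 c2 c3 c4 EwN EwN1 tw => [|[|u]] uw wN c1 c2 c3 c4 EwN EwN1 tw;
  rewrite ?tw; clear tw; move: c1 c2 c3 EwN EwN1; clear c4;
  rewrite ?(negPf E0) ?(negPf E1) /=; split_gaps; decide_nat; rewrite /=; by split_bools.
- case: u uw wN c1 c2 c3 c4 EwN EwN1 tw => [|[|u]] uw wN c1 c2 c3 c4 EwN EwN1 tw;
  rewrite ?tw; clear tw; move: c1 c2 c3 c4 EwN EwN1;
  rewrite ?(negPf E0) ?(negPf E1) /=; split_gaps; decide_nat; rewrite /=; by split_bools.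
- rewrite ?tw; clear tw; move: c1 c2 c3 c4 EwN EwN1; case: u uw lw => [|[|u]] uw lw;
  rewrite ?(negPf E0) ?(negPf E1) /=;
  repeat match goal with
  | |- context [gap_free ?l w.+1] => rewrite (@gap_freeR l w); [|by lia]
  end;
  decide_nat; rewrite /=.
  + by split_bools.
  + rewrite (@gap_freeL 0); [|by lia]; rewrite /=; by split_bools.
  + rewrite (@gap_freeL u); [|by lia]; rewrite (@gap_freeL u.+1); [|by lia]; rewrite /=; by split_bools.
Qed.
End Conjugation.

Section KernelConjugation.
Variables (S : comNzRingType) (N : nat) (E : pred nat) (b z : S).
Hypothesis E0 : ~~ E 0%N.
Hypothesis E1 : ~~ E 1%N.
Hypothesis ES : forall x, E x -> ~~ E x.+1.
Hypothesis EN : forall x, E x -> (x < N)%N.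

Definition conjugate (x : nat -> S) u : S :=
  (1 + (tau N E u)%:R) * x u + (if u is u'.+1 then b * (tau N E u')%:R * x u' else 0).

Lemma kernel_reach phi u w : kernel b z phi u w = z ^+ (w - u) * reach b z phi u w.
Proof.
by rewrite /kernel /reach mulrDr; congr (_ + _); case: u => [|u] /=;
   rewrite ?mulr0 // exprS; ring.
Qed.

Lemma kernel_conj x u : (u <= N)%N ->
  \sum_(u <= w < N.+1) kernel b z (phi_first E b z) u w * conjugate x w =
  conjugate (fun u => \sum_(u <= w < N.+1) kernel b z (phi_last N E b z) u w * x w) u.
Proof.
move=> uN; under eq_bigr => w _ do rewrite kernel_reach /conjugate mulrDr.
rewrite big_split /=; set q := b * z; set rF := reach b z (phi_first E b z).
(* The added term [w = N] vanishes because [tau N] is false, so no interval ends beyond the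
   chain. *)
have shift u0 : (u0 <= N)%N ->
    \sum_(u0 <= w < N) z ^+ (w.+1 - u) * rF u w.+1 * (b * (tau N E w)%:R * x w) =
    \sum_(u0 <= w < N.+1) z ^+ (w.+1 - u) * rF u w.+1 * (b * (tau N E w)%:R * x w).
  move=> u0N; rewrite big_nat_recr //= [X in _ + X](_ : _ = 0) ?addr0 //.
  by rewrite /tau ltnn /= andbF !(mulr0, mul0r).
have second : \sum_(u <= w < N.+1) z ^+ (w - u) * rF u w *
      (if w is w'.+1 then b * (tau N E w')%:R * x w' else 0) =
    (if u is u'.+1 then rF u u * (tau N E u')%:R * b * x u' else 0) +
    \sum_(u <= w < N.+1) z ^+ (w - u) * (q * (tau N E w)%:R * rF u w.+1) * x w.
  case: u uN @rF shift => [|u] uN rF shift.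
    rewrite big_ltn // mulr0 !add0r big_add1 /= shift //.
    apply: eq_bigr => w _; rewrite !subn0 exprS /q; ring.
  rewrite big_add1 /= shift ?(ltnW uN) // [LHS]big_ltn ?ltnS ?(ltnW uN) //.
  rewrite subnn expr0 mul1r; congr (_ + _); first by ring.
  rewrite big_nat [RHS]big_nat; apply: eq_bigr => w /andP[uw _].
  rewrite (_ : (w.+1 - u.+1 = (w - u.+1).+1)%N) ?exprS /q; [ring|lia].
rewrite second addrCA -big_split /=.
have -> : \sum_(u <= w < N.+1)
    (z ^+ (w - u) * rF u w * ((1 + (tau N E w)%:R) * x w) +
     z ^+ (w - u) * (q * (tau N E w)%:R * rF u w.+1) * x w) =
  \sum_(u <= w < N.+1) z ^+ (w - u) * ((1 + (tau N E u)%:R) * reach b z (phi_last N E b z) u w +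
    (if u is u'.+1 then q * (tau N E u')%:R * reach b z (phi_last N E b z) u' w else 0)) * x w.
  rewrite big_nat [RHS]big_nat; apply: eq_bigr => w /andP[uw]; rewrite ltnS => wN.
  by rewrite -reach_conj ?uw // -/rF -/q; ring.
rewrite /conjugate big_distrr /=; under [X in _ = X + _]eq_bigr => w _ do rewrite kernel_reach.
case: u uN @rF shift second => [|u] uN rF _ _.
  by rewrite add0r [RHS]addr0; apply: eq_bigr => w _; rewrite /=; ring.
rewrite big_distrr /= [X in _ = _ + X]big_ltn ?ltnS ?(ltnW uN) //.
under [X in _ = _ + (_ + X)]eq_bigr => w _ do rewrite kernel_reach.
rewrite addrCA -big_split /= kernel_reach subnn expr0 mul1r.
have := @reach_diag S N E b z E0 E1 EN u.+1 uN; rewrite /= -/rF => ->.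
congr (_ + _); first by ring.
rewrite big_nat [RHS]big_nat; apply: eq_bigr => w /andP[uw _].
rewrite (_ : (w - u = (w - u.+1).+1)%N) ?exprS /q; [ring|lia].
Qed.
End KernelConjugation.

(** * From kernels to coefficients *)

Section CoefficientStep.
Variables (Q : finType) (Y : sys Q).

(** In [{poly {poly int}}] the outer ['X] is the letter variable and ['X%:P] is beta; polynomials
    suffice, as a step places letters on finitely many elements. *)
Lemma sop_coef n (v : {set Q} -> {poly int}) U :
  sop 'X Y n v U = (vstep Y ('X%:P) 'X (fun V => (v V)%:P) U)`_n.
Proof.
have -> : vstep Y ('X%:P : {poly {poly int}}) 'X (fun V => (v V)%:P) U =
    \sum_(p | spred Y U p) ('X ^+ sexp U p * v (snext U p))%:P * 'X^(ssize p).
  rewrite /vstep /sstep /step.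
  under eq_bigr => B _ do rewrite big_distrr /=.
  rewrite pair_big_dep /=; apply: eq_bigr => -[B C] _ /=.
  by rewrite /ssize /sexp /snext !exprD /= !rmorphM !rmorphXn /=; ring.
rewrite coef_sum /sop /coef_op big_mkcondr; apply: eq_bigr => p _.
rewrite coefCM coefXn eq_sym /swt; case: eqP => _; rewrite ?mulr1 ?mulr0 //.
Qed.

(** An empty element below a member of [U] can never receive a letter, so no run completes from
    there. *)
Lemma foldr_sop_closed (e : seq nat) U : foldr (sop 'X Y) (sfinal {poly int}) e U != 0 ->
  forall s t, srel Y s t -> t \in U -> s \in U.
Proof.
elim: e U => [|n e IHe] U /=.
  rewrite /sfinal; case: (U =P [set: Q]) => [-> _ s t _|_]; last by rewrite eqxx.
  by rewrite !inE.
move=> h s t cst tU; apply: contraNT h => sU; apply/eqP.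
rewrite /sop /coef_op big1 // => -[B C] /andP[/andP[/legalP[_ n1 _] /legalP[_ n2 _]] _].
rewrite /= in n1 n2 *.
have [->|/IHe/(_ s t cst)] := eqVneq (foldr (sop 'X Y) (sfinal {poly int}) e (snext U (B, C))) 0.
  by rewrite mulr0.
rewrite /snext !inE tU => /(_ isT) /orP[/orP[sU'|sB]|sC].
- by rewrite sU' in sU.
- by have := n1 s t sB tU; rewrite cst.
- by have := n2 s t sC; rewrite inE tU cst => /(_ isT).
Qed.
End CoefficientStep.

Lemma closed_seg N (U : {set 'I_N}) :
    (forall s t, succ_rel N s t -> t \in U -> s \in U) ->
  exists2 k, (k <= N)%N & U = seg N k.
Proof.
move=> cl; have down (t : 'I_N) : t \in U -> forall s : 'I_N, (s <= t)%N -> s \in U.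
  move=> tU s st; have [n en] : exists n, (t - s)%N = n by exists (t - s)%N.
  elim: n s st en => [|n IHn] s st en.
    by rewrite (_ : s = t) //; apply: val_inj => /=; lia.
  have sN : (s.+1 < N)%N by have := ltn_ord t; lia.
  apply: (cl s (Ordinal sN)); first by rewrite /succ_rel.
  by apply: IHn => /=; lia.
exists #|U|; first by rewrite -[X in (_ <= X)%N]card_ord max_card.
have cseg k : (k <= N)%N -> #|seg N k| = k.
  move=> kN; have -> : seg N k = itv N 0 k by apply/setP => x; rewrite !inE.
  by rewrite card_itv // subn0.
have cU : (#|U| <= N)%N by rewrite -[X in (_ <= X)%N]card_ord max_card.
apply/esym/eqP; rewrite eqEcard cseg // leqnn andbT; apply/fintype.subsetP => x; rewrite inE => xU.
apply/negPn/negP => nx; have : U \subset seg N x.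
  apply/fintype.subsetP => t tU; rewrite inE ltnNge; apply: contra nx => xt.
  exact: down tU _ xt.
by move/subset_leq_card; rewrite cseg ?(ltnW (ltn_ord x)) // leqNgt xU.
Qed.

Lemma foldr_sop_chain N (Y : sys 'I_N) (phi : nat -> nat -> {poly {poly int}}) n e u :
    (forall i j, srel Y i j = succ_rel N i j) ->
    (forall s t, srel Y s t -> spair Y false s t -> ~~ spair Y true s t) ->
    (u <= N)%N -> (forall l, phi l l = 1) ->
    (forall l h, (l < h <= N)%N ->
       \prod_(x in itv N l h) letter_wt Y 'X%:P 'X (itv N l h) x = phi l h) ->
  foldr (sop 'X Y) (sfinal {poly int}) (n :: e) (seg N u) =
  (\sum_(u <= w < N.+1) kernel ('X%:P) 'X phi u w *
     (foldr (sop 'X Y) (sfinal {poly int}) e (seg N w))%:P)`_n.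
Proof.
move=> relY excl uN phi1 hphi; rewrite [LHS]/= sop_coef.
rewrite (@vstep_chain _ _ _ _ _ relY excl phi) // => U; rewrite polyC_eq0 => h.
apply: closed_seg => s t cst; apply: (foldr_sop_closed h); by rewrite relY.
Qed.

Lemma sys_series_relabel (Q : finType) (f : Q -> Q) (Y Y' : sys Q) : involutive f ->
    (forall q r, srel Y' q r = srel Y (f q) (f r)) ->
    (forall p q, smark Y' p q = smark Y p (f q)) ->
    (forall p q r, srel Y' q r -> spair Y' p q r = spair Y p (f q) (f r)) ->
  sys_series Y' = sys_series Y.
Proof.
move=> fK hr hm hp; apply/funext => m; rewrite /sys_series /genseries.
pose h (sg : {ffun Q -> {fset marked}}) : {ffun Q -> {fset marked}} := [ffun q => sg (f q)].
have hK : involutive h by move=> sg; apply/ffunP => q; rewrite !ffunE fK.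
have hmon sg : part_mon (h sg) = part_mon sg.
  rewrite /part_mon [RHS](reindex_inj (inv_inj fK)).
  by apply: eq_bigr => q _; rewrite ffunE.
have hval sg : sys_valid Y' sg <-> sys_valid Y (h sg).
  split=> -[h1 h2 h3 h4]; split.
  - by move=> q; rewrite ffunE.
  - by move=> x q; rewrite ffunE => /h2; rewrite hm fK.
  - by move=> q r qr; rewrite !ffunE; apply: h3; rewrite hr !fK.
  - move=> x q r qr; rewrite !ffunE => xq xr.
    have qr' : srel Y' (f q) (f r) by rewrite hr !fK.
    by have := h4 x _ _ qr' xq xr; rewrite hp // !fK.
  - by move=> q; have := h1 (f q); rewrite ffunE fK.
  - by move=> x q xq; rewrite hm; apply: h2; rewrite ffunE fK.
  - by move=> q r; rewrite hr => /h3; rewrite !ffunE !fK.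
  - move=> x q r qr xq xr; rewrite hp //; apply: h4; rewrite -?hr // ffunE fK //.
rewrite (@reindex_fsbig _ _ _ _ _ h [set sg | sys_valid Y' sg /\ part_mon sg = m]%classic
  [set sg | sys_valid Y sg /\ part_mon sg = m]%classic).
  by apply: eq_fsbigr => sg _; rewrite !part_cardE hmon.
split.
- by move=> sg /= [/hval vs <-]; rewrite hmon.
- by move=> sg sg' _ _; exact: (inv_inj hK).
- move=> sg /= [vs ms]; exists (h sg); last exact: hK.
  by split; [apply/hval; rewrite hK|rewrite hmon].
Qed.

(** * Reversal and comparison of chains *)

Section ChainSystems.
Variable N : nat.
Implicit Types D E : pred nat.

Lemma eq_chain_label D D' : (forall t, (0 < t < N)%N -> D t = D' t) ->
  chain_label N D = chain_label N D'.
Proof.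
move=> e; apply/funext => i; apply: eq_bigr => k _; rewrite e //.
by rewrite ltn0Sn (leq_ltn_trans _ (ltn_ord i)).
Qed.

Lemma eq_chainK D D' : (forall t, (0 < t < N)%N -> D t = D' t) -> chainK N D = chainK N D'.
Proof. by move=> e; rewrite /chainK (eq_chain_label e). Qed.

Lemma eq_chainKbar D D' : (forall t, (0 < t < N)%N -> D t = D' t) ->
  chainKbar N D = chainKbar N D'.
Proof.
move=> e; rewrite /chainKbar (eq_chain_label e); congr bar_sys.
apply/funext => i; case: (posnP i) => //= i0.
by rewrite e // i0 ltn_ord.
Qed.

(** The reversal of a bar chain, with elements renumbered backwards. The shifts in [E] come from
    setting [E t = D (N + 1 - t)], the descent set of the flat composition, instead of the plain
    reversal [D (N - t)]. *)
Definition chain_last E : sys 'I_N := Sys (succ_rel N)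
  (fun p i => ~~ p || ~~ ((i.+1 == N :> nat) || E i.+2)) (fun p _ j => ~~ p && ~~ E j.+1).

Lemma succ_rev_ord (i j : 'I_N) : succ_rel N i j = succ_rel N (rev_ord j) (rev_ord i).
Proof.
rewrite /succ_rel /=; have := ltn_ord i; have := ltn_ord j.
by move=> jN iN; apply/eqP/eqP; lia.
Qed.

(** Walking the chain backwards turns descents of the labels into ascents, which complements the
    descent set. *)
Lemma rho_chainK D :
  rho (sys_series (chainK N D)) = sys_series (chainK N (fun t => ~~ D (N - t)%N)).
Proof.
rewrite rho_sys_series; apply/esym/(sys_series_relabel rev_ordK) => // [i j|p i j ij].
  exact: succ_rev_ord.
rewrite /= (chain_label_lt _ ij) (chain_label_gt _ ij).
have ji : succ_rel N (rev_ord j) (rev_ord i) by rewrite -succ_rev_ord.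
rewrite (chain_label_lt _ ji) (chain_label_gt _ ji) negbK /= (eqP ij : j = i.+1 :> nat).
by case: p.
Qed.

Lemma rho_chainKbar D :
  rho (sys_series (chainKbar N D)) = sys_series (chain_last (fun t => D (N.+1 - t)%N)).
Proof.
rewrite rho_sys_series; apply/esym/(sys_series_relabel rev_ordK) => [i j|p i|p i j ij].
- exact: succ_rev_ord.
- rewrite /= subSS; congr (_ || ~~ (_ || _)); have := ltn_ord i; move=> iN.
  by apply/eqP/eqP; lia.
have ji : succ_rel N (rev_ord j) (rev_ord i) by rewrite -succ_rev_ord.
by rewrite /= (chain_label_lt _ ji) /= subSS (eqP ij : j = i.+1 :> nat).
Qed.

Lemma chainK_peaks D D' :
    (forall t, (0 < t)%N -> (t.+1 < N)%N -> (~~ D t && D t.+1) = (~~ D' t && D' t.+1)) ->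
  sys_series (chainK N D) = sys_series (chainK N D').
Proof.
move=> e; apply: pseries_ext => s; rewrite !sys_series_emon -(seg0 N).
have uN : (0 <= N)%N by [].
pose phi D0 l h : {poly {poly int}} := if (l < h)%N then
  (nop (fun x => ~~ D0 x && D0 x.+1) l h.-1)%:R * (2 + 'X%:P * 'X) else 1.
have step D0 n s' u : (u <= N)%N ->
    foldr (sop 'X (chainK N D0)) (sfinal {poly int}) (n :: s') (seg N u) =
    (\sum_(u <= w < N.+1) kernel ('X%:P) 'X (phi D0) u w *
     (foldr (sop 'X (chainK N D0)) (sfinal {poly int}) s' (seg N w))%:P)`_n.
  move=> uN'; apply: foldr_sop_chain => // [i j ij|l|l h /andP[lh hN]].
  - by rewrite /= (chain_label_lt _ ij) (chain_label_gt _ ij) negbK.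
  - by rewrite /phi ltnn.
  rewrite (@letter_wt_itv _ ('X%:P * 'X) xpredT xpredT D0 (predC D0)) //.
  - case: h lh hN => // h lh hN.
    by rewrite itv_wt_peak // /phi lh.
  - by move=> i j ij; rewrite /= (chain_label_gt _ ij).
  - by move=> i j ij; rewrite /= (chain_label_lt _ ij).
elim: s (0%N) uN => [//|n s IHs] u uN; rewrite !step //; apply: (congr1 (fun p : {poly {poly int}} => p`_n)).
rewrite big_nat [RHS]big_nat; apply: eq_bigr => w /andP[uw wN]; rewrite IHs //.
congr (_ * _); rewrite /kernel.
have ephi l : phi D l w = phi D' l w.
  rewrite /phi; case: ifP => // lw; congr (_%:R * _); congr nat_of_bool.
  by apply: eq_nop => x hx; apply: e; lia.
by rewrite !ephi.
Qed.

Lemma chainKbar_last E :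
    ~~ E 0%N -> ~~ E 1%N -> (forall x, E x -> ~~ E x.+1) -> (forall x, E x -> (x < N)%N) ->
  sys_series (chain_last E) = sys_series (chainKbar N E).
Proof.
move=> E0 E1 ES EN; apply: pseries_ext => s; rewrite !sys_series_emon -(seg0 N).
pose x s u := foldr (sop 'X (chain_last E)) (sfinal {poly int}) s (seg N u).
have stepL n s' u : (u <= N)%N -> x (n :: s') u =
    (\sum_(u <= w < N.+1) kernel ('X%:P) 'X (phi_last N E 'X%:P 'X) u w * (x s' w)%:P)`_n.
  move=> uN'; apply: foldr_sop_chain => // [l|l h /andP[lh hN]].
  - by rewrite /phi_last ltnn.
  rewrite (@letter_wt_itv _ ('X%:P * 'X) xpredT
     (fun x => ~~ ((x.+1 == N) || E x.+2)) (predC (E \o succn)) xpred0) //.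
  case: h lh hN => // h lh hN.
  by rewrite itv_wt_last // /phi_last lh /gap_free /= ltnS.
have stepF n s' u : (u <= N)%N ->
    foldr (sop 'X (chainKbar N E)) (sfinal {poly int}) (n :: s') (seg N u) =
    (\sum_(u <= w < N.+1) kernel ('X%:P) 'X (phi_first E 'X%:P 'X) u w *
       (foldr (sop 'X (chainKbar N E)) (sfinal {poly int}) s' (seg N w))%:P)`_n.
  move=> uN'; apply: foldr_sop_chain => // [l|l h /andP[lh hN]].
  - by rewrite /phi_first ltnn.
  rewrite (@letter_wt_itv _ ('X%:P * 'X)
     (fun x => ~~ ((x == 0%N) || E x)) xpredT xpred0 (predC E)) //.
  - case: h lh hN => // h lh hN.
    by rewrite itv_wt_first // /phi_first lh /gap_free /= orbA ltnS.
  - by move=> i j ij; rewrite /= (chain_label_lt _ ij).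
(* Since [tau 0] is false, conjugation does not change the entry at [u = 0], which is the
   coefficient sought. *)
suff key u : (u <= N)%N -> foldr (sop 'X (chainKbar N E)) (sfinal {poly int}) s (seg N u) =
    conjugate N E 'X (x s) u.
  by rewrite key // /conjugate /tau /= mulr0n !addr0 mul1r.
elim: s u => [|n s IHs] u uN.
  (* The final vector is the indicator of [N]; it is fixed by conjugation because [tau N] is
     false. *)
  have sE w : (w <= N)%N -> sfinal {poly int} (seg N w) = (w == N)%:R.
    move=> wN; rewrite /sfinal -(segN N); congr (nat_of_bool _)%:R.
    by apply/eqP/eqP => [/(seg_inj wN (leqnn N))//|->].
  rewrite /conjugate /x /= sE // [X in _ + X](_ : _ = 0) ?addr0.
    by rewrite /tau; case: (eqVneq u N) => [->|]; rewrite ?ltnn /= ?andbF ?addr0 ?mul1r ?mulr0.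
  by case: u uN => // u uN; rewrite sE ?(ltnW uN) // ltn_eqF // mulr0.
rewrite stepF //.
have -> : \sum_(u <= w < N.+1) kernel ('X%:P) 'X (phi_first E 'X%:P 'X) u w *
     (foldr (sop 'X (chainKbar N E)) (sfinal {poly int}) s (seg N w))%:P =
   \sum_(u <= w < N.+1) kernel ('X%:P) 'X (phi_first E 'X%:P 'X) u w *
     conjugate N E 'X%:P (fun w => (x s w)%:P) w.
  rewrite big_nat [RHS]big_nat; apply: eq_bigr => w /andP[_ wN]; rewrite IHs //; congr (_ * _).
  rewrite /conjugate rmorphD rmorphM rmorphD rmorph1 rmorph_nat; congr (_ + _).
  by case: w {wN} => [|w]; rewrite ?rmorph0 // !rmorphM rmorph_nat.
rewrite kernel_conj // /conjugate coefD.
have cE (k : nat) : (k%:R : {poly {poly int}}) = (k%:R)%:P by rewrite rmorph_nat.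
congr (_ + _).
  by rewrite !cE -[1]/(1%:P) -polyCD coefCM stepL.
case: u uN => [|u] uN; first by rewrite coef0.
by rewrite cE -polyCM coefCM stepL // ltnW.
Qed.
End ChainSystems.

(** * Peak compositions and their flats *)

Lemma peak_descents a (D := mem (descents a)) : is_peak a ->
  (forall t, D t -> (1 < t < sumn a)%N) /\ (forall t, D t -> ~~ D t.+1).
Proof.
move=> pa; have /andP[ca _] := pa; split=> t.
  rewrite /D /= => dt; have := dt; rewrite mem_descents // => /andP[/andP[_ ->] _].
  rewrite andbT; move: dt; elim: a {D ca} pa t => [|x [|y s] IHs] //= pa t.
  rewrite descents_cons inE => /orP[/eqP ->|/mapP[i di ->]].
    by case/andP: pa => _ /andP[].
  case/andP: pa => _ /andP[x2 _]; lia.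
rewrite /D /=; elim: a {D ca} pa t => [|x [|y s] IHs] // pa t.
have pa' : is_peak (y :: s).
  by move: pa; rewrite /is_peak /= => /andP[/andP[_ ->] /andP[_ ->]].
have d2 : forall i, i \in descents (y :: s) -> (1 < i)%N.
  elim: (y :: s) pa' {IHs pa t} => [|x' [|y' s'] IHs] //= pa t.
  rewrite descents_cons inE => /orP[/eqP ->|/mapP[i di ->]].
    by case/andP: pa => _ /andP[].
  case/andP: pa => _ /andP[x2 _]; lia.
rewrite descents_cons !inE => /orP[/eqP ->|/mapP[i di ->]].
  rewrite negb_or (_ : (x.+1 == x) = false) /=; last by lia.
  by apply/mapP => -[i /d2 i2 e]; lia.
have i2 := d2 _ di; rewrite negb_or (_ : (_ == x) = false) /=; last by lia.
apply/mapP => -[j dj e]; have ej : j = i.+1 by lia.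
by have := IHs pa' i di; rewrite -ej dj.
Qed.

(** The flat is the reversal with one unit moved from the last part to the first, which shifts every
    proper partial sum by one. *)
Lemma descents_flat a : is_peak a -> (2 <= size a)%N ->
  sumn (flat a) = sumn a /\ descents (flat a) = map succn (descents (rev a)).
Proof.
case: a => [|a1 [|b s]] // pa _.
have er : rev (a1 :: b :: s) = last b s :: rcons (rev (belast b s)) a1.
  by rewrite rev_cons lastI rev_rcons.
have a10 : (0 < a1)%N by case/andP: pa => /andP[].
split.
  rewrite -[RHS]sumn_rev er /= -!cats1 !sumn_cat /=; lia.
rewrite er -[flat _]/((last b s).+1 :: rcons (rev (belast b s)) a1.-1).
move: (last b s) (rev _) => c m; rewrite /descents -map_comp.
have -> : size (c.+1 :: rcons m a1.-1) = size (c :: rcons m a1) by rewrite /= !size_rcons.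
apply/eq_in_map => -[|k]; rewrite mem_iota => /andP[// _]; rewrite /= size_rcons => km.
by rewrite -!cats1 !takel_cat //; lia.
Qed.

Lemma mem_descents_flat a t : is_peak a -> (0 < t < sumn a)%N ->
  (t \in descents (flat a)) = (((sumn a).+1 - t)%N \in descents a).
Proof.
move=> pa ht; have /andP[ca _] := pa.
have [hD _] := peak_descents pa.
case: (ltnP 1 (size a)) => [sa|]; last by case: a {pa ca hD} ht => [|x []] //=.
have [_ ->] := descents_flat pa sa; case: t ht => // t ht.
rewrite mem_map; last exact: succn_inj.
rewrite subSS; case: t ht => [|t] ht.
  rewrite subn0 mem_descents ?is_comp_rev //=; apply/esym/negP => /hD; lia.
by rewrite mem_descents_rev //; lia.
Qed.

Lemma sumn_flat a : is_peak a -> sumn (flat a) = sumn a.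
Proof.
move=> pa; case: (ltnP 1 (size a)) => [sa|]; first by have [] := descents_flat pa sa.
by case: a {pa} => [|x []].
Qed.

Section PeakComposition.
Variable a : seq nat.
Hypothesis pa : is_peak a.
Let D : pred nat := mem (descents a).
Let N := sumn a.
Let E : pred nat := fun t => D (N.+1 - t)%N.

Lemma flat_peak_facts : [/\ ~~ E 0%N, ~~ E 1%N, forall x, E x -> ~~ E x.+1 &
  forall x, E x -> (x < N)%N].
Proof.
have [hD hS] := peak_descents pa; split.
- by rewrite /E subn0; apply/negP => /hD; rewrite /N; lia.
- by rewrite /E subSS subn0; apply/negP => /hD; rewrite /N; lia.
- move=> x Ex; have := hD _ Ex => hx; apply/negP => Ex1.
  have e : (N.+1 - x.+1).+1 = (N.+1 - x)%N by lia.
  by have := hS _ Ex1; rewrite e => /negP; apply; exact: Ex.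
- by move=> x /hD; lia.
Qed.

Lemma mpeakK_flat : mpeakK (flat a) = sys_series (chainK N E).
Proof.
rewrite mpeakK_sys sumn_flat //; congr sys_series; apply: eq_chainK => t ht.
by rewrite /= mem_descents_flat.
Qed.

Lemma mpeakKbar_flat : mpeakKbar (flat a) = sys_series (chainKbar N E).
Proof.
rewrite mpeakKbar_sys sumn_flat //; congr sys_series; apply: eq_chainKbar => t ht.
by rewrite /= mem_descents_flat.
Qed.

Lemma rho_mpeakK : rho (mpeakK a) = mpeakK (flat a).
Proof.
have [hD hS] := peak_descents pa; have [_ _ ES _] := flat_peak_facts.
rewrite mpeakK_flat mpeakK_sys rho_chainK; apply: chainK_peaks => t t0 tN.
(* Both peak conditions reduce to [D (N - t)], because [D] contains no two consecutive positions. *)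
rewrite negbK -/D -/N /E subSS; case: (boolP (D (N - t)%N)) => Dt; last by rewrite andbF.
have e1 : (N - t)%N = (N - t.+1).+1 by rewrite -subSS subSn // ltnW.
have -> : ~~ D (N - t.+1)%N by apply: contraL Dt => /hS; rewrite e1.
by rewrite (_ : (N.+1 - t = (N - t).+1)%N) ?hS // subSn //; lia.
Qed.

Lemma rho_mpeakKbar : rho (mpeakKbar a) = mpeakKbar (flat a).
Proof.
have [E0 E1 ES EN] := flat_peak_facts.
by rewrite mpeakKbar_flat mpeakKbar_sys rho_chainKbar chainKbar_last.
Qed.
End PeakComposition.

Lemma psi_chainK N D : psi (sys_series (chainK N D)) = at_geom (sys_series (chainK N D)).
Proof. by apply: psi_label_sys => s t; exact: chain_label_neq. Qed.

Lemma psi_chainKbar N (D : pred nat) :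
    ~~ D 1%N -> (forall t, D t -> ~~ D t.+1) ->
  psi (sys_series (chainKbar N D)) = at_geom (sys_series (chainKbar N D)).
Proof.
move=> D1 DS; apply: psi_bar_sys => s t st.
- exact: chain_label_neq.
- by rewrite (chain_label_gt _ st) (eqP st : t = s.+1 :> nat).
rewrite (eqP st : t = s.+1 :> nat) /= => Ds; rewrite negb_or; apply/andP; split.
  by apply: contraTneq Ds => ->.
by apply: contraL Ds => /DS.
Qed.

Theorem proposition6p4 (a : seq nat) (ha : is_peak a)
    (disp : Order.disp_t) (P : finPOrderType disp) (gamma : P -> int)
    (hgamma : injective gamma) :
  [/\ omega (mpeakK a) = at_geom (mpeakK (flat a)),
      psi (mpeakK a) = at_geom (mpeakK a) &
      rho (mpeakK a) = mpeakK (flat a)] /\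
  [/\ omega (@Omega _ P gamma) = at_geom (@Omega _ (P^d)%type gamma),
      psi (@Omega _ P gamma) = at_geom (@Omega _ P gamma) &
      rho (@Omega _ P gamma) = @Omega _ (P^d)%type gamma] /\
  [/\ omega (mpeakKbar a) = at_geom (mpeakKbar (flat a)),
      psi (mpeakKbar a) = at_geom (mpeakKbar a) &
      rho (mpeakKbar a) = mpeakKbar (flat a)].
Proof.
have [hD hS] := peak_descents ha; have [_ E1 ES _] := flat_peak_facts ha.
split; [|split]; split.
- rewrite omega_psi_rho ?rho_mpeakK //; last by rewrite mpeakK_sys; exact: sys_series_mQSym.
  by rewrite mpeakK_sys psi_chainK.
- by rewrite mpeakK_sys psi_chainK.
- exact: rho_mpeakK.
- rewrite omega_psi_rho ?rho_Omega //; last by rewrite Omega_sys //; exact: sys_series_mQSym.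
  exact: psi_Omega.
- exact: psi_Omega.
- exact: rho_Omega.
- rewrite omega_psi_rho ?rho_mpeakKbar //; last by rewrite mpeakKbar_sys; exact: sys_series_mQSym.
  by rewrite mpeakKbar_flat // psi_chainKbar.
- rewrite mpeakKbar_sys psi_chainKbar //; by apply/negP => /hD; lia.
- exact: rho_mpeakKbar.
Qed.
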